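(* There is a positive constant $C=C(d)$, depending only on $d$, such that every solution $u$ to the heat equation $\partial_tu=\triangle u$ on $\mathbb{R}^+\times\mathbb{R}^d$, $u(0,\cdot)\in L^2(\mathbb{R}^d)$, with $\int_{\mathbb{R}^d}(1+|x|)^2|u(0,x)|^2\,dx<\infty$, has the following property: given $T>0$, $N>0$ and $r\ge1$, there is $R(\cdot)\in L^2(\mathbb{R}^d)$ with $$\|R(\cdot)\|\le C\left(1+(TN^2)^{-\frac d4}\right)\Big(e^{-TN^2}+(1+T^{\frac d2})(1+T^{-\frac12})\,r^{-1}\Big)\Big(\int_{\mathbb{R}^d}(1+|x|)^2|u(0,x)|^2\,dx\Big)^{1/2}$$ such that $$u(T,\cdot)=\sum_{n\in\mathbb{Z}^d,\,|n/N|<r}u(T,n/N)\,f_{N,n}(\cdot)+R(\cdot)\quad\text{in } L^2(\mathbb{R}^d).$$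
   Context: $d\ge1$ is an integer; $\|\cdot\|$ is the norm of $L^2(\mathbb{R}^d)$ and $|\cdot|$ the Euclidean norm. For $N>0$ and $n\in\mathbb{Z}^d$, $f_{N,n}(x)=\prod_{j=1}^d\frac{\sin\pi(Nx_j-n_j)}{\pi(Nx_j-n_j)}$ (with value $1$ for a factor whose denominator vanishes). Solutions to the heat equation are $u(t,\cdot)=e^{t\triangle}u(0,\cdot)$, with $\{e^{t\triangle}\}_{t\ge0}$ the heat semigroup on $L^2(\mathbb{R}^d)$; $u(T,\cdot)$ is smooth for $T>0$. *)

(* Defs.v *)
From HB Require Import structures.
From mathcomp Require Import all_boot all_order all_algebra.
From mathcomp Require Import all_classical all_reals all_analysis.
Set Implicit Arguments.
Unset Strict Implicit.
Unset Printing Implicit Defensive.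
Import Order.TTheory GRing.Theory Num.Theory.
Import numFieldNormedType.Exports.

Local Open Scope classical_set_scope.
Local Open Scope ring_scope.

(* The measurable structure on tuples is the product sigma-algebra of the Borel
   sigma-algebras of the coordinates, i.e. the Borel sigma-algebra of R^d. *)
Notation Rd R d := (d.-tuple (measurableTypeR R)).

Section LebesgueMeasureRd.
Context {R : realType}.
Implicit Types n : nat.

Definition consRd n (p : measurableTypeR R * Rd R n) : Rd R n.+1 :=
  [tuple of p.1 :: p.2].

Lemma measurable_consRd n : measurable_fun setT (@consRd n).
Proof. exact: measurable_cons. Qed.

Section step.
Context n (m : {sigma_finite_measure set (Rd R n) -> \bar R}).
Local Open Scope ereal_scope.

Definition lebesgue_step : set (Rd R n.+1) -> \bar R :=
  pushforward (lebesgue_measure \x m) (@consRd n).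

Let step0 : lebesgue_step set0 = 0.
Proof. by rewrite /lebesgue_step /pushforward preimage_set0 measure0. Qed.

Let step_ge0 A : 0 <= lebesgue_step A.
Proof. by rewrite /lebesgue_step /pushforward; exact: measure_ge0. Qed.

Let step_sigma_additive : semi_sigma_additive lebesgue_step.
Proof.
move=> F mF tF mUF; rewrite /lebesgue_step /pushforward preimage_bigcup.
have mc A : measurable A -> measurable (@consRd n @^-1` A).
  by move=> mA; rewrite -[X in measurable X]setTI; exact: measurable_consRd.
apply: measure_semi_sigma_additive.
- by move=> k; exact: mc.
- apply/trivIsetP => /= i j _ _ ij; rewrite -preimage_setI.
  by move/trivIsetP : tF => /(_ _ _ _ _ ij) ->//; rewrite preimage_set0.
- by rewrite -preimage_bigcup; exact: mc.
Qed.

HB.instance Definition _ := isMeasure.Build _ _ _ lebesgue_step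
  step0 step_ge0 step_sigma_additive.

Let step_sigma_finite : sigma_finite setT lebesgue_step.
Proof.
have /sigma_finiteP[F [TF ndF Foo]] := sigma_finiteT (@lebesgue_measure R).
have /sigma_finiteP[G [TG ndG Goo]] := sigma_finiteT m.
pose g (x : Rd R n.+1) : measurableTypeR R * Rd R n :=
  (thead x, [tuple of behead x]).
have mg : measurable_fun setT g.
  apply/measurable_fun_pairP; split => /=.
    exact: measurable_tnth.
  exact: measurable_behead.
exists (fun k => g @^-1` (F k `*` G k)).
  apply/esym; rewrite -subTset => x _.
  have [i _ Fi] : (\bigcup_k F k) (g x).1 by rewrite -TF.
  have [j _ Gj] : (\bigcup_k G k) (g x).2 by rewrite -TG.
  exists (maxn i j) => //; split.
    by move: Fi; exact/subsetPset/ndF/leq_maxl.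
  by move: Gj; exact/subsetPset/ndG/leq_maxr.
move=> k; have [mFk Fk] := Foo k; have [mGk Gk] := Goo k; split.
  by rewrite -[X in measurable X]setTI; apply: mg => //; exact: measurableX.
rewrite /lebesgue_step /pushforward -comp_preimage.
rewrite (_ : g \o @consRd n = id); last first.
  apply/funext => -[a x]; rewrite /g /consRd/= theadE.
  by congr pair; exact/val_inj.
by rewrite preimage_id product_measure1E// lte_mul_pinfty// ge0_fin_numE.
Qed.

HB.instance Definition _ := Measure_isSigmaFinite.Build _ _ _ lebesgue_step
  step_sigma_finite.

End step.

Fixpoint lebesgue_measureRd n : {sigma_finite_measure set (Rd R n) -> \bar R} :=
  if n is n'.+1 then
    [the {sigma_finite_measure set _ -> \bar R} of
      lebesgue_step (lebesgue_measureRd n')]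
  else
    [the {sigma_finite_measure set _ -> \bar R} of \d_([tuple] : Rd R 0)].

Lemma lebesgue_measureRd_box n (A : 'I_n -> set (measurableTypeR R)) :
  (forall i, measurable (A i)) ->
  lebesgue_measureRd n [set x | forall i, A i (tnth x i)] =
  (\prod_(i < n) lebesgue_measure (A i))%E.
Proof.
elim: n A => [|n IH] A mA /=.
  rewrite big_ord0 diracE mem_set//= => -[]//.
rewrite /lebesgue_step /pushforward big_ord_recl -(IH (fun i => A (lift ord0 i)))//.
rewrite (_ : _ @^-1` _ =
  A ord0 `*` [set x | forall i, A (lift ord0 i) (tnth x i)]); last first.
  apply/seteqP; split => -[a x] /=.
    move=> h; split => [|i]; first by have := h ord0.
    by have := h (lift ord0 i); rewrite tnthS.
  move=> [Aa h] i; case: (unliftP ord0 i) => [j ->|->//].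
  by rewrite tnthS.
rewrite product_measure1E//.
rewrite (_ : [set x | _] =
  \bigcap_(i : 'I_n) ((@tnth n _ ^~ i) @^-1` A (lift ord0 i))); last first.
  by apply/seteqP; split => x /= h i => [_|]; exact: h.
apply: fin_bigcap_measurable => // i _.
by rewrite -[X in measurable X]setTI; exact: measurable_tnth.
Qed.

End LebesgueMeasureRd.

Section SamplingHeat.
Context {R : realType} {d : nat}.
Implicit Types (t N r : R) (x y z : Rd R d) (n : d.-tuple int).

Definition enorm x : R := Num.sqrt (\sum_(i < d) (tnth x i : R) ^+ 2).

Definition subRd x y : Rd R d := [tuple (tnth x i : R) - tnth y i | i < d].

Definition heat_kernel t z : R :=
  (4 * pi * t) `^ (- (d%:R / 2)) * expR (- (enorm z ^+ 2 / (4 * t))).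

(* For t > 0 and f in L^2 the integrand is integrable for every x, so this
   is the smooth representative of e^{t Laplacian} f, defined pointwise. *)
Definition heat_semigroup t (f : Rd R d -> R) : Rd R d -> R := fun x =>
  if t == 0 then f x
  else \int[lebesgue_measureRd d]_y (heat_kernel t (subRd x y) * f y).

Definition heat_solution (u : R -> Rd R d -> R) :=
  u 0 \in Lfun (lebesgue_measureRd d) 2%:E /\
  forall t, 0 <= t -> u t = heat_semigroup t (u 0).

Definition lattice_point N n : Rd R d := [tuple (tnth n i)%:~R / N | i < d].

Definition sampling_fun N n x : R :=
  \prod_(j < d) let s : R := pi * (N * tnth x j - (tnth n j)%:~R) in
    if s == 0 then 1 else sin s / s.

Definition lattice_ball N r : set (d.-tuple int) :=
  [set n | enorm (lattice_point N n) < r].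

(* Finiteness matters: a sum over an infinite support is 0 by convention. *)
Lemma finite_lattice_ball N r : 0 < N -> finite_set (lattice_ball N r).
Proof.
move=> N0; pose M := (Num.truncn (r * N)).+1.
pose f (k : d.-tuple 'I_(M + M).+1) : d.-tuple int :=
  [tuple (tnth k i)%:Z - M%:Z | i < d].
apply: (@sub_finite_set _ _ (f @` setT)); last first.
  by apply: finite_image; exact: finite_finset.
move=> n /= nr.
have bnd i : (`|tnth n i| <= M%:Z)%R.
  have h : `|(tnth n i)%:~R / N : R| < r.
    apply: le_lt_trans nr; rewrite -sqrtr_sqr ler_wsqrtr//.
    rewrite (bigD1 i)//= tnth_mktuple lerDl.
    by apply: sumr_ge0 => j _; exact: sqr_ge0.
  move: h; rewrite normrM normfV (gtr0_norm N0) ltr_pdivrMr// => h.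
  rewrite -(ler_int R) intr_norm (le_trans (ltW h))//.
  by rewrite ltW// /M -pmulrn; exact: truncnS_gt.
exists [tuple inord `|(tnth n i + M%:Z)%R|%N | i < d] => //.
apply: eq_from_tnth => i; rewrite !tnth_mktuple.
have /andP[b1 b2] : (- M%:Z <= tnth n i <= M%:Z)%R by rewrite -ler_norml.
have b3 : (0 <= tnth n i + M%:Z)%R by rewrite -lerBlDr sub0r.
rewrite inordK; first by rewrite gez0_abs// addrK.
by rewrite ltnS -lez_nat gez0_abs// PoszD lerD2r.
Qed.

End SamplingHeat.

(* Main.v *)
(* In one variable and in units where N = 1, let G have Fourier transform
   max(exp(-tau q^2) - exp(-tau pi^2), 0), with tau = T N^2.  It is
   band-limited to [-pi, pi], hence reproduced exactly by its sinc series, and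
   it differs from the heat kernel by O(exp(-tau)) times the sum of two Cauchy
   kernels: the difference solves a first-order linear ODE in x with an
   O(exp(-tau pi^2)) forcing term, which a barrier controls.  For tau < 1 one
   simply takes G = 0.

   Let w = G_N * u(0) and h = u(T) - w, with G_N the d-fold product of rescaled
   copies of G.  Then R is the limit of h plus the sinc combinations whose
   coefficients are -h at the nodes inside the ball of radius r and w = u(T) - h
   at those outside.  Sinc combinations obey a Bessel inequality, so it is
   enough to bound h in L^2, h on the lattice in l^2, and u(T) on the lattice
   outside the ball in l^2.  All three follow from Schur tests with products of
   Cauchy kernels, the last one because |x| / r >= 1 there and
   |x| K(x - y) <= (O(sqrt T) + |y|) P(x - y) for the heat kernel K and such a
   product P.  Fatou's lemma passes to the limit. *)
From HB Require Import structures.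
Require Import Defs.
From mathcomp Require Import all_boot all_order all_algebra ring lra zify.
From mathcomp Require Import all_classical all_reals all_analysis measurable_realfun.
Set Implicit Arguments.
Unset Strict Implicit.
Unset Printing Implicit Defensive.
Import Order.TTheory GRing.Theory Num.Theory.
Import numFieldNormedType.Exports.

Local Open Scope classical_set_scope.
Local Open Scope ring_scope.

(** * The cardinal sine *)

(** Plancherel's theorem is never invoked. The Bessel inequality and the convergence of the sinc
    series both rest on one fact: the matrix of sinc (p_i - p_j) is positive semidefinite, being a
    Gram matrix of trigonometric functions on [0, pi]. The Gaussian is lowered by exp(-tau pi^2)
    instead of being cut off sharply because a jump at the band edge would leave a tail of order
    1/x, neither absolutely integrable nor summable, while the Schur tests need quadratic decay. The
    barrier loses a factor tau^2, absorbed by the gap between exp(-tau pi^2) and exp(-tau). The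
    factor 1 + (T N^2)^(-d/4) comes from the square root of a lattice sum: a kernel of width sqrt T
    sampled at spacing 1/N sums to O(N (1 + (T N^2)^(-1/2))) per coordinate, and the resulting N^d
    cancels against N^(-d) in the Bessel inequality. The moment argument itself yields only (1 +
    sqrt T) / r, which is dominated by the powers of T in the statement because d >= 1. *)

Lemma is_derive_ge0_le {R : realType} (f f' : R -> R) (a b : R) :
  (forall x : R, is_derive x 1 f (f' x)) -> (forall x, a < x < b -> 0 <= f' x) ->
  a <= b -> f a <= f b.
Proof.
move=> df f'0; rewrite le_eqVlt => /predU1P[->//|ab].
have cf : {within `[a, b], continuous f}.
  by apply: derivable_within_continuous => x _; exact: (@ex_derive _ _ _ _ _ _ _ (df x)).
have [c /[!in_itv]/= cab] := MVT ab (fun x _ => df x) cf.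
by rewrite -subr_ge0 => ->; rewrite mulr_ge0 ?f'0// subr_ge0 ltW.
Qed.

Section Sinc.
Context {R : realType}.
Implicit Types (x y t : R).

Definition sinc x : R := if pi * x == 0 then 1 else sin (pi * x) / (pi * x).

Let pi_neq0 : pi != 0 :> R. Proof. by rewrite gt_eqF// pi_gt0. Qed.

Lemma sinc0 : sinc 0 = 1.
Proof. by rewrite /sinc mulr0 eqxx. Qed.

Lemma sincE x : x != 0 -> sinc x = sin (pi * x) / (pi * x).
Proof. by move=> x0; rewrite /sinc mulf_eq0 (negbTE pi_neq0) (negbTE x0). Qed.

Lemma sincN x : sinc (- x) = sinc x.
Proof.
have [->|x0] := eqVneq x 0; first by rewrite oppr0.
by rewrite !sincE ?oppr_eq0// mulrN sinN invrN mulrNN.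
Qed.

Lemma sincB x y : sinc (x - y) = sinc (y - x).
Proof. by rewrite -sincN opprB. Qed.

Lemma sin_pi_nat (n : nat) : sin (pi * n%:R) = 0 :> R.
Proof.
elim: n => [|n IH]; first by rewrite mulr0 sin0.
by rewrite -natr1 mulrDr mulr1 sinDpi IH oppr0.
Qed.

Lemma sinc_nat_eq0 (m n : nat) : m != n -> sinc (m%:R - n%:R) = 0.
Proof.
wlog mn : m n / (m < n)%N => [hw|_].
  rewrite neq_ltn => /orP[mn|nm]; first by rewrite hw// neq_ltn mn.
  by rewrite sincB hw// neq_ltn nm.
rewrite sincB -natrB ?(ltnW mn)// sincE ?sin_pi_nat ?mul0r//.
by rewrite pnatr_eq0 subn_eq0 -ltnNge.
Qed.

Lemma x_cos_le_sin x : 0 <= x <= pi / 2 -> x * cos x <= sin x.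
Proof.
move=> /andP[x0 xpi].
pose f (y : R) := sin y - y * cos y.
have df (y : R) : is_derive y 1 f (y * sin y).
  by rewrite /f; apply: is_derive_eq; rewrite !scaler1 /GRing.scale/=; ring.
suff : f 0 <= f x by rewrite /f sin0 mul0r subr0 subr_ge0.
apply: (is_derive_ge0_le df) => // y /andP[y0 yx].
rewrite mulr_ge0 ?(ltW y0)// sin_ge0_pi// (ltW y0)/= (le_trans (ltW yx))//.
by rewrite (le_trans xpi)// ler_pdivrMr// ler_pMr ?pi_gt0// ler1n.
Qed.

Lemma sin_le x : 0 <= x -> sin x <= x.
Proof.
move=> x0.
pose f (y : R) := y - sin y.
have df (y : R) : is_derive y 1 f (1 - cos y).
  by rewrite /f; apply: is_derive_eq.
suff : f 0 <= f x by rewrite /f sin0 subr0 subr_ge0.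
by apply: (is_derive_ge0_le df) => // y _; rewrite subr_ge0 cos_le1.
Qed.

Lemma norm_sin_le x : 0 <= x -> `|sin x| <= x.
Proof.
move=> x0; rewrite ler_norml sin_le// andbT.
pose f (y : R) := y + sin y.
have df (y : R) : is_derive y 1 f (1 + cos y).
  by rewrite /f; apply: is_derive_eq.
suff : f 0 <= f x by rewrite /f sin0 addr0 -lerBlDl sub0r.
by apply: (is_derive_ge0_le df) => // y _; rewrite -lerBlDl sub0r cos_geN1.
Qed.

(** Squaring x cos x <= sin x and replacing cos^2 by 1 - sin^2 gives the second bound. It amounts to
    1/sin^2 <= 1/x^2 + 1: passing from the angle to its sine costs a bounded amount. *)
Lemma sin_sq_bounds x : `|x| <= pi / 2 ->
  sin x ^+ 2 <= x ^+ 2 /\ x ^+ 2 <= sin x ^+ 2 * (1 + x ^+ 2).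
Proof.
wlog x0 : x / 0 <= x => [hw|].
  have [|x0] := leP 0 x; first exact: hw.
  have := hw (- x); rewrite normrN sinN !sqrrN; apply.
  by rewrite oppr_ge0 ltW.
rewrite ger0_norm// => xpi.
have s0 : 0 <= sin x.
  by rewrite sin_ge0_pi// x0/= (le_trans xpi)// ler_pdivrMr// ler_pMr ?pi_gt0// ler1n.
have c0 : 0 <= cos x.
  by rewrite cos_ge0_pihalf// xpi andbT (le_trans _ x0)// oppr_le0 divr_ge0 ?pi_ge0.
split; first by rewrite ler_sqr ?nnegrE// sin_le.
have : (x * cos x) ^+ 2 <= sin x ^+ 2.
  by rewrite ler_sqr ?nnegrE ?mulr_ge0// x_cos_le_sin// x0.
rewrite exprMn cos2sin2; lra.
Qed.

Lemma big_even_odd (V : nmodType) (F : nat -> V) n :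
  \sum_(k < n.*2) F k = \sum_(k < n) F k.*2 + \sum_(k < n) F k.*2.+1.
Proof.
elim: n => [|n IH]; first by rewrite !big_ord0 addr0.
by rewrite doubleS 4!big_ord_recr/= IH addrACA -addrA.
Qed.

(** Let s and c be the sine and cosine of pi t / 2. Then sin (pi t) = 2 s c, and s^2 + c^2 = 1
    splits 1 / (2 s c)^2 into (1/s^2 + 1/c^2) / 4; the cosine is the sine at the shifted half
    angle. *)
Lemma inv_sin_sq_double t : sin (pi * t) != 0 ->
  [/\ sin (pi * (t / 2)) != 0, sin (pi * ((t + 1) / 2)) != 0 &
  (sin (pi * t) ^+ 2)^-1 = 4^-1 *
    ((sin (pi * (t / 2)) ^+ 2)^-1 + (sin (pi * ((t + 1) / 2)) ^+ 2)^-1)].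
Proof.
have -> : pi * t = (pi * (t / 2)) *+ 2 by rewrite -mulrnAr -mulr_natr divfK ?pnatr_eq0.
have -> : pi * ((t + 1) / 2) = pi * (t / 2) + pi / 2 by field.
rewrite sin_mulr2n sinDpihalf; set s := sin _; set c := cos _.
move=> cs.
have s0 : s != 0 by apply: contra_neq cs => ->; rewrite mulr0 mul0rn.
have c0 : c != 0 by apply: contra_neq cs => ->; rewrite mul0r mul0rn.
split=> //.
have cs1 : c ^+ 2 + s ^+ 2 = 1 by exact: cos2Dsin2.
rewrite (_ : s ^- 2 + c ^- 2 = (c ^+ 2 + s ^+ 2) / (c * s) ^+ 2); last first.
  by field; rewrite c0 s0.
by rewrite cs1 -mulr_natr; field; rewrite c0 s0.
Qed.

(* As m grows, the right-hand side becomes the sum of (pi (t + k))^-2 over all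
   integers k, that is, the sum of sinc (t + k) ^+ 2 is 1. *)
Lemma inv_sin_sq_sum (m : nat) t : sin (pi * t) != 0 ->
  (sin (pi * t) ^+ 2)^-1 = (4 ^+ m)^-1 *
    \sum_(k < 2 ^ m) (sin (pi * ((t + k%:R) / 2 ^+ m)) ^+ 2)^-1.
Proof.
elim: m t => [|m IH] t t0.
  by rewrite !expr0 expn0 big_ord1 addr0 invr1 mul1r mulr1.
have [a0 b0 ->] := inv_sin_sq_double t0.
rewrite (IH _ a0) (IH _ b0) -mulrDr mulrA -invfM -exprS; congr (_ * _).
rewrite expnS mul2n (big_even_odd (fun k => (sin (pi * ((t + k%:R) / 2 ^+ m.+1)) ^+ 2)^-1)).
congr (_ + _); apply: eq_bigr => k _; congr ((sin (pi * _) ^+ 2)^-1).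
  rewrite -muln2 natrM exprS; field.
  by rewrite expf_neq0// pnatr_eq0.
rewrite -[(_.*2).+1%:R]natr1 -muln2 natrM exprS; field.
by rewrite expf_neq0// pnatr_eq0.
Qed.

Lemma sin_sq_pi_addn n y : sin (pi * (y + n%:R)) ^+ 2 = sin (pi * y) ^+ 2.
Proof.
elim: n => [|n IH]; first by rewrite addr0.
by rewrite -natr1 addrA mulrDr mulr1 sinDpi sqrrN IH.
Qed.

(** The bound on |t + k| keeps every angle in [inv_sin_sq_sum] within pi / 2. There 1/sin^2 z <=
    1/z^2 + 1 costs at most 4^-(m+1) per term, hence 2^-(m+1) over the 2^(m+1) terms. *)
Lemma sinc_sq_window (m : nat) t : sin (pi * t) != 0 ->
  (forall k : 'I_(2 ^ m.+1), `|t + k%:R| <= 2 ^+ m) ->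
  1 - 2^- m.+1 <= \sum_(k < 2 ^ m.+1) sinc (t + k%:R) ^+ 2.
Proof.
move=> t0 tk; pose s := sin (pi * t) ^+ 2.
have s0 : 0 < s by rewrite exprn_even_gt0.
have s1 : s <= 1.
  by rewrite -(expr1n _ 2) /s -real_normK ?num_real// lerXn2r ?nnegrE// sin_max.
have tkn0 (k : nat) : t + k%:R != 0.
  apply: contra_neq t0 => tk0; have := sin_sq_pi_addn k t.
  by rewrite tk0 mulr0 sin0 expr0n/= => /esym/eqP; rewrite sqrf_eq0 => /eqP.
have step (k : 'I_(2 ^ m.+1)) :
    s * (4 ^+ m.+1)^-1 * (sin (pi * ((t + k%:R) / 2 ^+ m.+1)) ^+ 2)^-1 <=
    sinc (t + k%:R) ^+ 2 + (4 ^+ m.+1)^-1.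
  set a := t + k%:R; set z := pi * (a / 2 ^+ m.+1).
  have z0 : z != 0.
    by rewrite /z !mulf_neq0 ?invr_eq0 ?expf_neq0 ?pnatr_eq0//; exact: tkn0.
  have : `|z| <= pi / 2.
    rewrite /z normrM ger0_norm ?pi_ge0// ler_pM2l ?pi_gt0// normf_div.
    rewrite exprS (@ger0_norm _ (2 * _)) ?mulr_ge0 ?exprn_ge0//.
    rewrite ler_pdivrMr ?mulr_gt0 ?exprn_gt0// mulrA mulVf ?pnatr_eq0// mul1r.
    exact: tk.
  move=> /sin_sq_bounds[_ h].
  have sz0 : 0 < sin z ^+ 2.
    rewrite lt_neqAle sqr_ge0 andbT eq_sym; apply/negP => /eqP sz.
    by move: h; rewrite sz mul0r; apply/negP; rewrite -ltNge exprn_even_gt0.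
  have inv_le : (sin z ^+ 2)^-1 <= (z ^+ 2)^-1 + 1.
    have z20 : 0 < z ^+ 2 by rewrite exprn_even_gt0.
    rewrite -[X in _ + X](@mulfV _ (z ^+ 2)) ?gt_eqF// -[X in X + _]mul1r -mulrDl.
    by rewrite ler_pdivlMr// mulrC ler_pdivrMr// mulrC.
  have -> : sinc a ^+ 2 = s * (4 ^+ m.+1)^-1 * (z ^+ 2)^-1.
    rewrite sincE ?tkn0// expr_div_n sin_sq_pi_addn -/s -mulrA; congr (_ * _).
    have -> : z ^+ 2 = (pi * a) ^+ 2 / 4 ^+ m.+1.
      rewrite /z mulrA expr_div_n; congr (_ / _).
      by rewrite exprAC; congr (_ ^+ _); ring.
    by rewrite invf_div mulrA mulVf ?mul1r// expf_neq0 ?pnatr_eq0.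
  apply: (@le_trans _ _ (s * (4 ^+ m.+1)^-1 * ((z ^+ 2)^-1 + 1))).
    by rewrite ler_wpM2l// mulr_ge0 ?(ltW s0)// invr_ge0 exprn_ge0.
  rewrite mulrDr mulr1 lerD2l ler_piMl// invr_ge0 exprn_ge0//.
have := ler_sum (index_enum 'I_(2 ^ m.+1)) (P := predT) (fun k _ => step k).
rewrite -mulr_sumr -mulrA -inv_sin_sq_sum// -/s mulfV ?gt_eqF// big_split/=.
rewrite sumr_const card_ord -[_ *+ (2 ^ m.+1)%N]mulr_natr natrX (_ : (4 ^+ m.+1)^-1 * _ = 2 ^- m.+1).
  by rewrite -lerBlDr.
rewrite (_ : 4 = 2 * 2 :> R); last by ring.
by rewrite exprMn invfM -mulrA mulVf ?mulr1// expf_neq0// pnatr_eq0.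
Qed.

End Sinc.

(** * Sampling and Bessel inequalities from the quadratic form of sinc *)

Section SincSampling.
Context {R : realType}.
Implicit Types (x y t : R) (f g : R -> R).
Let mu := (@lebesgue_measure R).

Lemma sinc_sq_sum_cvg x (e : R) : 0 < e ->
  exists M0 : nat, forall M, (M0 <= M)%N ->
    1 - e <= \sum_(k < M.*2.+1) sinc (x - (k%:R - M%:R)) ^+ 2.
Proof.
move=> e0.
pose F M (k : nat) : R := sinc (x - (k%:R - M%:R)) ^+ 2.
have F0 M k : 0 <= F M k by exact: sqr_ge0.
pose p : int := Num.floor x.
(* [sinc_sq_window] excludes integers; for those a single term of the sum already equals 1. *)
have [xp|xp] := eqVneq x p%:~R.
  exists `|p|%N => M pM.
  have ltM : (`|(p + M%:Z)%R|%N < M.*2.+1)%N by lia.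
  rewrite (bigD1 (Ordinal ltM))//=.
  rewrite (_ : x - _ = 0); last first.
    rewrite natr_absz ger0_norm; last by lia.
    by rewrite xp intrD -pmulrn addrK subrr.
  rewrite sinc0 expr1n; apply: (@le_trans _ _ 1); first by rewrite gerBl ltW.
  by rewrite lerDl sumr_ge0// => i _; exact: sqr_ge0.
pose p' := p + 1.
pose y : R := p'%:~R - x.
have y1 : 0 < y < 1.
  have /andP[px _] := Num.Theory.floor_itv x.
  rewrite subr_gt0 floorD1_gt/= /y intrD mulr1z ltrBlDr addrC ltrD2l.
  by rewrite lt_neqAle eq_sym xp px.
have siny : sin (pi * y) != 0.
  rewrite gt_eqF// sin_gt0_pi//.
  by case/andP: y1 => y0 y1; rewrite mulr_gt0 ?pi_gt0//= gtr_pMr ?pi_gt0.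
pose m := (Num.truncn e^-1).+1.
have me : 2^- m.+1 <= e.
  rewrite -[leRHS]invrK lef_pV2 ?posrE ?invr_gt0 ?exprn_gt0//.
  rewrite (le_trans (ltW (truncnS_gt _)))// -natrX ler_nat.
  by rewrite (leq_trans (ltnW (ltn_expl m (ltnSn 1))))// leq_exp2l.
(* Starting 2^m below y centres the window: the points t + k with k < 2^(m+1) lie in [-2^m, 2^m]
   because 0 < y < 1. *)
pose t : R := y - 2 ^+ m.
have ty : t + (2 ^ m)%:R = y by rewrite natrX subrK.
have t0 : sin (pi * t) != 0.
  by rewrite -sqrf_eq0 -(sin_sq_pi_addn (2 ^ m)) ty sqrf_eq0.
have m2 : (2 ^ m.+1 = 2 ^ m + 2 ^ m)%N by rewrite expnS mul2n addnn.
have tk (k : 'I_(2 ^ m.+1)) : `|t + k%:R| <= 2 ^+ m.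
  case/andP: y1 => y0 y1; rewrite ler_norml /t; apply/andP; split.
    by rewrite addrAC lerDr addr_ge0// ltW.
  have : (k.+1 <= 2 ^ m + 2 ^ m)%N by rewrite -m2.
  rewrite -(ler_nat R) -natr1 natrD natrX; lra.
have := sinc_sq_window t0 tk => h.
exists (`|p'|%N + 2 ^ m)%N => M hM.
(* Index at which the window begins among the nodes -M, ..., M. The terms outside the window are
   squares and are dropped. *)
pose b := `|(p' - (2 ^ m)%N%:Z + M%:Z)%R|%N.
have bE : (b%:R : R) = p'%:~R - 2 ^+ m + M%:R.
  rewrite /b natr_absz ger0_norm; last by lia.
  by rewrite !intrD intrN -!pmulrn natrX.
have bM : (b + 2 ^ m.+1 <= M.*2.+1)%N by rewrite /b m2; lia.
have -> : \sum_(k < M.*2.+1) sinc (x - (k%:R - M%:R)) ^+ 2 = \sum_(0 <= k < M.*2.+1) F M k.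
  by rewrite big_mkord.
rewrite (@big_cat_nat _ _ _ b)//=; last by rewrite (leq_trans _ bM)// leq_addr.
rewrite (@big_cat_nat _ _ _ (b + 2 ^ m.+1) b)//=; last by rewrite leq_addr.
have -> : \sum_(b <= i < b + 2 ^ m.+1) F M i = \sum_(k < 2 ^ m.+1) sinc (t + k%:R) ^+ 2.
  rewrite -{1}[b]add0n big_addn addnC addnK big_mkord; apply: eq_bigr => k _.
  rewrite /F -sincN natrD bE /t /y; congr (sinc _ ^+ 2); ring.
apply: (@le_trans _ _ (1 - 2^- m.+1)); first by rewrite lerD2l lerN2.
apply: (le_trans h).
by rewrite addrCA lerDl addr_ge0// sumr_ge0.
Qed.

Lemma integrable_segment f (a b : R) : continuous f ->
  mu.-integrable `[a, b] (EFin \o f).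
Proof.
move=> cf; apply: continuous_compact_integrable; first exact: segment_compact.
exact: continuous_subspaceT.
Qed.

Lemma Rintegral_FTC2 (f F : R -> R) (a b : R) : a <= b -> continuous f ->
  (forall x : R, is_derive x 1 F (f x)) ->
  \int[mu]_(x in `[a, b]) f x = F b - F a.
Proof.
rewrite le_eqVlt => /predU1P[->|ab] cf dF.
  by rewrite set_itv1 Rintegral_set1 subrr.
have cF : continuous F.
  by move=> x; apply: differentiable_continuous; apply/derivable1_diffP; exact: (@ex_derive _ _ _ _ _ _ _ (dF x)).
rewrite /Rintegral (continuous_FTC2 ab (F := F)) ?fineB//.
- exact: continuous_subspaceT.
- split.
  + by move=> x _; exact: (@ex_derive _ _ _ _ _ _ _ (dF x)).
  + by apply: cvg_at_right_filter; exact: cF.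
  + by apply: cvg_at_left_filter; exact: cF.
- by move=> x _; rewrite derive1E; exact: (@derive_val _ _ _ _ _ _ _ (dF x)).
Qed.

Lemma integral_cos_pi z : \int[mu]_(q in `[0, pi]) cos (q * z) = pi * sinc z.
Proof.
have [->|z0] := eqVneq z 0.
  under eq_Rintegral do rewrite mulr0 cos0.
  rewrite sinc0 Rintegral_cst//= lebesgue_measure_itv/= lte_fin pi_gt0 /= subr0.
  by rewrite mul1r mulr1.
have dF (q : R) : is_derive q 1 (fun q => sin (q * z) / z) (cos (q * z)).
  apply: is_derive_eq.
  by rewrite /GRing.scale/= ?(mulr1, mul1r, scaler0, addr0, mulr0); field.
rewrite (Rintegral_FTC2 (pi_ge0 R) _ dF).
  rewrite mul0r sin0 mul0r subr0 sincE// invfM [RHS]mulrCA mulVKf//.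
  by rewrite gt_eqF// pi_gt0.
move=> q; apply: continuous_comp; last exact: continuous_cos.
by apply: cvgM; [exact: cvg_id|exact: cvg_cst].
Qed.

Lemma Rintegral_sum_seg (I : Type) (s : seq I) (F : I -> R -> R) (a b : R) :
  (forall i, continuous (F i)) ->
  \int[mu]_(x in `[a, b]) (\sum_(i <- s) F i x) =
  \sum_(i <- s) \int[mu]_(x in `[a, b]) F i x.
Proof.
move=> cF; elim: s => [|i s IH].
  under eq_Rintegral do rewrite big_nil.
  by rewrite big_nil Rintegral_cst//= mul0r.
under eq_Rintegral do rewrite big_cons.
rewrite big_cons RintegralD//; first by rewrite IH.
  exact: integrable_segment.
apply: integrable_segment => x.
by apply: cvg_big => [|j _]; [exact: add_continuous|exact: cF].
Qed.

(** The integrand is the squared modulus of the sum of a_i exp(i q p_i), and each cross term cos (q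
    (p_i - p_j)) integrates to pi sinc. This exhibits sinc as a Gram kernel. *)
Lemma integral_trig_sq (I : finType) (a p : I -> R) :
  \int[mu]_(q in `[0, pi])
    ((\sum_i a i * cos (q * p i)) ^+ 2 + (\sum_i a i * sin (q * p i)) ^+ 2) =
  pi * \sum_i \sum_j a i * a j * sinc (p i - p j).
Proof.
transitivity (\int[mu]_(q in `[0, pi]) \sum_i \sum_j a i * a j * cos (q * (p i - p j))).
  apply: eq_Rintegral => q _; rewrite !expr2 !mulr_suml -big_split/=.
  apply: eq_bigr => i _; rewrite !mulr_sumr -big_split/=; apply: eq_bigr => j _.
  by rewrite mulrBr cosB; ring.
have cc i j : continuous (fun q : R => a i * a j * cos (q * (p i - p j))).
  move=> q; apply: cvgM; first exact: cvg_cst.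
  apply: continuous_comp; last exact: continuous_cos.
  by apply: cvgM; [exact: cvg_id|exact: cvg_cst].
rewrite Rintegral_sum_seg; last first.
  by move=> i q; apply: cvg_big => [|j _]; [exact: add_continuous|exact: cc].
rewrite mulr_sumr; apply: eq_bigr => i _.
rewrite Rintegral_sum_seg// mulr_sumr; apply: eq_bigr => j _.
rewrite RintegralZl//.
  by rewrite integral_cos_pi; ring.
apply: integrable_segment => q.
apply: continuous_comp; last exact: continuous_cos.
by apply: cvgM; [exact: cvg_id|exact: cvg_cst].
Qed.

Lemma sinc_posdef (I : finType) (a p : I -> R) :
  0 <= \sum_i \sum_j a i * a j * sinc (p i - p j).
Proof.
rewrite -(pmulr_rge0 _ (pi_gt0 R)) -integral_trig_sq.
by apply: Rintegral_ge0 => q _; rewrite addr_ge0 ?sqr_ge0.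
Qed.

(** Two integer grids, shifted against each other by t, each have the identity as Gram matrix.
    Semidefiniteness of the joint Gram matrix forces its off-diagonal block to be a contraction. *)
Lemma sinc_bessel (K M : nat) (c : 'I_M -> R) t :
  \sum_(k < K) (\sum_(m < M) c m * sinc (t + k%:R - m%:R)) ^+ 2 <=
  \sum_(m < M) c m ^+ 2.
Proof.
pose d (k : 'I_K) := \sum_(m < M) c m * sinc (t + k%:R - m%:R).
(* The form [sinc_posdef] evaluates to sum c^2 - sum d^2 at these weights. *)
pose a (i : 'I_K + 'I_M) := match i with inl k => - d k | inr m => c m end.
pose p (i : 'I_K + 'I_M) : R := match i with inl k => k%:R | inr m => m%:R - t end.
have := sinc_posdef a p.
rewrite big_sumType/=.
under eq_bigr do rewrite big_sumType/=.
under [X in _ + X]eq_bigr do rewrite big_sumType/=.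
rewrite !big_split/=.
have -> : \sum_(k < K) \sum_(j < K) - d k * - d j * sinc (k%:R - j%:R) = \sum_(k < K) d k ^+ 2.
  apply: eq_bigr => k _; rewrite (bigD1 k)//= subrr sinc0 mulr1 mulrNN big1 ?addr0//.
  by move=> j jk; rewrite sinc_nat_eq0 ?mulr0// eq_sym.
have -> : \sum_(k < K) \sum_(m < M) - d k * c m * sinc (k%:R - (m%:R - t)) =
    - \sum_(k < K) d k ^+ 2.
  rewrite -sumrN; apply: eq_bigr => k _.
  rewrite expr2 -mulNr [X in _ = _ * X]/d mulr_sumr; apply: eq_bigr => m _.
  by rewrite -mulrA; congr (_ * (_ * sinc _)); ring.
have -> : \sum_(m < M) \sum_(k < K) c m * - d k * sinc (m%:R - t - k%:R) =
    - \sum_(k < K) d k ^+ 2.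
  rewrite exchange_big -sumrN; apply: eq_bigr => k _.
  rewrite expr2 -mulNr [X in _ = _ * X]/d mulr_sumr; apply: eq_bigr => m _.
  rewrite (mulrC (c m)) -mulrA; congr (_ * (_ * _)).
  by rewrite -sincN; congr sinc; ring.
have -> : \sum_(m < M) \sum_(j < M) c m * c j * sinc (m%:R - t - (j%:R - t)) =
    \sum_(m < M) c m ^+ 2.
  apply: eq_bigr => k _; rewrite (bigD1 k)//= subrr sinc0 mulr1 -expr2 big1 ?addr0//.
  move=> j jk; rewrite (_ : _ - _ - _ = k%:R - j%:R); last by ring.
  by rewrite sinc_nat_eq0 ?mulr0// eq_sym.
by rewrite subrr add0r addrC subr_ge0.
Qed.

Lemma continuous_cosM z : continuous (fun q : R => cos (q * z)).
Proof.
move=> q; apply: continuous_comp; last exact: continuous_cos.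
by apply: cvgM; [exact: cvg_id|exact: cvg_cst].
Qed.

Lemma continuous_sinM z : continuous (fun q : R => sin (q * z)).
Proof.
move=> q; apply: continuous_comp; last exact: continuous_sin.
by apply: cvgM; [exact: cvg_id|exact: cvg_cst].
Qed.

(** The left-hand side is the integral of g against a rotated trigonometric polynomial, whose square
    is at most A^2 + B^2. A weighted arithmetic-geometric mean inequality with free e then replaces
    Cauchy-Schwarz and avoids roots of integrals. *)
Lemma cos_transform_bound (I : finType) (a p : I -> R) g y (e : R) :
  continuous g -> 0 < e ->
  `|\sum_i a i * \int[mu]_(q in `[0, pi]) (g q * cos (q * (p i - y)))| <=
  e * \int[mu]_(q in `[0, pi]) g q ^+ 2 +
  e^-1 * (pi * \sum_i \sum_j a i * a j * sinc (p i - p j)).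
Proof.
move=> cg e0.
have cgc z : continuous (fun q : R => g q * cos (q * z)).
  by move=> q; apply: cvgM; [exact: cg|exact: continuous_cosM].
pose A q := \sum_i a i * cos (q * p i).
pose B q := \sum_i a i * sin (q * p i).
have cA : continuous A.
  move=> q; apply: cvg_big => [|i _]; first exact: add_continuous.
  by apply: cvgM; [exact: cvg_cst|exact: continuous_cosM].
have cB : continuous B.
  move=> q; apply: cvg_big => [|i _]; first exact: add_continuous.
  by apply: cvgM; [exact: cvg_cst|exact: continuous_sinM].
have -> : \sum_i a i * \int[mu]_(q in `[0, pi]) (g q * cos (q * (p i - y))) =
    \int[mu]_(q in `[0, pi]) (g q * (cos (q * y) * A q + sin (q * y) * B q)).
  transitivity (\int[mu]_(q in `[0, pi]) \sum_i a i * (g q * cos (q * (p i - y)))).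
    rewrite Rintegral_sum_seg; last first.
      by move=> i q; apply: cvgM; [exact: cvg_cst|exact: cgc].
    apply: eq_bigr => i _; rewrite RintegralZl//; exact: integrable_segment.
  apply: eq_Rintegral => q _; rewrite /A /B !mulr_sumr -big_split/= mulr_sumr.
  by apply: eq_bigr => i _; rewrite mulrBr cosB; ring.
rewrite -integral_trig_sq -!RintegralZl//=; last 2 first.
- apply: integrable_segment => q; apply: cvgD; apply: cvgM; [exact: cA|exact: cA|exact: cB|exact: cB].
- by apply: integrable_segment => q; apply: cvgM; exact: cg.
rewrite -RintegralD//=; last 2 first.
- apply: integrable_segment => q; apply: cvgM; first exact: cvg_cst.
  by apply: cvgM; exact: cg.
- apply: integrable_segment => q; apply: cvgM; first exact: cvg_cst.
  by apply: cvgD; apply: cvgM; [exact: cA|exact: cA|exact: cB|exact: cB].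
have cAB : continuous (fun q => g q * (cos (q * y) * A q + sin (q * y) * B q)).
  move=> q; apply: cvgM; first exact: cg.
  apply: cvgD; apply: cvgM; [exact: continuous_cosM|exact: cA|exact: continuous_sinM|exact: cB].
apply: (le_trans (le_normr_Rintegral _ _)) => //.
  exact: integrable_segment.
apply: le_Rintegral => //=.
- apply: integrable_segment => q; apply: cvg_norm; exact: cAB.
- apply: integrable_segment => q; apply: cvgD; apply: cvgM.
  + exact: cvg_cst.
  + by apply: cvgM; exact: cg.
  + exact: cvg_cst.
  + by apply: cvgD; apply: cvgM; [exact: cA|exact: cA|exact: cB|exact: cB].
move=> q _.
set u := g q; set c := cos _; set s := sin _; set v := A q; set w := B q.
have cs : c ^+ 2 + s ^+ 2 = 1 by exact: cos2Dsin2.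
have e0' : 0 < e^-1 by rewrite invr_gt0.
have h1 : (c * v + s * w) ^+ 2 <= v ^+ 2 + w ^+ 2.
  rewrite -subr_ge0 -[X in X - _]mul1r -cs.
  by rewrite (_ : _ - _ = (c * w - s * v) ^+ 2) ?sqr_ge0//; ring.
apply: (@le_trans _ _ (e * u ^+ 2 + e^-1 * (c * v + s * w) ^+ 2)); last first.
  by rewrite lerD2l ler_wpM2l// ltW.
set z := c * v + s * w.
have hz : 0 <= e * (`|u| - e^-1 * `|z|) ^+ 2 by rewrite mulr_ge0 ?sqr_ge0// ltW.
have -> : e * u ^+ 2 + e^-1 * z ^+ 2 =
    e * (`|u| - e^-1 * `|z|) ^+ 2 + `|u * z| *+ 2.
  rewrite -(real_normK (num_real u)) -(real_normK (num_real z)) normrM; field.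
  by rewrite gt_eqF.
by rewrite mulr2n addrA lerDr addr_ge0.
Qed.

Lemma cos_transform_sampling g x y : continuous g ->
  \sum_(k < M.*2.+1)
    (\int[mu]_(q in `[0, pi]) (g q * cos (q * (k%:R - M%:R - y)))) *
      sinc (x - (k%:R - M%:R)) @[M --> \oo] -->
  \int[mu]_(q in `[0, pi]) (g q * cos (q * (x - y))).
Proof.
move=> cg; apply/cvgrPdist_le => /= e e0.
set I2 := \int[mu]_(q in `[0, pi]) g q ^+ 2.
have I20 : 0 <= I2 by apply: Rintegral_ge0 => q _; exact: sqr_ge0.
(* Makes the term with [I2] at most e / 2, the summand 1 guarding against [I2] = 0. The tolerance in
   [eta0] is then the defect of the squared sinc sum for which the other term is at most e / 2. *)
pose d := e / (2 * (I2 + 1)).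
have d0 : 0 < d by rewrite divr_gt0// mulr_gt0// ltr_wpDl.
have dI : d * I2 <= e / 2.
  rewrite /d invfM mulrA -mulrA ler_piMr//; first by rewrite ltW// divr_gt0.
  by rewrite ler_pdivrMl ?mulr1 ?lerDl// ltr_wpDl.
have eta0 : 0 < (d * (e / 2)) / pi by rewrite divr_gt0 ?pi_gt0// mulr_gt0// divr_gt0.
have [M0 hM0] := sinc_sq_sum_cvg x eta0.
exists M0 => //= M /hM0 hM.
pose n (k : 'I_M.*2.+1) : R := k%:R - M%:R.
pose s k := sinc (x - n k).
(* For these weights the quadratic form is 1 - sum_k s_k^2, which tends to 0. *)
pose a (i : 'I_1 + 'I_M.*2.+1) := if i is inr k then - s k else 1.
pose p (i : 'I_1 + 'I_M.*2.+1) := if i is inr k then n k else x.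
have := cos_transform_bound a p y cg d0.
rewrite !big_sumType/= !big_ord1/=.
under [X in _ <= _ + _ * (_ * (_ + X))]eq_bigr do rewrite big_sumType/= big_ord1/=.
rewrite big_sumType/= big_ord1/= subrr sinc0 !mulr1 mul1r big_split/=.
have -> : \sum_(i < M.*2.+1) 1 * - s i * sinc (x - n i) = - \sum_i s i ^+ 2.
  by rewrite -sumrN; apply: eq_bigr => k _; rewrite -/(s k); ring.
have -> : \sum_(i < M.*2.+1) - s i * 1 * sinc (n i - x) = - \sum_i s i ^+ 2.
  by rewrite -sumrN; apply: eq_bigr => k _; rewrite -sincN opprB -/(s k); ring.
have -> : \sum_(i < M.*2.+1) \sum_(j < M.*2.+1) - s i * - s j * sinc (n i - n j) =
    \sum_i s i ^+ 2.
  apply: eq_bigr => i _; rewrite (bigD1 i)//= subrr sinc0 mulr1 mulrNN -expr2.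
  rewrite big1 ?addr0// => j ji.
  rewrite (_ : n i - n j = i%:R - j%:R); last by rewrite /n; ring.
  by rewrite sinc_nat_eq0 ?mulr0// eq_sym.
rewrite addNr addr0.
have -> : \sum_(i < M.*2.+1) - s i *
    (\int[mu]_(q in `[0, pi]) (g q * cos (q * (n i - y)))) =
    - \sum_(k < M.*2.+1)
    (\int[mu]_(q in `[0, pi]) (g q * cos (q * (k%:R - M%:R - y)))) *
      sinc (x - (k%:R - M%:R)).
  by rewrite -sumrN; apply: eq_bigr => k _; rewrite mulNr mulrC.
move/le_trans; apply.
rewrite -/I2 [leRHS](splitr e) lerD//.
rewrite mulrC ler_pdivrMr// mulrC -ler_pdivlMr ?pi_gt0// [_ * d]mulrC.
by rewrite lerBlDr -lerBlDl.
Qed.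

End SincSampling.

(** * Splitting the Gaussian into low and high frequencies *)

Section GaussianHalfLine.
Context {R : realType}.
Let mu := (@lebesgue_measure R).

(** The normal density involved has variance 1 / (2 a), so integrability and total mass are
    inherited from it. *)
Let gaussE (a : R) : 0 < a ->
  (fun q => expR (- (a * q ^+ 2))) =
  (fun q => Num.sqrt (pi / a) * normal_pdf 0 (Num.sqrt (2 * a)^-1) q).
Proof.
move=> a0; have s0 : Num.sqrt (2 * a)^-1 != 0.
  by rewrite gt_eqF// sqrtr_gt0 invr_gt0 mulr_gt0.
have s2 : Num.sqrt (2 * a)^-1 ^+ 2 = (2 * a)^-1.
  by rewrite sqr_sqrtr// invr_ge0 mulr_ge0 ?ltW.
apply/funext => q; rewrite /normal_pdf (negbTE s0)/= /normal_peak /normal_fun s2 subr0.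
have -> : (2 * a)^-1 * pi *+ 2 = pi / a.
  by rewrite -mulr_natr invfM; move: (pi : R) => p; field; rewrite gt_eqF.
rewrite mulVKf; last by rewrite gt_eqF// sqrtr_gt0 divr_gt0 ?pi_gt0.
by congr expR; rewrite -mulr_natr; field; rewrite gt_eqF.
Qed.

Lemma integrable_gauss (a : R) : 0 < a ->
  mu.-integrable setT (EFin \o (fun q => expR (- (a * q ^+ 2)))).
Proof.
move=> a0; rewrite gaussE//.
rewrite (_ : _ \o _ = fun x => (Num.sqrt (pi / a))%:E * (normal_pdf 0 (Num.sqrt (2 * a)^-1) x)%:E)%E.
  by apply: integrableZl => //; exact: integrable_normal_pdf.
by apply/funext => x; rewrite /= EFinM.
Qed.

Lemma integral_gauss_half (a : R) : 0 < a ->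
  \int[mu]_(q in `[0, +oo[) expR (- (a * q ^+ 2)) = Num.sqrt (pi / a) / 2.
Proof.
move=> a0; have s0 : Num.sqrt (2 * a)^-1 != 0.
  by rewrite gt_eqF// sqrtr_gt0 invr_gt0 mulr_gt0.
have : \int[mu]_q expR (- (a * q ^+ 2)) = Num.sqrt (pi / a).
  rewrite gaussE// RintegralZl//; last exact: integrable_normal_pdf.
  by rewrite /Rintegral integral_normal_pdf//= mulr1.
have cf : continuous (fun q : R => expR (- (a * q ^+ 2))).
  move=> q; apply: continuous_comp; last exact: continuous_expR.
  apply: cvgN; apply: cvgM; first exact: cvg_cst.
  by apply: cvgM; exact: cvg_id.
rewrite /Rintegral ge0_symfun_integralT//=; last by move=> q /=; rewrite sqrrN.
rewrite fineM//; last first.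
  rewrite -set_itvcy; apply: integrable_fin_num => //.
  by apply: integrableS (integrable_gauss a0).
by rewrite -set_itvcy => <- /=; field.
Qed.

End GaussianHalfLine.

Section GaussianSplit.
Context {R : realType}.
Implicit Types (x y t : R).
Let mu := (@lebesgue_measure R).

Definition heat1 t x : R := (Num.sqrt (4 * pi * t))^-1 * expR (- (x ^+ 2 / (4 * t))).

Variable tau : R.
Hypothesis tau1 : 1 <= tau.

Let tau0 : 0 < tau. Proof. by rewrite (lt_le_trans _ tau1). Qed.

Let tau_ge0 : 0 <= tau. Proof. exact: ltW. Qed.

Let c := expR (- (tau * pi ^+ 2)).

(** The maximum with 0 is not written, since the integrals below run over [0, pi], where the
    difference is nonnegative. *)
Definition cut_gauss (q : R) : R := expR (- (tau * q ^+ 2)) - c.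
Let g := cut_gauss.

Definition low_int x := \int[mu]_(q in `[0, pi]) (g q * cos (q * x)).

(** Inverse Fourier transform of an even function on [-pi, pi]: the factor (2 pi)^-1 doubles when
    the integral is folded onto [0, pi]. *)
Definition low_heat x := pi^-1 * low_int x.

Let c0 : 0 < c. Proof. exact: expR_gt0. Qed.

Let is_derive_g (q : R) : is_derive q 1 g (- (2 * tau * q) * expR (- (tau * q ^+ 2))).
Proof.
rewrite /g /cut_gauss; apply: is_derive_eq.
by rewrite /GRing.scale/=; ring.
Qed.

Lemma continuous_cut_gauss : continuous cut_gauss.
Proof.
move=> q; apply: differentiable_continuous; apply/derivable1_diffP.
exact: (@ex_derive _ _ _ _ _ _ _ (is_derive_g q)).
Qed.

Let g_le1 q : `|g q| <= 1.
Proof.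
have h1 : expR (- (tau * q ^+ 2)) <= 1.
  by rewrite -expR0 ler_expR oppr_le0 mulr_ge0 ?sqr_ge0 ?ltW.
have h2 : c <= 1.
  by rewrite -expR0 ler_expR oppr_le0 mulr_ge0 ?sqr_ge0 ?ltW.
have h3 : 0 <= expR (- (tau * q ^+ 2)) by exact: expR_ge0.
rewrite /g /cut_gauss ler_norml; move: c0; lra.
Qed.

Let sigma x := \int[mu]_(q in `[0, pi]) (q * sin (q * x)).

Let sigma_sq x : x ^+ 2 * sigma x = sin (pi * x) - pi * x * cos (pi * x).
Proof.
have dF (q : R) : is_derive q 1 (fun q => sin (q * x) - q * x * cos (q * x))
    (x ^+ 2 * (q * sin (q * x))).
  by apply: is_derive_eq; rewrite /GRing.scale/=; ring.
rewrite -RintegralZl//; last first.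
  by apply: integrable_segment => q; apply: cvgM; [exact: cvg_id|exact: continuous_sinM].
rewrite (Rintegral_FTC2 (pi_ge0 R) _ dF).
  by rewrite !mul0r sin0 subrr subr0.
move=> q; apply: cvgM; first exact: cvg_cst.
by apply: cvgM; [exact: cvg_id|exact: continuous_sinM].
Qed.

(** Two estimates are added: |sin (q x)| <= q x controls [sigma] near 0, and the closed form of x^2
    [sigma] controls it far away. The resulting shape x / (1 + x^2) matches the derivative of the
    barrier in [E_ub]. *)
Let sigma_ub x : 0 <= x -> (1 + x ^+ 2) * `|sigma x| <= (pi ^+ 3 + 2 * pi) * x.
Proof.
move=> x0; rewrite mulrDl mul1r [leRHS]mulrDl lerD//.
  have cq : continuous (fun q : R => q * sin (q * x)).
    by move=> q; apply: cvgM; [exact: cvg_id|exact: continuous_sinM].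
  apply: (le_trans (le_normr_Rintegral _ _)) => //; first exact: integrable_segment.
  apply: (@le_trans _ _ (\int[mu]_(q in `[0, pi]) (pi ^+ 2 * x))); last first.
    rewrite Rintegral_cst//= lebesgue_measure_itv/= lte_fin pi_gt0/= subr0.
    by rewrite le_eqVlt; apply/orP; left; apply/eqP; ring.
  apply: le_Rintegral => //=.
  - by apply: integrable_segment => q; apply: cvg_norm; exact: cq.
  - by apply: integrable_segment => q; exact: cvg_cst.
  move=> q /[!in_itv]/= /andP[q0 qpi].
  rewrite normrM ger0_norm// expr2 -mulrA ler_pM//.
  have s_le : `|sin (q * x)| <= q * x.
    have qx0 : 0 <= q * x by rewrite mulr_ge0.
    exact: norm_sin_le.
  by rewrite (le_trans s_le)// ler_wpM2r.
rewrite -[X in X * _](ger0_norm (sqr_ge0 x)) -normrM sigma_sq.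
apply: (le_trans (ler_normB _ _)).
rewrite (_ : 2 * pi * x = pi * x + pi * x); last by ring.
rewrite lerD//; first by rewrite norm_sin_le// mulr_ge0 ?pi_ge0.
rewrite normrM ger0_norm ?mulr_ge0 ?pi_ge0//.
by rewrite ler_piMr ?cos_max// mulr_ge0 ?pi_ge0.
Qed.

(** Integration by parts in q. The derivative of g is -2 tau q (g + c), and the extra c is the sole
    source of the forcing term. *)
Let dPhi x (q : R) : is_derive q 1 (fun q => g q * sin (q * x))
  (x * (g q * cos (q * x)) - 2 * tau * (g q * (q * sin (q * x)) + c * (q * sin (q * x)))).
Proof.
have dg := is_derive_g q.
have dsin : is_derive q 1 (fun q => sin (q * x)) (x * cos (q * x)).
  by apply: is_derive_eq; rewrite /GRing.scale/=; move: (cos _) => w; ring.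
apply: (is_derive_eq (is_deriveM dg dsin)); rewrite /GRing.scale/=.
rewrite (_ : expR (- (tau * q ^+ 2)) = g q + c); last by rewrite /g /cut_gauss subrK.
by move: (g q) (cos _) (sin _) c => u v w k; ring.
Qed.

Let is_derive_low x : is_derive x 1 low_int (- (x / (2 * tau)) * low_int x + c * sigma x).
Proof.
pose f (x q : R) := g q * cos (q * x).
have df (z q : R) : is_derive z 1 (f ^~ q) (- (g q * (q * sin (q * z)))).
  by rewrite /f; apply: is_derive_eq; rewrite /GRing.scale/=; ring.
have cgc z : continuous (f z).
  by move=> q; apply: cvgM; [exact: continuous_cut_gauss|exact: continuous_cosM].
have cgs z : continuous (fun q => g q * (q * sin (q * z))).
  move=> q; apply: cvgM; first exact: continuous_cut_gauss.
  by apply: cvgM; [exact: cvg_id|exact: continuous_sinM].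
have cs z : continuous (fun q : R => q * sin (q * z)).
  by move=> q; apply: cvgM; [exact: cvg_id|exact: continuous_sinM].
have xI : `]x - 1, x + 1[%classic x by rewrite /= in_itv/= ltrBlDr ltrDl ltr01.
have intf z : `]x - 1, x + 1[%classic z -> mu.-integrable `[0, pi] (EFin \o f z).
  by move=> _; exact: integrable_segment.
have derf z q : `]x - 1, x + 1[%classic z -> `[0, pi]%classic q -> derivable (f ^~ q) z 1.
  by move=> _ _; exact: (@ex_derive _ _ _ _ _ _ _ (df z q)).
have G_ub z q : `]x - 1, x + 1[%classic z -> `[0, pi]%classic q -> `|partial1of2 f z q| <= pi.
  move=> _ /=; rewrite in_itv/= => /andP[q0 qpi].
  rewrite partial1of2E (@derive_val _ _ _ _ _ _ _ (df z q)) normrN !normrM -[leRHS]mul1r.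
  rewrite ler_pM ?g_le1// -[leRHS]mulr1 ler_pM// ?sin_max//.
  by rewrite ger0_norm.
have intG : mu.-integrable `[0, pi] (EFin \o cst (pi : R)).
  by apply: integrable_segment => q; exact: cvg_cst.
have dl := @derivable_under_integral R _ _ mu f `[0, pi] (measurable_itv _) x _ _ xI intf derf (cst pi) (fun _ => pi_ge0 R) intG G_ub.
apply: DeriveDef; first exact: dl.
rewrite -derive1E.
rewrite (@differentiation_under_integral R _ _ mu f `[0, pi] (measurable_itv _) x _ _ xI intf derf (cst pi) (fun _ => pi_ge0 R) intG G_ub).
under eq_Rintegral do rewrite partial1of2E (@derive_val _ _ _ _ _ _ _ (df _ _)).
have dPhix := dPhi x.
have c1 : continuous (fun q => g q * (q * sin (q * x)) + c * (q * sin (q * x))).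
  move=> q; apply: cvgD; first exact: cgs.
  by apply: cvgM; [exact: cvg_cst|exact: cs].
have c2 : continuous (fun q => x * (g q * cos (q * x))).
  by move=> q; apply: cvgM; [exact: cvg_cst|exact: cgc].
have := Rintegral_FTC2 (pi_ge0 R) _ dPhix.
(* This is what subtracting c buys: both boundary terms vanish, at 0 through the sine and at pi
   through g. *)
have gpi : g pi = 0 by rewrite /g /cut_gauss -/c subrr.
rewrite gpi mul0r mul0r sin0 mulr0 subrr.
rewrite RintegralB//=; last 2 first.
- exact: integrable_segment.
- by apply: integrable_segment => q; apply: cvgM; [exact: cvg_cst|exact: c1].
rewrite !RintegralZl//; last 2 first.
- by apply: integrable_segment; exact: c1.
- by apply: integrable_segment; exact: cgc.
rewrite RintegralD//; last 2 first.
- by apply: integrable_segment; exact: cgs.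
- by apply: integrable_segment => q; apply: cvgM; [exact: cvg_cst|exact: cs].
rewrite RintegralZl//; last exact: integrable_segment.
rewrite -/(sigma x) -/(low_int x).
move=> h.
under eq_Rintegral do rewrite -mulN1r.
rewrite RintegralZl//; last exact: integrable_segment.
set J := Rintegral _ _ _ in h *.
have {}h : x * low_int x - 2 * tau * (J + c * sigma x) = 0.
  apply: h => q; apply: cvgB; first exact: c2.
  by apply: cvgM; [exact: cvg_cst|exact: c1].
apply: (@mulfI _ (2 * tau)); first by rewrite mulf_neq0 ?pnatr_eq0// gt_eqF.
rewrite mulN1r mulrN mulrDr mulNr mulrN [_ * (x / _ * _)]mulrA mulrC.
rewrite [2 * tau * (x / _)]mulrC divfK; last by rewrite mulf_neq0 ?pnatr_eq0// gt_eqF.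
by move: h; rewrite mulrDr; lra.
Qed.

Let E x := pi * heat1 tau x - low_int x.

(** The heat kernel solves the same equation without forcing, so the difference is driven by c
    [sigma] alone. *)
Let is_derive_E x : is_derive x 1 E (- (x / (2 * tau)) * E x - c * sigma x).
Proof.
have dh : is_derive x 1 (heat1 tau) (- (x / (2 * tau)) * heat1 tau x).
  rewrite /heat1; apply: is_derive_eq; rewrite /GRing.scale/=.
  move: (expR _) (Num.sqrt _)^-1 => e s; field.
  by rewrite gt_eqF.
have dl := is_derive_low x.
rewrite /E; apply: (is_derive_eq (is_deriveB (is_deriveM (is_derive_cst (pi : R) x 1) dh) dl)).
rewrite /GRing.scale/=; move: (heat1 _ _) (low_int x) (sigma x) c (pi : R) => h l s k p.
by field; rewrite gt_eqF.
Qed.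

Let E_even x : E (- x) = E x.
Proof.
rewrite /E /heat1 sqrrN; congr (_ - _); apply: eq_Rintegral => q _.
by rewrite mulrN cosN.
Qed.

Let E0_ub : `|E 0| <= (expR (pi ^+ 2) * Num.sqrt pi / 2 + pi) * c.
Proof.
(* With u = pi^2 and v = q^2 this says exp(-tau q^2) <= c exp(pi^2) exp(-q^2) beyond pi: as tau >=
   1, the tail is at most c times a fixed Gaussian tail. *)
have aux (u v : R) : u <= v -> - (tau * v) <= - (tau * u) + u - 1 * v.
  move=> uv; have : (tau - 1) * u <= (tau - 1) * v by rewrite ler_wpM2l// subr_ge0.
  rewrite !mulrBl; lra.
pose f (a q : R) := expR (- (a * q ^+ 2)).
have intf a (I : interval R) : 0 < a -> mu.-integrable [set` I] (EFin \o f a).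
  by move=> a0; apply: integrableS (integrable_gauss a0).
have E0 : E 0 = \int[mu]_(q in `]pi, +oo[) f tau q + pi * c.
  rewrite -(@Rintegral_itvB _ _ (BLeft 0) +oo%O)//; last 2 first.
  - exact: intf.
  - by rewrite bnd_simp pi_ge0.
  rewrite integral_gauss_half// /E /low_int.
  under eq_Rintegral do rewrite mulr0 cos0 mulr1.
  rewrite /g /cut_gauss RintegralB//; last 2 first.
  - exact: intf.
  - by apply: integrable_segment => q; exact: cvg_cst.
  rewrite Rintegral_cst//= lebesgue_measure_itv/= lte_fin pi_gt0/= subr0.
  rewrite opprB addrA [c * _]mulrC addrAC; congr (_ - _ + _).
  rewrite /heat1 expr0n/= mul0r oppr0 expR0 mulr1.
  rewrite -mulrA sqrtrM// (_ : 4 = 2 ^+ 2 :> R); last by rewrite -natrX.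
  rewrite sqrtr_sqr ger0_norm// sqrtrM ?pi_ge0// sqrtrM ?pi_ge0// sqrtrV ?ltW//.
  rewrite -{1}(sqr_sqrtr (pi_ge0 R)).
  have sp : Num.sqrt pi != 0 :> R by rewrite gt_eqF// sqrtr_gt0 pi_gt0.
  have st : Num.sqrt tau != 0 by rewrite gt_eqF// sqrtr_gt0.
  by move: (Num.sqrt pi) (Num.sqrt tau) sp st => u v u0 v0; field; rewrite u0 v0.
have T0 : 0 <= \int[mu]_(q in `]pi, +oo[) f tau q.
  by apply: Rintegral_ge0 => q _; exact: expR_ge0.
have T1 : \int[mu]_(q in `]pi, +oo[) f tau q <= expR (pi ^+ 2) * Num.sqrt pi / 2 * c.
  apply: (@le_trans _ _ (\int[mu]_(q in `]pi, +oo[) (c * expR (pi ^+ 2) * f 1 q))).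
    apply: le_Rintegral => //=.
    - exact: intf.
    - rewrite (_ : _ \o _ = fun x => (c * expR (pi ^+ 2))%:E * (EFin \o f 1%R) x)%E.
        by apply: integrableZl => //; exact: intf.
      by apply/funext => x; rewrite /= EFinM.
    move=> q /[!in_itv]/=; rewrite andbT => piq.
    rewrite /c /f -!expRD ler_expR.
    have : pi ^+ 2 <= q ^+ 2 by rewrite ler_sqr ?nnegrE ?pi_ge0 ?(ltW (lt_trans (pi_gt0 R) piq))// ltW.
    exact: aux.
  rewrite RintegralZl//; last exact: intf.
  have : \int[mu]_(q in `]pi, +oo[) f 1 q <= Num.sqrt pi / 2.
    have := integral_gauss_half (@ltr01 R); rewrite divr1 => <-.
    rewrite -(@Rintegral_itvB _ _ (BLeft 0) +oo%O)//; last 2 first.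
    - exact: intf.
    - by rewrite bnd_simp pi_ge0.
    rewrite gerBl; apply: Rintegral_ge0 => q _; exact: expR_ge0.
  move=> /(ler_wpM2l (mulr_ge0 (ltW c0) (expR_ge0 (pi ^+ 2)))) /le_trans; apply.
  by rewrite le_eqVlt; apply/orP; left; apply/eqP; move: (expR _) (Num.sqrt _) c => u v w; ring.
rewrite E0 ger0_norm ?addr_ge0// ?mulr_ge0 ?pi_ge0 ?(ltW c0)//.
by rewrite [leRHS]mulrDl lerD2r.
Qed.

(** Sized for the barrier in [E_ub]: 32 = 8 * 4 comes from 1 / (1 + z^2) <= 8 tau / (8 tau + z^2)
    and from the rate 1 / (4 tau) left in its derivative. The 8 in the second summand comes from its
    denominator 8 tau at z = 0. *)
Definition split_const : R :=
  32 * (pi ^+ 3 + 2 * pi) + 8 * (expR (pi ^+ 2) * Num.sqrt pi / 2 + pi).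

Lemma split_const_ge0 : 0 <= split_const.
Proof.
have C1 : 0 <= pi ^+ 3 + 2 * pi :> R by rewrite addr_ge0 ?exprn_ge0 ?mulr_ge0 ?pi_ge0.
have C2 : 0 <= expR (pi ^+ 2) * Num.sqrt pi / 2 + pi :> R.
  by rewrite addr_ge0 ?divr_ge0 ?mulr_ge0 ?expR_ge0 ?sqrtr_ge0 ?pi_ge0.
by rewrite /split_const addr_ge0// mulr_ge0.
Qed.

Lemma continuous_low_heat : continuous low_heat.
Proof.
move=> x; apply: differentiable_continuous; apply/derivable1_diffP.
have dl := is_derive_low x.
by apply: derivableM => //; exact: (@ex_derive _ _ _ _ _ _ _ dl).
Qed.

Let E_ub x : `|E x| <= split_const * tau ^+ 2 * c / (8 * tau + x ^+ 2).
Proof.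
wlog x0 : x / 0 <= x => [hw|].
  have [|x0] := leP 0 x; first exact: hw.
  by have := hw (- x); rewrite E_even sqrrN; apply; rewrite oppr_ge0 ltW.
have C1 : 0 <= pi ^+ 3 + 2 * pi :> R by rewrite addr_ge0 ?exprn_ge0 ?mulr_ge0 ?pi_ge0.
have C2 : 0 <= expR (pi ^+ 2) * Num.sqrt pi / 2 + pi :> R.
  by rewrite addr_ge0 ?divr_ge0 ?mulr_ge0 ?expR_ge0 ?sqrtr_ge0 ?pi_ge0.
pose b := split_const * tau ^+ 2 * c.
have den z : 0 < 8 * tau + z ^+ 2 :> R by rewrite ltr_wpDr ?sqr_ge0// mulr_gt0.
pose w (z : R) := expR (z ^+ 2 / (4 * tau)).
have dw (z : R) : is_derive z 1 w (z / (2 * tau) * w z).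
  rewrite /w; apply: is_derive_eq; rewrite /GRing.scale/=; move: (expR _) => e; field.
  by rewrite gt_eqF.
pose Y z := E z * w z.
have dY (z : R) : is_derive z 1 Y (- (c * sigma z) * w z).
  apply: (is_derive_eq (is_deriveM (is_derive_E z) (dw z))).
  rewrite /GRing.scale/=; move: (E z) (w z) (sigma z) c => e v s k; ring.
(* Y' = - c sigma w; the shift 8 tau makes the barrier B increasing, with B' >= |Y'|. *)
pose B z := b / (8 * tau + z ^+ 2) * w z.
have dB (z : R) : is_derive z 1 B (b * w z * z / (8 * tau + z ^+ 2) *
    ((2 * tau)^-1 - 2 / (8 * tau + z ^+ 2))).
  have dd : is_derive z 1 (fun z : R => 8 * tau + z ^+ 2) (2 * z).
    by apply: is_derive_eq; rewrite /GRing.scale/=; ring.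
  have di : is_derive z 1 (fun z : R => (8 * tau + z ^+ 2)^-1) (- (8 * tau + z ^+ 2) ^- 2 * (2 * z)).
    apply: is_derive_eq (is_deriveV _ dd) _; first by rewrite gt_eqF.
    by rewrite /GRing.scale/=.
  apply: (is_derive_eq (is_deriveM (is_deriveM (is_derive_cst b z 1) di) (dw z))).
  rewrite !fctE /GRing.scale/=; move: (den z) => dz.
  move: (w z) => v; field.
  by rewrite !gt_eqF.
have Bge (z : R) : 0 <= z -> `|c * sigma z * w z| <= b * w z * z / (8 * tau + z ^+ 2) *
    ((2 * tau)^-1 - 2 / (8 * tau + z ^+ 2)).
  move=> z0.
  (* As 8 tau + z^2 >= 8 tau, differentiating the denominator costs at most half of the logarithmic
     derivative z / (2 tau) of [w]. *)
  have h1 : (4 * tau)^-1 <= (2 * tau)^-1 - 2 / (8 * tau + z ^+ 2).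
    rewrite lerBrDr -lerBrDl.
    rewrite (_ : (2 * tau)^-1 - (4 * tau)^-1 = 2 / (8 * tau)); last first.
      by field; rewrite gt_eqF.
    by rewrite ler_wpM2l// lef_pV2 ?posrE ?den ?mulr_gt0// lerDl sqr_ge0.
  apply: (@le_trans _ _ (b * w z * z / (8 * tau + z ^+ 2) * (4 * tau)^-1)); last first.
    rewrite ler_wpM2l// divr_ge0 ?(ltW (den z))// !mulr_ge0 ?expR_ge0 ?sqr_ge0 ?(ltW c0)//.
    by rewrite addr_ge0// mulr_ge0.
  rewrite !normrM (ger0_norm (ltW c0)) (ger0_norm (expR_ge0 _)).
  have h2 : `|sigma z| <= (pi ^+ 3 + 2 * pi) * z / (1 + z ^+ 2).
    rewrite ler_pdivlMr; last by rewrite ltr_wpDr ?sqr_ge0.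
    by rewrite mulrC sigma_ub.
  have h3 : (1 + z ^+ 2)^-1 <= 8 * tau / (8 * tau + z ^+ 2).
    rewrite ler_pdivlMr ?den// mulrC ler_pdivrMr ?ltr_wpDr ?sqr_ge0//.
    rewrite mulrDr mulr1 lerD2l ler_peMl ?sqr_ge0//; move: tau1; lra.
  have h4 : `|sigma z| <= (pi ^+ 3 + 2 * pi) * z * (8 * tau / (8 * tau + z ^+ 2)).
    by apply: (le_trans h2); rewrite ler_wpM2l// mulr_ge0.
  have h5 : c * `|sigma z| * w z <=
      32 * (pi ^+ 3 + 2 * pi) * tau ^+ 2 * c * w z * z / (8 * tau + z ^+ 2) * (4 * tau)^-1.
    apply: (@le_trans _ _ (c * ((pi ^+ 3 + 2 * pi) * z * (8 * tau / (8 * tau + z ^+ 2))) * w z)).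
      by rewrite ler_wpM2r ?expR_ge0// ler_wpM2l// ltW.
    rewrite le_eqVlt; apply/orP; left; apply/eqP; move: (den z) => dz.
    move: (pi ^+ 3 + 2 * pi) (w z) c => u v k; field.
    by rewrite !gt_eqF.
  apply: (le_trans h5).
  rewrite !ler_wpM2r ?invr_ge0 ?(ltW (den z)) ?(ltW c0) ?expR_ge0 ?sqr_ge0//.
    by rewrite mulr_ge0 ?ltW.
  by rewrite lerDl mulr_ge0.
have Y0 : `|Y 0| <= B 0.
  rewrite /Y /B /w expr0n/= mul0r expR0 !mulr1 addr0.
  apply: (le_trans E0_ub); rewrite /b ler_pdivlMr ?mulr_gt0//.
  rewrite /split_const; set u := pi ^+ 3 + _ in C1 *; set v := _ + pi in C2 *.
  have tt : tau <= tau ^+ 2 by rewrite expr2 ler_peMl.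
  rewrite (_ : v * c * (8 * tau) = 8 * v * tau * c); last by ring.
  rewrite ler_wpM2r ?(ltW c0)//.
  apply: (@le_trans _ _ (8 * v * tau ^+ 2)); first by rewrite ler_wpM2l// mulr_ge0.
  by rewrite ler_wpM2r ?sqr_ge0// lerDr mulr_ge0.
have Yx : `|Y x| <= B x.
  move: Y0; rewrite !ler_norml => /andP[l0 r0]; apply/andP; split.
    rewrite -subr_ge0 opprK addrC; rewrite -subr_ge0 opprK addrC in l0.
    apply: (le_trans l0).
    apply: (@is_derive_ge0_le _ (fun z => B z + Y z) _ 0 x (fun z => is_deriveD (dB z) (dY z))) => //.
    move=> z /andP[/ltW z0 _]; rewrite mulNr subr_ge0.
    by apply: le_trans (Bge z z0); exact: ler_norm.
  rewrite -subr_ge0; rewrite -subr_ge0 in r0; apply: (le_trans r0).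
  apply: (@is_derive_ge0_le _ (fun z => B z - Y z) _ 0 x (fun z => is_deriveB (dB z) (dY z))) => //.
  move=> z /andP[/ltW z0 _]; rewrite mulNr opprK -lerBlDr sub0r.
  by apply: le_trans (Bge z z0); rewrite -normrN; exact: ler_norm.
move: Yx; rewrite /Y /B normrM (ger0_norm (expR_ge0 _)) ler_pM2r//.
exact: expR_gt0.
Qed.

Lemma heat1_sub_low_heat x :
  `|heat1 tau x - low_heat x| <= split_const / pi * expR (- tau) / (1 + x ^+ 2).
Proof.
have -> : heat1 tau x - low_heat x = pi^-1 * E x.
  by rewrite /E mulrBr mulKf// gt_eqF// pi_gt0.
rewrite normrM ger0_norm ?invr_ge0 ?pi_ge0//.
rewrite -(mulrA split_const) (mulrC split_const) -!mulrA ler_wpM2l ?invr_ge0 ?pi_ge0//.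
apply: (le_trans (E_ub x)).
have S0 := split_const_ge0.
rewrite [leRHS]mulrCA (_ : split_const * tau ^+ 2 * c / (8 * tau + x ^+ 2) = split_const * (tau ^+ 2 * c / (8 * tau + x ^+ 2))); last first.
  by rewrite !mulrA.
rewrite ler_wpM2l// ler_pM ?mulr_ge0 ?sqr_ge0 ?(ltW c0)//.
- by rewrite invr_ge0 addr_ge0 ?sqr_ge0// mulr_ge0.
(* The loss tau^2 is at most exp(2 tau), and pi^2 >= 4, so tau^2 c <= exp(-2 tau) <= exp(-tau). *)
- have h1 : tau <= expR tau by rewrite (le_trans _ (expR_ge1Dx _))// lerDr.
  have h2 : tau ^+ 2 <= expR (tau + tau).
    by rewrite expRD expr2 ler_pM// ?ltW.
  apply: (@le_trans _ _ (expR (tau + tau) * c)); first by rewrite ler_wpM2r ?(ltW c0).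
  rewrite /c -expRD ler_expR.
  have p2 : 4 <= pi ^+ 2 :> R.
    rewrite (_ : 4 = 2 ^+ 2 :> R); last by rewrite -natrX.
    by rewrite ler_sqr ?nnegrE ?pi_ge0// pi_ge2.
  have : tau * 4 <= tau * pi ^+ 2 by rewrite ler_wpM2l// ltW.
  move: tau0; lra.
- by rewrite lef_pV2 ?posrE ?ltr_wpDr ?sqr_ge0// ?mulr_gt0// lerD2r; move: tau1; lra.
Qed.

End GaussianSplit.

(** * Cauchy kernels *)

Section CauchyKernel.
Context {R : realType}.
Implicit Types (l x y z t : R).
Let mu := (@lebesgue_measure R).

(** This is pi times the Cauchy density of scale l; its primitive atan (z / l) governs both its
    integrals and its sums over integers. *)
Definition cauchy_kernel l z : R := l^-1 / (1 + (z / l) ^+ 2).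

Let den_gt0 z : 0 < 1 + z ^+ 2 :> R.
Proof. by rewrite ltr_wpDr ?sqr_ge0. Qed.

Lemma cauchy_kernel_ge0 l z : 0 < l -> 0 <= cauchy_kernel l z.
Proof. by move=> l0; rewrite /cauchy_kernel divr_ge0 ?invr_ge0 ?(ltW l0) ?(ltW (den_gt0 _)). Qed.

Lemma cauchy_kernel_le l z : 0 < l -> cauchy_kernel l z <= l^-1.
Proof.
move=> l0; rewrite /cauchy_kernel ler_pdivrMr// ler_pMr ?invr_gt0//.
by rewrite lerDl sqr_ge0.
Qed.

Lemma cauchy_kernelN l z : cauchy_kernel l (- z) = cauchy_kernel l z.
Proof. by rewrite /cauchy_kernel mulNr sqrrN. Qed.

Lemma cauchy_kernel_scale N l z : 0 < N -> 0 < l ->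
  cauchy_kernel l z = N * cauchy_kernel (l * N) (N * z).
Proof.
move=> N0 l0; rewrite /cauchy_kernel (_ : N * z / (l * N) = z / l); last first.
  by field; rewrite !gt_eqF.
by rewrite invfM mulrA mulrCA mulfV ?mulr1// gt_eqF.
Qed.

Lemma continuous_cauchy_kernel l : continuous (cauchy_kernel l).
Proof.
move=> z; rewrite /cauchy_kernel; apply: cvgM; first exact: cvg_cst.
apply: cvgV; first by rewrite gt_eqF.
apply: cvgD; first exact: cvg_cst.
by rewrite /GRing.exp/=; apply: cvgM; apply: cvgM; (exact: cvg_id || exact: cvg_cst).
Qed.

Let is_derive_atan l z : 0 < l ->
  is_derive z 1 (fun z => atan (z / l)) (cauchy_kernel l z).
Proof.
move=> l0; have h : is_derive z 1 (fun z : R => z / l) l^-1.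
  by apply: is_derive_eq; rewrite /GRing.scale/=; ring.
apply: (is_derive_eq (is_derive1_comp (is_derive1_atan _) h)).
by rewrite /cauchy_kernel mulrC.
Qed.

Let atanB_le_pi (a b : R) : atan a - atan b <= pi.
Proof.
have := atan_ltpi2 a; have := atan_gtNpi2 b.
have : pi = pi / 2 + pi / 2 :> R by rewrite -splitr.
move: (pi : R) (pi / 2) (atan a) (atan b) => p q u v; lra.
Qed.

(** By the mean value theorem the difference of arctangents is the kernel at some c in (z, z + 1).
    Division by l >= 1 leaves c / l and z / l at distance at most 1, and then 1 + (c/l)^2 <= 3 (1 +
    (z/l)^2). *)
Let cauchy_kernel_step l z : 1 <= l ->
  cauchy_kernel l z <= 3 * (atan ((z + 1) / l) - atan (z / l)).
Proof.
move=> l1; have l0 : 0 < l by rewrite (lt_le_trans _ l1).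
have zz : z < z + 1 by rewrite ltrDl.
have cf : {within `[z, z + 1], continuous (fun z => atan (z / l))}.
  by apply: derivable_within_continuous => y _; exact: (@ex_derive _ _ _ _ _ _ _ (is_derive_atan y l0)).
have [c /[!in_itv]/= /andP[zc cz] ->] := MVT zz (fun y _ => is_derive_atan y l0) cf.
rewrite addrAC subrr add0r mulr1 /cauchy_kernel.
rewrite ler_pdivrMr// -mulrA -[leLHS]mulr1 mulrCA -!mulrA ler_wpM2l ?invr_ge0 ?(ltW l0)//.
rewrite ler_pdivlMl// mulr1.
have hc : c / l <= z / l + 1.
  rewrite -[X in _ + X](@mulfV _ l) ?gt_eqF// -mulrDl ler_pM2r ?invr_gt0//; lra.
have hz : z / l <= c / l by rewrite ler_pM2r ?invr_gt0 ?ltW.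
move: (c / l) (z / l) hc hz => u v uv vu.
have : 0 <= (u - v) * (1 - (u - v)) by apply: mulr_ge0; lra.
have : 0 <= (2 * v - u) ^+ 2 by exact: sqr_ge0.
have : 0 <= (u - v) by lra.
nra.
Qed.

(** For l >= 1 the arctangents telescope to at most pi; for l < 1 the kernel is at most 1/l times
    that of scale 1. Uniformity in the shift x and the length K is what the column sums of the
    sampled Schur test require. *)
Lemma cauchy_kernel_sum l x (K : nat) : 0 < l ->
  \sum_(k < K) cauchy_kernel l (k%:R + x) <= 3 * pi * (1 + l^-1).
Proof.
have big l' : 1 <= l' -> \sum_(k < K) cauchy_kernel l' (k%:R + x) <= 3 * pi.
  move=> l1.
  apply: (@le_trans _ _ (\sum_(k < K) 3 * (atan ((k.+1%:R + x) / l') - atan ((k%:R + x) / l')))).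
    apply: ler_sum => k _; have := cauchy_kernel_step (k%:R + x) l1.
    by rewrite addrAC natr1.
  rewrite -mulr_sumr ler_wpM2l//.
  by rewrite -(big_mkord xpredT (fun k => atan ((k.+1%:R + x) / l') - atan ((k%:R + x) / l'))) telescope_sumr.
move=> l0; have [l1|l1] := leP 1 l.
  by apply: (le_trans (big _ l1)); rewrite ler_peMr ?mulr_ge0 ?pi_ge0// lerDl invr_ge0 ltW.
apply: (@le_trans _ _ (l^-1 * \sum_(k < K) cauchy_kernel 1 (k%:R + x))).
  rewrite mulr_sumr; apply: ler_sum => k _.
  rewrite /cauchy_kernel invr1 mulr1 mul1r ler_wpM2l ?invr_ge0 ?(ltW l0)//.
  rewrite lef_pV2 ?posrE// lerD2l -[leLHS]mulr1 expr_div_n ler_wpM2l ?sqr_ge0//.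
  by rewrite invf_ge1 ?exprn_gt0// expr_le1// ltW.
apply: (@le_trans _ _ (l^-1 * (3 * pi))); first by rewrite ler_wpM2l ?invr_ge0 ?(ltW l0)// big.
by rewrite mulrC ler_wpM2l ?mulr_ge0 ?pi_ge0// lerDr.
Qed.

(** The segments are multiples of s so that, for s = 1/N, each consists of whole sampling
    periods. *)
Lemma integral_le_segments (f : R -> R) (s : R) (B : \bar R) : 0 < s ->
  measurable_fun [set: R] f -> (forall x, 0 <= f x) ->
  (forall K : nat, \int[mu]_(x in `[(- (s * K%:R))%R, (s * K%:R)%R]) (f x)%:E <= B)%E ->
  (\int[mu]_x (f x)%:E <= B)%E.
Proof.
move=> s0 mf f0 fB.
pose F (K : nat) : set R := `[- (s * K%:R), s * K%:R]%classic.
have ndF : nondecreasing_seq F.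
  move=> m n mn; apply/subsetPset => x; rewrite /F/= !in_itv/= => /andP[h1 h2].
  have mn' : s * m%:R <= s * n%:R by rewrite ler_pM2l// ler_nat.
  by rewrite (le_trans h2)// andbT (le_trans _ h1)// lerN2.
have UF : \bigcup_K F K = setT.
  rewrite -subTset => x _; exists (Num.truncn (`|x| / s)).+1 => //.
  rewrite /F/= in_itv/= -ler_norml -ler_pdivrMl// mulrC ltW//.
  by apply: truncnS_gt.
have h : (\int[mu]_(x in F i) (EFin \o f) x @[i --> \oo] --> \int[mu]_x (EFin \o f) x)%E.
  rewrite -UF; apply: ge0_nondecreasing_set_cvg_integral => //.
  - by move=> i; exact: measurable_itv.
  - by move=> i; apply/measurable_EFinP; exact: measurable_funTS.
  - by move=> i x _; rewrite lee_fin.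
rewrite -(cvg_lim _ h)//; apply: lime_le; first by apply/cvg_ex; eexists; exact: h.
by apply: nearW => K; exact: fB.
Qed.

Lemma integral_cauchy_kernel l x : 0 < l ->
  (\int[mu]_y (cauchy_kernel l (x - y))%:E <= pi%:E)%E.
Proof.
move=> l0.
have cc : continuous (fun y : R => cauchy_kernel l (x - y)).
  move=> y; apply: (@continuous_comp _ _ _ (fun y => x - y) (cauchy_kernel l)); last exact: continuous_cauchy_kernel.
  by apply: cvgB; [exact: cvg_cst|exact: cvg_id].
apply: (integral_le_segments ltr01).
- exact: continuous_measurable_fun.
- by move=> y; rewrite cauchy_kernel_ge0.
move=> K; rewrite mul1r.
have -> : (\int[mu]_(y in `[(- K%:R)%R, K%:R]) (cauchy_kernel l (x - y))%:E =
    (\int[mu]_(y in `[(- K%:R)%R, K%:R]) (cauchy_kernel l (x - y)))%R%:E)%E.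
  rewrite /Rintegral fineK//; apply: integrable_fin_num => //.
  exact: integrable_segment.
have dF (y : R) : is_derive y 1 (fun y => - atan ((x - y) / l)) (cauchy_kernel l (x - y)).
  have h : is_derive y 1 (fun y : R => x - y) (-1).
    by apply: is_derive_eq; ring.
  apply: (is_derive_eq (is_deriveN (is_derive1_comp (is_derive_atan _ l0) h))).
  by rewrite mulrN1 opprK.
have KK : - K%:R <= K%:R :> R by rewrite (@le_trans _ _ 0)// oppr_le0.
rewrite (Rintegral_FTC2 KK cc dF) lee_fin opprK addrC.
exact: atanB_le_pi.
Qed.

Lemma heat1_ge0 t z : 0 <= heat1 t z.
Proof. by rewrite mulr_ge0 ?expR_ge0// invr_ge0 sqrtr_ge0. Qed.

Let sqrt_4pit t : 0 < t -> (Num.sqrt (4 * pi * t))^-1 <= (2 * Num.sqrt t)^-1.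
Proof.
move=> t0; rewrite lef_pV2 ?posrE ?mulr_gt0 ?sqrtr_gt0 ?mulr_gt0 ?pi_gt0//.
rewrite -(@ger0_norm _ 2)// -sqrtr_sqr -sqrtrM ?sqr_ge0// ler_sqrt ?mulr_ge0 ?pi_ge0 ?(ltW t0)//.
rewrite ler_wpM2r ?(ltW t0)// expr2 (_ : 2 * 2 = 4 * 1 :> R); last by ring.
by rewrite ler_wpM2l// (le_trans _ (pi_ge2 R))// ler1n.
Qed.

Let sq_2sqrt t z : 0 < t -> (z / (2 * Num.sqrt t)) ^+ 2 = z ^+ 2 / (4 * t).
Proof.
move=> t0; rewrite expr_div_n exprMn sqr_sqrtr ?ltW//.
by rewrite -natrX.
Qed.

Lemma heat1_le_cauchy t z : 0 < t ->
  heat1 t z <= cauchy_kernel (2 * Num.sqrt t) z.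
Proof.
move=> t0; rewrite /heat1 /cauchy_kernel sq_2sqrt// ler_pM ?invr_ge0 ?sqrtr_ge0 ?expR_ge0 ?sqrt_4pit//.
set s := _ / _; have s0 : 0 <= s by rewrite divr_ge0 ?sqr_ge0// mulr_ge0// ltW.
by rewrite expRN lef_pV2 ?posrE ?expR_gt0 ?expR_ge1Dx// ltr_wpDr.
Qed.

Lemma norm_heat1_le_cauchy t z : 0 < t ->
  `|z| * heat1 t z <= 4 * Num.sqrt t * cauchy_kernel (2 * Num.sqrt t) z.
Proof.
move=> t0; set q := Num.sqrt t; have q0 : 0 < q by rewrite sqrtr_gt0.
pose a := `|z| / (2 * q).
have a0 : 0 <= a by rewrite divr_ge0// mulr_ge0// ltW.
have zE : `|z| = 2 * q * a by rewrite /a mulrC divfK// mulf_neq0// gt_eqF.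
have sE : z ^+ 2 / (4 * t) = a ^+ 2.
  by rewrite -sq_2sqrt// -/q /a -[in RHS](@ger0_norm _ (2 * q)) -?normf_div ?real_normK ?num_real// mulr_ge0// ltW.
rewrite /cauchy_kernel sq_2sqrt// sE /heat1 sE zE.
(* Combines exp(a^2) >= (1 + a^2 / 2)^2 with a <= (1 + a^2) / 2: the factor |z| is absorbed without
   losing the Cauchy decay. *)
have h1 : expR (- a ^+ 2) * a <= 2 / (1 + a ^+ 2).
  rewrite expRN ler_pdivlMr// -mulrA ler_pdivrMl ?expR_gt0//.
  have : (1 + a ^+ 2 / 2) ^+ 2 <= expR (a ^+ 2).
    rewrite [X in expR X](splitr (a ^+ 2)) expRD -expr2.
    rewrite ler_sqr ?nnegrE ?expR_ge0 ?expR_ge1Dx// addr_ge0// divr_ge0 ?sqr_ge0//.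
  have : 0 <= (a - 1) ^+ 2 by exact: sqr_ge0.
  move: (expR _) => e ha he; have : a <= (1 + a ^+ 2) / 2 by nra.
  move=> hh; apply: (@le_trans _ _ ((1 + a ^+ 2) / 2 * (1 + a ^+ 2))).
    by rewrite ler_wpM2r// ltW.
  nra.
have h2 := sqrt_4pit t0; rewrite -/q in h2.
rewrite (_ : 2 * q * a * _ = (2 * q) * ((Num.sqrt (4 * pi * t))^-1 * (expR (- a ^+ 2) * a))); last first.
  by move: (Num.sqrt _)^-1 (expR _) => u v; ring.
rewrite (_ : 4 * q * _ = (2 * q) * ((2 * q)^-1 * (2 / (1 + a ^+ 2)))); last first.
  by move: (den_gt0 a) => da; field; rewrite !gt_eqF.
rewrite ler_wpM2l ?mulr_ge0 ?(ltW q0)// ler_pM ?invr_ge0 ?sqrtr_ge0//.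
by rewrite mulr_ge0 ?expR_ge0.
Qed.

Lemma sinc_sq_le z : sinc z ^+ 2 <= 2 * cauchy_kernel 1 z.
Proof.
rewrite /cauchy_kernel invr1 mulr1 mul1r ler_pdivlMr//.
have h1 : sinc z ^+ 2 <= 1.
  have [->|z0] := eqVneq z 0; first by rewrite sinc0 expr1n.
  have pz : 0 < `|pi * z| by rewrite normr_gt0 mulf_neq0// gt_eqF// pi_gt0.
  rewrite -real_normK ?num_real// expr_le1// sincE// normf_div ler_pdivrMr// mul1r.
  have [h|h] := leP 0 (pi * z); first by rewrite (ger0_norm h) norm_sin_le.
  by rewrite -normrN -sinN (ltr0_norm h) norm_sin_le// oppr_ge0 ltW.
have h2 : sinc z ^+ 2 * z ^+ 2 <= 1.
  have [->|z0] := eqVneq z 0; first by rewrite expr0n mulr0.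
  rewrite -exprMn sincE// invfM mulrA divfK// expr_div_n.
  rewrite ler_pdivrMr ?exprn_gt0 ?pi_gt0// mul1r (@le_trans _ _ 1)//.
    by rewrite expr_ge1// (le_trans _ (pi_ge2 R))// ler1n.
rewrite mulrDr mulr1 (_ : 2 = 1 + 1 :> R)// lerD//.
Qed.

End CauchyKernel.

(** * The one-dimensional band-limited kernel: domination and uniform error *)

Section LowFrequencyPart.
Context {R : realType}.
Implicit Types (x y z t tau : R).
Let mu := (@lebesgue_measure R).

Lemma sum_cauchy_schwarz (I : finType) (w s : I -> R) : (forall i, 0 <= w i) ->
  (\sum_i w i * s i) ^+ 2 <= (\sum_i w i) * \sum_i w i * s i ^+ 2.
Proof.
move=> w0; rewrite -subr_ge0 -(pmulr_rge0 _ (ltr0n R 2)).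
rewrite (_ : 2 * _ = \sum_i \sum_j w i * w j * (s i - s j) ^+ 2).
  by apply: sumr_ge0 => i _; apply: sumr_ge0 => j _; rewrite mulr_ge0 ?sqr_ge0// mulr_ge0.
have dist (u v : I -> R) : (\sum_i u i) * (\sum_j v j) = \sum_i \sum_j u i * v j.
  by rewrite big_distrlr.
transitivity ((\sum_i w i) * (\sum_j w j * s j ^+ 2) + (\sum_i w i * s i ^+ 2) * (\sum_j w j)
    - (\sum_i w i * s i) * (\sum_j w j * s j) *+ 2).
  move: (\sum_i w i) (\sum_i w i * s i) (\sum_i w i * s i ^+ 2) => u v t; ring.
rewrite !dist -sumrMnl -sumrN -!big_split/=; apply: eq_bigr => i _.
by rewrite -sumrMnl -sumrN -!big_split/=; apply: eq_bigr => j _; ring.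
Qed.

Definition majorant tau z : R := cauchy_kernel (2 * Num.sqrt tau) z + cauchy_kernel 1 z.

(** Symmetric partial sums converge at each point, for every translate by y, since y becomes the
    integration variable of the convolution. *)
Definition samplable (G : R -> R) := forall x y,
  \sum_(k < M.*2.+1) G (k%:R - M%:R - y) * sinc (x - (k%:R - M%:R)) @[M --> \oo] -->
  G (x - y).

(** Supplies a dominating function independent of M. Cauchy-Schwarz with weights D q leaves the sum
    of q sinc^2 <= 2 p q, from which [pq] extracts the kernel at x - y; the constant is 288 = 6 * 4
    * 12. *)
Lemma samplable_dominated (G : R -> R) D : 0 <= D ->
  (forall z, `|G z| <= D * cauchy_kernel 1 z) ->
  forall M x y,
  (\sum_(k < M.*2.+1) G (k%:R - M%:R - y) * sinc (x - (k%:R - M%:R))) ^+ 2 <=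
  (288 * pi ^+ 2 * D ^+ 2) * cauchy_kernel 1 (x - y).
Proof.
move=> D0 GD M x y.
pose q k : R := cauchy_kernel 1 (k%:R - M%:R - y).
pose p k : R := cauchy_kernel 1 (x - (k%:R - M%:R)).
have q0 k : 0 <= q k by exact: cauchy_kernel_ge0.
have p0 k : 0 <= p k by exact: cauchy_kernel_ge0.
have pi6 : 3 * pi * (1 + 1^-1) = 6 * pi :> R.
  by rewrite invr1; move: (pi : R) => u; ring.
have qsum : \sum_(k < M.*2.+1) q k <= 6 * pi.
  under eq_bigr do rewrite /q -addrA.
  by apply: (le_trans (cauchy_kernel_sum _ _ ltr01)); rewrite pi6.
have psum : \sum_(k < M.*2.+1) p k <= 6 * pi.
  under eq_bigr do rewrite /p -cauchy_kernelN opprB -addrA.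
  by apply: (le_trans (cauchy_kernel_sum _ _ ltr01)); rewrite pi6.
set S := \sum_(k < _) _.
have hS : S ^+ 2 <= (\sum_(k < M.*2.+1) D * q k * `|sinc (x - (k%:R - M%:R))|) ^+ 2.
  rewrite -real_normK ?num_real// ler_sqr ?nnegrE//; last first.
    by apply: sumr_ge0 => k _; rewrite mulr_ge0// mulr_ge0.
  apply: (le_trans (ler_norm_sum _ _ _)); apply: ler_sum => k _.
  by rewrite normrM ler_wpM2r.
apply: (le_trans hS).
apply: (le_trans (sum_cauchy_schwarz _ _)) => [k|]; first by rewrite mulr_ge0.
(* With x - y = a + b this is 1 + (a + b)^2 <= 2 ((1 + a^2) + (1 + b^2)): a and b cannot both be
   small against x - y. *)
have pq k : p k * q k <= 2 * cauchy_kernel 1 (x - y) * (p k + q k).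
  rewrite /p /q /cauchy_kernel !invr1 !mulr1 !mul1r.
  set a := x - (k%:R - M%:R); set b := k%:R - M%:R - y.
  have -> : x - y = a + b by rewrite /a /b; ring.
  have a0 : 0 < 1 + a ^+ 2 by rewrite ltr_wpDr ?sqr_ge0.
  have b0 : 0 < 1 + b ^+ 2 by rewrite ltr_wpDr ?sqr_ge0.
  have c0 : 0 < 1 + (a + b) ^+ 2 by rewrite ltr_wpDr ?sqr_ge0.
  rewrite (_ : 2 * _ * _ = (2 * ((1 + a ^+ 2) + (1 + b ^+ 2)) / (1 + (a + b) ^+ 2)) *
    ((1 + a ^+ 2)^-1 * (1 + b ^+ 2)^-1)); last first.
    by field; rewrite !gt_eqF.
  rewrite ler_peMl ?mulr_ge0 ?invr_ge0 ?(ltW a0) ?(ltW b0)//.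
  rewrite ler_pdivlMr// mul1r.
  have : 0 <= (a - b) ^+ 2 by exact: sqr_ge0.
  nra.
have K0 : 0 <= cauchy_kernel 1 (x - y) by exact: cauchy_kernel_ge0.
have h1 : \sum_(k < M.*2.+1) D * q k <= D * (6 * pi).
  by rewrite -mulr_sumr ler_wpM2l.
have h2 : \sum_(k < M.*2.+1) D * q k * `|sinc (x - (k%:R - M%:R))| ^+ 2 <=
    D * (4 * cauchy_kernel 1 (x - y) * (12 * pi)).
  apply: (@le_trans _ _ (\sum_(k < M.*2.+1) D * (4 * cauchy_kernel 1 (x - y) * (p k + q k)))).
    apply: ler_sum => k _; rewrite -mulrA ler_wpM2l//.
    rewrite real_normK ?num_real//.
    apply: (@le_trans _ _ (q k * (2 * p k))); first by rewrite ler_wpM2l// sinc_sq_le.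
    have := pq k; lra.
  rewrite -mulr_sumr ler_wpM2l// -mulr_sumr; apply: ler_wpM2l; first exact: mulr_ge0.
  rewrite big_split/= (_ : 12 * pi = 6 * pi + 6 * pi :> R); first exact: lerD.
  by rewrite -mulrDl -natrD.
have S1 : 0 <= \sum_(k < M.*2.+1) D * q k.
  by apply: sumr_ge0 => k _; rewrite mulr_ge0.
have S2 : 0 <= \sum_(k < M.*2.+1) D * q k * `|sinc (x - (k%:R - M%:R))| ^+ 2.
  by apply: sumr_ge0 => k _; rewrite mulr_ge0 ?exprn_ge0// mulr_ge0.
apply: (le_trans (ler_pM S1 S2 h1 h2)).
by rewrite le_eqVlt; apply/orP; left; apply/eqP; move: (pi : R) (cauchy_kernel _ _) => u v; ring.
Qed.

(** C is uniform in tau because it enters the final constant. D may depend on tau: it serves only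
    integrability and the convergence of the sampling series. *)
Lemma low_frequency_part : exists2 C : R, 0 < C & forall tau, 0 < tau ->
  exists2 G : R -> R, samplable G /\ continuous G &
  exists2 D : R, 0 <= D &
  forall z, `|G z| <= D * cauchy_kernel 1 z /\
    `|heat1 tau z - G z| <= C * expR (- tau) * majorant tau z.
Proof.
pose C : R := expR 1 + `|split_const| / pi.
have C0 : 0 < C by rewrite ltr_wpDr ?expR_gt0// divr_ge0 ?pi_ge0.
have ck0 z : 0 <= cauchy_kernel 1 z :> R by exact: cauchy_kernel_ge0.
exists C => // tau tau0.
have s0 : 0 < 2 * Num.sqrt tau by rewrite mulr_gt0 ?sqrtr_gt0.
have [tau1|tau1] := leP 1 tau; last first.
  (* For tau < 1 one has exp(1) exp(-tau) >= 1, so the whole heat kernel is an admissible error. *)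
  exists (cst 0); [split|exists 0 => // z].
  - move=> x y; rewrite [X in X @ _](_ : _ = cst 0); first exact: cvg_cst.
    by apply/funext => M; rewrite big1// => k _; rewrite mul0r.
  - exact: cst_continuous.
  rewrite /cst/= normr0 mul0r subr0 ger0_norm ?heat1_ge0//; split => //.
  apply: (le_trans (heat1_le_cauchy z tau0)).
  apply: (@le_trans _ _ (1 * majorant tau z)); first by rewrite mul1r lerDl.
  apply: ler_wpM2r; first by rewrite addr_ge0// cauchy_kernel_ge0.
  apply: (@le_trans _ _ (expR 1 * expR (- tau))).
    by rewrite -expRD -[leLHS]expR0 ler_expR subr_ge0 ltW.
  by rewrite ler_wpM2r ?expR_ge0// lerDl divr_ge0 ?pi_ge0.
have Hz z := heat1_sub_low_heat tau1 z.
have kE z : (1 + z ^+ 2)^-1 = cauchy_kernel 1 z by rewrite /cauchy_kernel invr1 mulr1 mul1r.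
exists (low_heat tau); [split|].
- move=> x y; have := @cos_transform_sampling R (cut_gauss tau) x y (@continuous_cut_gauss R tau).
  move=> h; rewrite /low_heat.
  under eq_fun do under eq_bigr do rewrite -mulrA.
  under eq_fun do rewrite -mulr_sumr.
  apply: cvgM; first exact: cvg_cst.
  exact: h.
- exact: continuous_low_heat.
exists (2 * Num.sqrt tau + split_const / pi * expR (- tau)).
  rewrite addr_ge0 ?(ltW s0)// mulr_ge0 ?expR_ge0// divr_ge0 ?pi_ge0//.
  exact: split_const_ge0.
move=> z; split.
  rewrite (_ : low_heat tau z = heat1 tau z - (heat1 tau z - low_heat tau z)); last by ring.
  apply: (le_trans (ler_normB _ _)); rewrite mulrDl lerD//; last first.
    by rewrite -kE.
  rewrite ger0_norm ?heat1_ge0//; apply: (le_trans (heat1_le_cauchy z tau0)).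
  rewrite -kE /cauchy_kernel; set l := 2 * _.
  have l1 : 1 <= l.
    have : 1 <= Num.sqrt tau by rewrite -[leLHS]sqrtr1 ler_wsqrtr.
    by rewrite /l; move: (Num.sqrt tau) => u; lra.
  have d1 : 0 < 1 + (z / l) ^+ 2 by rewrite ltr_wpDr ?sqr_ge0.
  have d2 : 0 < 1 + z ^+ 2 by rewrite ltr_wpDr ?sqr_ge0.
  rewrite ler_pdivrMr// mulrAC ler_pdivlMr// ler_pdivrMl//.
  rewrite mulrA -expr2 mulrDr mulr1 expr_div_n mulrCA mulfV ?mulr1; last by rewrite expf_neq0 ?gt_eqF.
  by rewrite lerD2r expr_ge1// ltW.
apply: (le_trans (Hz z)); rewrite kE.
apply: (@le_trans _ _ (split_const / pi * expR (- tau) * majorant tau z)).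
  apply: ler_wpM2l; last by rewrite lerDr cauchy_kernel_ge0.
  by rewrite mulr_ge0 ?expR_ge0// divr_ge0 ?pi_ge0// split_const_ge0.
apply: ler_wpM2r; first by rewrite addr_ge0// cauchy_kernel_ge0.
rewrite ler_wpM2r ?expR_ge0// -[leLHS]add0r lerD ?expR_ge0//.
by rewrite ler_wpM2r ?invr_ge0 ?pi_ge0// ler_norm.
Qed.

End LowFrequencyPart.

(** * Bessel inequality for sinc combinations *)

Section SincBesselIntegral.
Context {R : realType}.
Let mu := (@lebesgue_measure R).

(** As the average of cos (q z) over [0, pi], sinc shows no exceptional point at 0. *)
Lemma continuous_sinc : continuous (@sinc R).
Proof.
have -> : @sinc R = fun z => pi^-1 * \int[mu]_(q in `[0, pi]) cos (q * z).
  by apply/funext => z; rewrite integral_cos_pi mulKf// gt_eqF// pi_gt0.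
move=> z; apply: cvgM; first exact: cvg_cst.
have zI : `]z - 1, z + 1[%classic z by rewrite /= in_itv/= ltrBlDr ltrDl ltr01.
apply: (@continuity_under_integral R _ _ mu (fun z q : R => cos (q * z)) `[0, pi] (measurable_itv _) (z - 1) (z + 1) _ _ (cst 1)).
- by move=> x _; apply: integrable_segment; exact: continuous_cosM.
- apply: aeW => q _ x _; apply: continuous_comp; last exact: continuous_cos.
  by apply: cvgM; [exact: cvg_cst|exact: cvg_id].
- by apply: integrable_segment => q; exact: cvg_cst.
- by move=> x _; apply: aeW => q _; exact: cos_max.
- exact/mem_set.
Qed.

Lemma Rintegral_shift (f : R -> R) (a b c : R) : a <= b -> continuous f ->
  \int[mu]_(x in `[a + c, b + c]) f x = \int[mu]_(x in `[a, b]) f (x + c).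
Proof.
move=> ab cf; rewrite /Rintegral; congr fine.
pose F := fun x : R => x + c.
have dF (x : R) : is_derive x 1 F 1.
  by rewrite /F; apply: is_derive_eq; rewrite addr0.
have cF : continuous F by move=> x; apply: cvgD; [exact: cvg_id|exact: cvg_cst].
have F'1 : derive1 F = cst 1.
  by apply/funext => x; rewrite derive1E; exact: (@derive_val _ _ _ _ _ _ _ (dF x)).
rewrite (@integration_by_substitution_increasing R F f a b)//.
- by rewrite F'1; apply: eq_integral => x _ /=; rewrite mulr1.
- by move=> x y _ _; rewrite /F ltrD2r.
- by rewrite F'1 => x _; exact: cst_continuous.
- by rewrite F'1; apply/cvg_ex; exists 1; exact: cvg_cst.
- by rewrite F'1; apply/cvg_ex; exists 1; exact: cvg_cst.
- split.
  + by move=> x _; exact: (@ex_derive _ _ _ _ _ _ _ (dF x)).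
  + by apply: cvg_at_right_filter; exact: cF.
  + by apply: cvg_at_left_filter; exact: cF.
- exact: continuous_subspaceT.
Qed.

Lemma Rintegral_split (f : R -> R) (a s : R) (m : nat) : 0 <= s -> continuous f ->
  \int[mu]_(x in `[a, a + s * m%:R]) f x =
  \sum_(j < m) \int[mu]_(x in `[0, s]) f (x + (a + s * j%:R)).
Proof.
move=> s0 cf; elim: m => [|m IH].
  by rewrite mulr0 addr0 big_ord0 set_itv1 Rintegral_set1.
rewrite big_ord_recr/= -IH -[X in _ = _ + X]Rintegral_shift// add0r.
have sE : s + (a + s * m%:R) = a + s * m.+1%:R by rewrite -natr1; ring.
have le1 : a <= a + s * m%:R by rewrite lerDl mulr_ge0.
have le2 : a + s * m%:R <= a + s * m.+1%:R by rewrite -sE lerDr.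
rewrite sE -[X in _ = _ + X]Rintegral_itv_obnd_cbnd; last first.
  by apply: integrableS (integrable_segment (a + s * m%:R) (a + s * m.+1%:R) cf) => //; exact: subset_itv_oc_cc.
rewrite -(@Rintegral_itvB _ f (BLeft a) (BRight (a + s * m.+1%:R)) (a + s * m%:R))//.
  by rewrite [RHS]addrC subrK.
exact: integrable_segment.
Qed.

Definition node M (k : 'I_M.*2.+1) : R := k%:R - M%:R.

(** The integral is folded onto one period [0, 1/N]. For fixed x the points x + j/N form, after
    scaling by N, a shifted integer grid, so [sinc_bessel] bounds the folded integrand uniformly;
    the factor N^-1 is the length of the period. *)
Lemma integral_sinc_bessel1 (N : R) M (c : 'I_M.*2.+1 -> R) : 0 < N ->
  (\int[mu]_x ((\sum_k c k * sinc (N * x - node k)) ^+ 2)%:E <=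
   (N^-1 * \sum_k c k ^+ 2)%:E)%E.
Proof.
move=> N0; pose f x := (\sum_k c k * sinc (N * x - node k)) ^+ 2.
have cf : continuous f.
  have cg : continuous (fun x : R => \sum_k c k * sinc (N * x - node k)).
    move=> x; apply: cvg_big => [|k _]; first exact: add_continuous.
    apply: cvgM; first exact: cvg_cst.
    apply: (@continuous_comp _ _ _ (fun x => N * x - node k) sinc); last exact: continuous_sinc.
    by apply: cvgB; [apply: cvgM; [exact: cvg_cst|exact: cvg_id]|exact: cvg_cst].
  by move=> x; rewrite /f; apply: cvgM; exact: cg.
have Ni0 : 0 < N^-1 by rewrite invr_gt0.
apply: (integral_le_segments Ni0).
- exact: continuous_measurable_fun.
- by move=> x; exact: sqr_ge0.
move=> K; set a := - _.
have -> : N^-1 * K%:R = a + N^-1 * K.*2%:R :> R by rewrite /a -addnn natrD; ring.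
have -> : (\int[mu]_(x in `[a, (a + N^-1 * K.*2%:R)%R]) (f x)%:E =
    (\int[mu]_(x in `[a, (a + N^-1 * K.*2%:R)%R]) (f x))%R%:E)%E.
  by rewrite /Rintegral fineK//; apply: integrable_fin_num => //; exact: integrable_segment.
rewrite lee_fin (Rintegral_split _ _ (ltW Ni0) cf).
have cfs j : continuous (fun x => f (x + (a + N^-1 * j%:R))).
  move=> x; apply: (@continuous_comp _ _ _ (fun x => x + (a + N^-1 * j%:R)) f); last exact: cf.
  by apply: cvgD; [exact: cvg_id|exact: cvg_cst].
rewrite -Rintegral_sum_seg; last by move=> j; exact: cfs.
apply: (@le_trans _ _ (\int[mu]_(x in `[0, N^-1]) (\sum_k c k ^+ 2))).
  apply: le_Rintegral => //=.
  - apply: integrable_segment => x; apply: cvg_big => [|k _]; first exact: add_continuous.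
    exact: cfs.
  - by apply: integrable_segment => x; exact: cvg_cst.
  move=> x _; rewrite /f.
  have := @sinc_bessel R K.*2 M.*2.+1 c (N * x - K%:R + M%:R).
  apply: le_trans; rewrite le_eqVlt; apply/orP; left; apply/eqP.
  apply: eq_bigr => j _; congr (_ ^+ 2); apply: eq_bigr => k _; congr (_ * sinc _).
  rewrite /node /a; field.
  by rewrite gt_eqF.
rewrite Rintegral_cst//= lebesgue_measure_itv/= lte_fin Ni0/= subr0.
by rewrite mulrC.
Qed.

End SincBesselIntegral.

(** * Integration on R^d, one coordinate at a time *)

Section IntegralRd.
Context {R : realType}.
Let mu := (@lebesgue_measure R).

Lemma big_tuple_cons (V : nmodType) (T : finType) n (F : n.+1.-tuple T -> V) :
  \sum_k F k = \sum_(a : T) \sum_(k : n.-tuple T) F [tuple of a :: k].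
Proof.
rewrite pair_bigA/= (reindex (fun p : T * n.-tuple T => [tuple of p.1 :: p.2]))//=.
exists (fun t : n.+1.-tuple T => (thead t, [tuple of behead t])) => [[a k] _|t _] /=.
  by rewrite theadE; congr pair; exact/val_inj.
by rewrite [RHS]tuple_eta.
Qed.

Lemma integral_RdS n (f : Rd R n.+1 -> \bar R) :
  measurable_fun setT f -> (forall x, 0 <= f x)%E ->
  (\int[lebesgue_measureRd n.+1]_x f x =
   \int[mu]_a \int[lebesgue_measureRd n]_x f (consRd (a, x)))%E.
Proof.
move=> mf f0.
rewrite [LHS](@ge0_integral_pushforward _ _ _ _ _ _ (@measurable_consRd R n) (lebesgue_measure \x lebesgue_measureRd n)%E setT f)//=.
by rewrite preimage_setT fubini_tonelli1//; exact: measurableT_comp (@measurable_consRd R n).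
Qed.

Lemma integral_Rd0 (f : Rd R 0 -> \bar R) : measurable_fun setT f ->
  (\int[lebesgue_measureRd 0]_x f x = f [tuple])%E.
Proof.
by move=> mf; rewrite /lebesgue_measureRd/= integral_dirac// diracT mul1e.
Qed.

Lemma measurable_tnth_comp n (i : 'I_n) (g : R -> R) : measurable_fun setT g ->
  measurable_fun setT (fun x : Rd R n => g (tnth x i)).
Proof. by move=> mg; apply: measurableT_comp => //; exact: measurable_tnth. Qed.

Lemma measurable_prod_tnth n (phi : 'I_n -> R -> R) :
  (forall i, measurable_fun setT (phi i)) ->
  measurable_fun setT (fun x : Rd R n => \prod_i phi i (tnth x i)).
Proof. by move=> mphi; apply: measurable_prod => i _; exact: measurable_tnth_comp. Qed.

Lemma integral_prod_le n (phi : 'I_n -> R -> R) (alpha : R) : 0 <= alpha ->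
  (forall i, measurable_fun setT (phi i)) -> (forall i z, 0 <= phi i z) ->
  (forall i, \int[mu]_z (phi i z)%:E <= alpha%:E)%E ->
  (\int[lebesgue_measureRd n]_x (\prod_i phi i (tnth x i))%:E <= (alpha ^+ n)%:E)%E.
Proof.
move=> a0; elim: n phi => [|n IH] phi mphi phi0 hphi.
  rewrite integral_Rd0 ?big_ord0 ?expr0//.
  by apply/measurable_EFinP; exact: measurable_prod_tnth.
have mphi' i : measurable_fun setT (phi (lift ord0 i)) by exact: mphi.
rewrite integral_RdS; last 2 first.
- by apply/measurable_EFinP; exact: measurable_prod_tnth.
- by move=> x; rewrite lee_fin prodr_ge0.
apply: (@le_trans _ _ (\int[mu]_a ((alpha ^+ n)%:E * (phi ord0 a)%:E))%E).
  apply: ge0_le_integral => //.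
  - by move=> a _; apply: integral_ge0 => x _; rewrite lee_fin prodr_ge0.
  - apply: (measurable_fun_fubini_tonelli_F
      (fun p : measurableTypeR R * Rd R n => (\prod_i phi i (tnth (consRd p) i))%:E)).
      apply/measurable_EFinP.
      exact: (measurableT_comp (measurable_prod_tnth mphi) (@measurable_consRd R n)).
    by move=> p; rewrite lee_fin prodr_ge0.
  - apply: emeasurable_funM; first exact: measurable_cst.
    by apply/measurable_EFinP; exact: mphi.
  move=> a _.
  have -> : (\int[lebesgue_measureRd n]_x (\prod_i phi i (tnth (consRd (a, x)) i))%:E =
      \int[lebesgue_measureRd n]_x ((phi ord0 a)%:E *
        (\prod_(i < n) phi (lift ord0 i) (tnth x i))%:E))%E.
    apply: eq_integral => x _; rewrite big_ord_recl -EFinM; congr (_ * _)%:E.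
    by apply: eq_bigr => i _; rewrite tnthS.
  rewrite ge0_integralZl_EFin//; last 2 first.
  - by move=> x _; rewrite lee_fin prodr_ge0.
  - by apply/measurable_EFinP; exact: (@measurable_prod_tnth n (fun i => phi (lift ord0 i))).
  rewrite muleC lee_wpmul2r ?lee_fin//.
  exact: (IH (fun i => phi (lift ord0 i)) mphi' (fun i => phi0 _) (fun i => hphi _)).
rewrite ge0_integralZl_EFin ?exprn_ge0//.
- by rewrite exprS EFinM muleC lee_wpmul2r ?lee_fin ?exprn_ge0.
- by move=> x _; rewrite lee_fin.
- by apply/measurable_EFinP; exact: mphi.
Qed.

Definition sinc_comb n (N : R) M (c : n.-tuple 'I_M.*2.+1 -> R) (x : Rd R n) : R :=
  \sum_k c k * \prod_(j < n) sinc (N * tnth x j - node (tnth k j)).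

Lemma measurable_sinc_shift (N y : R) : measurable_fun setT (fun z : R => sinc (N * z - y)).
Proof.
apply: continuous_measurable_fun => z.
apply: (@continuous_comp _ _ _ (fun x => N * x - y) sinc); last exact: continuous_sinc.
by apply: cvgB; [apply: cvgM; [exact: cvg_cst|exact: cvg_id]|exact: cvg_cst].
Qed.

Lemma measurable_sinc_comb n (N : R) M (c : n.-tuple 'I_M.*2.+1 -> R) :
  measurable_fun setT (sinc_comb N c).
Proof.
apply: measurable_sum => k; apply: measurable_funM; first exact: measurable_cst.
apply: (@measurable_prod_tnth n (fun j z => sinc (N * z - node (tnth k j)))) => j.
exact: measurable_sinc_shift.
Qed.

(** Induction on the dimension. With the first coordinate frozen at a, the combination has
    coefficients [c' a] in the other variables; each of these is in turn a one-dimensional sinc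
    combination in a. *)
Lemma sinc_bessel_Rd n (N : R) M (c : n.-tuple 'I_M.*2.+1 -> R) : 0 < N ->
  (\int[lebesgue_measureRd n]_x (sinc_comb N c x ^+ 2)%:E <=
   (N ^- n * \sum_k c k ^+ 2)%:E)%E.
Proof.
move=> N0; elim: n c => [|n IH] c.
  rewrite integral_Rd0; last first.
    by apply/measurable_EFinP; apply: measurable_funX; exact: measurable_sinc_comb.
  rewrite /sinc_comb expr0 invr1 mul1r lee_fin (big_pred1 [tuple]) => [|k]; last first.
    by apply/esym/eqP/val_inj; case: k => -[].
  rewrite (big_pred1 [tuple]) => [|k]; last first.
    by apply/esym/eqP/val_inj; case: k => -[].
  by rewrite big_ord0 mulr1.
rewrite integral_RdS; last 2 first.
- by apply/measurable_EFinP; apply: measurable_funX; exact: measurable_sinc_comb.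
- by move=> x; rewrite lee_fin sqr_ge0.
pose c' (a : R) (k : n.-tuple 'I_M.*2.+1) := \sum_b c [tuple of b :: k] * sinc (N * a - node b).
have combE a x : sinc_comb N c (consRd (a, x)) = sinc_comb N (c' a) x.
  rewrite /sinc_comb big_tuple_cons exchange_big/=; apply: eq_bigr => k _.
  rewrite mulr_suml; apply: eq_bigr => b _; rewrite big_ord_recl/= mulrA.
  by congr (_ * _); apply: eq_bigr => j _; rewrite !tnthS.
apply: (@le_trans _ _ (\int[mu]_a (N ^- n * \sum_k c' a k ^+ 2)%:E)%E).
  apply: ge0_le_integral => //.
  - by move=> a _; apply: integral_ge0 => x _; rewrite lee_fin sqr_ge0.
  - apply: (measurable_fun_fubini_tonelli_F
      (fun p : measurableTypeR R * Rd R n => (sinc_comb N c (consRd p) ^+ 2)%:E)).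
      apply/measurable_EFinP; apply: measurable_funX.
      exact: (measurableT_comp (measurable_sinc_comb N c) (@measurable_consRd R n)).
    by move=> p; rewrite lee_fin sqr_ge0.
  - apply/measurable_EFinP; apply: measurable_funM; first exact: measurable_cst.
    apply: measurable_sum => k; apply: measurable_funX; apply: measurable_sum => b.
    by apply: measurable_funM; [exact: measurable_cst|exact: measurable_sinc_shift].
  move=> a _; under eq_integral do rewrite combE.
  exact: IH.
under eq_integral do rewrite EFinM.
have mc' k : measurable_fun setT (fun a => c' a k ^+ 2).
  apply: measurable_funX; apply: measurable_sum => b.
  by apply: measurable_funM; [exact: measurable_cst|exact: measurable_sinc_shift].
rewrite ge0_integralZl_EFin//; last 3 first.
- by move=> a _; rewrite lee_fin sumr_ge0// => k _; exact: sqr_ge0.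
- by apply/measurable_EFinP; exact: measurable_sum.
- by rewrite invr_ge0 exprn_ge0 ?ltW.
rewrite exprSr invfM -mulrA EFinM lee_wpmul2l ?lee_fin ?invr_ge0 ?exprn_ge0 ?(ltW N0)//.
under eq_integral do rewrite -sumEFin.
rewrite ge0_integral_sum//; last 2 first.
- by move=> k; apply/measurable_EFinP; exact: mc'.
- by move=> k a _; rewrite lee_fin sqr_ge0.
rewrite big_tuple_cons exchange_big/= mulr_sumr -sumEFin; apply: lee_sum => k _.
exact: integral_sinc_bessel1.
Qed.

End IntegralRd.

(** * Schur tests *)

Section Schur.
Context {R : realType} d (T : measurableType d).

Section schur_pointwise.
Variable mu : {measure set T -> \bar R}.
Variables (P Phi f : T -> R).
Hypotheses (mP : measurable_fun setT P) (mPhi : measurable_fun setT Phi)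
  (mf : measurable_fun setT f).
Hypothesis PhiP : forall x, `|Phi x| <= P x.

Let P0 x : 0 <= P x. Proof. exact: le_trans (PhiP x). Qed.

Let mPf : measurable_fun setT (fun x => P x * f x ^+ 2).
Proof. by apply: measurable_funM => //; exact: measurable_funX. Qed.

(** lam stays free for two uses: lam = 1 gives integrability, and the optimal lam gives
    Cauchy-Schwarz for the measure of density P. *)
Let schur_amgm (A b lam : R) : 0 < lam -> (\int[mu]_x (P x)%:E <= A%:E)%E ->
  (\int[mu]_x (P x * f x ^+ 2)%:E <= b%:E)%E ->
  (\int[mu]_x `|Phi x * f x|%:E <= ((lam * A + lam^-1 * b) / 2)%:E)%E.
Proof.
move=> l0 hA hb.
have li0 : 0 <= lam^-1 by rewrite invr_ge0 ltW.
apply: (@le_trans _ _ (\int[mu]_x ((lam / 2)%:E * (P x)%:E + (lam^-1 / 2)%:E * (P x * f x ^+ 2)%:E))%E).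
  apply: ge0_le_integral => //.
  - by apply/measurable_EFinP; apply: measurableT_comp => //; exact: measurable_funM.
  - under eq_fun do rewrite -!EFinM -EFinD.
    apply/measurable_EFinP; apply: measurable_funD.
      by apply: measurable_funM => //; exact: measurable_cst.
    by apply: measurable_funM => //; exact: measurable_cst.
  move=> x _; rewrite -!EFinM -EFinD lee_fin normrM.
  apply: (@le_trans _ _ (P x * `|f x|)); first by rewrite ler_wpM2r.
  rewrite -(real_normK (num_real (f x))); move: (P0 x) (normr_ge0 (f x)).
  move: (P x) `|f x| => p v p0 v0.
  rewrite (_ : _ + _ = p * ((lam + lam^-1 * v ^+ 2) / 2)); last by ring.
  rewrite ler_wpM2l// ler_pdivlMr//.
  have : 0 <= lam^-1 * (lam - v) ^+ 2 by rewrite mulr_ge0 ?sqr_ge0.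
  rewrite (_ : lam^-1 * (lam - v) ^+ 2 = lam + lam^-1 * v ^+ 2 - v * 2) ?subr_ge0//.
  by field; rewrite gt_eqF.
rewrite ge0_integralD//; last 4 first.
- by move=> x _; rewrite -EFinM lee_fin mulr_ge0// divr_ge0// ltW.
- by apply: emeasurable_funM; [exact: measurable_cst|exact/measurable_EFinP].
- by move=> x _; rewrite -EFinM lee_fin mulr_ge0 ?divr_ge0// mulr_ge0// sqr_ge0.
- by apply: emeasurable_funM; [exact: measurable_cst|exact/measurable_EFinP].
rewrite !ge0_integralZl_EFin//; first last.
- by rewrite divr_ge0// ltW.
- exact/measurable_EFinP.
- by move=> x _; rewrite lee_fin.
- by rewrite divr_ge0.
- exact/measurable_EFinP.
- by move=> x _; rewrite lee_fin mulr_ge0 ?sqr_ge0.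
rewrite (_ : (lam * A + lam^-1 * b) / 2 = (lam / 2) * A + (lam^-1 / 2) * b); last by ring.
by rewrite EFinD !EFinM leeD// lee_wpmul2l// lee_fin divr_ge0// ltW.
Qed.

Lemma schur_integrable (A : R) : (\int[mu]_x (P x)%:E <= A%:E)%E ->
  (\int[mu]_x (P x * f x ^+ 2)%:E < +oo)%E ->
  mu.-integrable setT (EFin \o (fun x => Phi x * f x)).
Proof.
move=> hA hb; apply/integrableP; split.
  by apply/measurable_EFinP; exact: measurable_funM.
have bE : (\int[mu]_x (P x * f x ^+ 2)%:E <= (fine (\int[mu]_x (P x * f x ^+ 2)%:E))%:E)%E.
  rewrite fineK// ge0_fin_numE//.
  by apply: integral_ge0 => x _; rewrite lee_fin mulr_ge0 ?sqr_ge0.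
apply: (@le_lt_trans _ _ (\int[mu]_x `|Phi x * f x|%:E)%E) => //.
exact: le_lt_trans (schur_amgm ltr01 hA bE) (ltry _).
Qed.

Lemma schur_pointwise (A : R) : 0 < A -> (\int[mu]_x (P x)%:E <= A%:E)%E ->
  (((\int[mu]_x (Phi x * f x))%R ^+ 2)%:E <= A%:E * \int[mu]_x (P x * f x ^+ 2)%:E)%E.
Proof.
move=> A0 hA.
have B0 : (0 <= \int[mu]_x (P x * f x ^+ 2)%:E)%E.
  by apply: integral_ge0 => x _; rewrite lee_fin mulr_ge0 ?sqr_ge0.
have [hb|] := ltP (\int[mu]_x (P x * f x ^+ 2)%:E)%E +oo%E; last first.
  by rewrite leye_eq => /eqP ->; rewrite gt0_muley ?lte_fin// leey.
have intPhi := schur_integrable hA hb.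
set b := (\int[mu]_x _)%E in B0 hb *.
have bE : b = (fine b)%:E by rewrite fineK// ge0_fin_numE.
set v := (\int[mu]_x (Phi x * f x)); rewrite -(real_normK (num_real v)).
rewrite bE -EFinM lee_fin.
have hv lam : 0 < lam -> `|v| <= (lam * A + lam^-1 * fine b) / 2.
  move=> l0; have hb' : (b <= (fine b)%:E)%E by rewrite -bE.
  have := schur_amgm l0 hA hb'; rewrite -lee_fin; apply: le_trans.
  rewrite EFin_normr_Rintegral//.
  by apply: le_abse_integral => //; exact: measurable_int intPhi.
have [->|v0] := eqVneq v 0.
  by rewrite normr0 expr0n/= mulr_ge0 ?(ltW A0)// fine_ge0.
have nv : 0 < `|v| by rewrite normr_gt0.
(* lam = |v| / A yields |v| <= (|v| + A b / |v|) / 2, hence v^2 <= A b. The case v = 0 was set aside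
   because lam must be positive. *)
have := hv _ (divr_gt0 nv A0).
rewrite divfK ?gt_eqF// invf_div ler_pdivlMr// mulr_natr mulr2n lerD2l.
by rewrite mulrAC ler_pdivlMr// -expr2.
Qed.

End schur_pointwise.

(** Reduction to Tonelli's measurability for nonnegative functions through positive and negative
    parts; [fine] gives their difference a real value in every case. *)
Lemma measurable_Rintegral_param d' (X : measurableType d')
    (mu : {sigma_finite_measure set T -> \bar R}) (F : X -> T -> R) :
  measurable_fun setT (fun p : X * T => F p.1 p.2) ->
  measurable_fun setT (fun x => \int[mu]_y F x y).
Proof.
move=> mF.
have mE : measurable_fun setT (fun p : X * T => (F p.1 p.2)%:E) by exact/measurable_EFinP.
rewrite /Rintegral.
have -> : (fun x => fine (\int[mu]_y (F x y)%:E)) =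
   fine \o (fun x => \int[mu]_y ((fun p : X * T => (F p.1 p.2)%:E)^\+ (x, y)) -
    \int[mu]_y ((fun p : X * T => (F p.1 p.2)%:E)^\- (x, y)))%E.
  apply/funext => x /=; rewrite [in LHS]integralE; congr (fine (_ - _)%E).
    by apply: eq_integral => y _; rewrite !funeposE.
  by apply: eq_integral => y _; rewrite !funenegE.
apply: measurableT_comp => //.
apply: emeasurable_funB.
  by apply: measurable_fun_fubini_tonelli_F => //; exact: measurable_funepos.
by apply: measurable_fun_fubini_tonelli_F => //; exact: measurable_funeneg.
Qed.

Section schur_operator.
Variable mu : {sigma_finite_measure set T -> \bar R}.
Variable f : T -> R.
Hypothesis mf : measurable_fun setT f.

Lemma schur_operator (P Phi : T -> T -> R) (A B : R) : 0 < A -> 0 <= B ->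
  measurable_fun setT (fun p : T * T => P p.1 p.2) ->
  measurable_fun setT (fun p : T * T => Phi p.1 p.2) ->
  (forall x y, `|Phi x y| <= P x y) ->
  (forall x, \int[mu]_y (P x y)%:E <= A%:E)%E ->
  (forall y, \int[mu]_x (P x y)%:E <= B%:E)%E ->
  (\int[mu]_x ((\int[mu]_y (Phi x y * f y))%R ^+ 2)%:E <=
   (A * B)%:E * \int[mu]_y (f y ^+ 2)%:E)%E.
Proof.
move=> A0 B0 mP mPhi PhiP hA hB.
have P0 x y : 0 <= P x y by exact: le_trans (PhiP x y).
have mfp : measurable_fun setT (fun p : T * T => f p.2).
  by apply: measurableT_comp => //; exact: measurable_snd.
have mPx x : measurable_fun setT (P x).
  exact: (measurableT_comp mP (measurable_pair1 x)).
have mPhix x : measurable_fun setT (Phi x).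
  exact: (measurableT_comp mPhi (measurable_pair1 x)).
have mPy y : measurable_fun setT (P ^~ y).
  exact: (measurableT_comp mP (measurable_pair2 y)).
have mPf : measurable_fun setT (fun p : T * T => (P p.1 p.2 * f p.2 ^+ 2)%:E).
  by apply/measurable_EFinP; apply: measurable_funM => //; exact: measurable_funX.
have Pf0 p : (0 <= (P p.1 p.2 * f p.2 ^+ 2)%:E)%E.
  by rewrite lee_fin mulr_ge0 ?sqr_ge0.
apply: (@le_trans _ _ (\int[mu]_x (A%:E * \int[mu]_y (P x y * f y ^+ 2)%:E))%E).
  apply: ge0_le_integral => //.
  - by move=> x _; rewrite lee_fin sqr_ge0.
  - apply/measurable_EFinP; apply: measurable_funX.
    apply: (@measurable_Rintegral_param _ _ mu (fun x y => Phi x y * f y)).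
    exact: measurable_funM.
  - apply: emeasurable_funM; first exact: measurable_cst.
    exact: (measurable_fun_fubini_tonelli_F (fun p : T * T => (P p.1 p.2 * f p.2 ^+ 2)%:E)).
  by move=> x _; apply: schur_pointwise.
rewrite ge0_integralZl_EFin ?(ltW A0)//; last 2 first.
- by move=> x _; apply: integral_ge0 => y _; exact: (Pf0 (x, y)).
- exact: (measurable_fun_fubini_tonelli_F (fun p : T * T => (P p.1 p.2 * f p.2 ^+ 2)%:E)).
rewrite EFinM -muleA lee_wpmul2l ?lee_fin ?(ltW A0)//.
rewrite (fubini_tonelli (fun p : T * T => (P p.1 p.2 * f p.2 ^+ 2)%:E))//=.
rewrite -ge0_integralZl_EFin//; last 2 first.
- by move=> y _; rewrite lee_fin sqr_ge0.
- by apply/measurable_EFinP; exact: measurable_funX.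
apply: ge0_le_integral => //.
- by move=> y _; apply: integral_ge0 => x _; exact: (Pf0 (x, y)).
- exact: (measurable_fun_fubini_tonelli_G (fun p : T * T => (P p.1 p.2 * f p.2 ^+ 2)%:E)).
- apply: emeasurable_funM; first exact: measurable_cst.
  by apply/measurable_EFinP; exact: measurable_funX.
move=> y _.
under eq_integral do rewrite mulrC EFinM.
rewrite ge0_integralZl_EFin ?sqr_ge0//; last 2 first.
- by move=> x _; rewrite lee_fin.
- exact/measurable_EFinP.
by rewrite muleC lee_wpmul2r ?lee_fin ?sqr_ge0.
Qed.

(** The Schur test with the integral in x replaced by a sum over sample points: B is now a lattice
    sum and carries the sampling density. *)
Lemma schur_sampled (I : finType) (p : I -> T) (P Phi : T -> T -> R) (A B : R) : 0 < A -> 0 <= B ->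
  (forall x, measurable_fun setT (P x)) -> (forall x, measurable_fun setT (Phi x)) ->
  (forall x y, `|Phi x y| <= P x y) ->
  (forall x, \int[mu]_y (P x y)%:E <= A%:E)%E ->
  (forall y, \sum_i P (p i) y <= B) ->
  ((\sum_i (\int[mu]_y (Phi (p i) y * f y)) ^+ 2)%R%:E <=
   (A * B)%:E * \int[mu]_y (f y ^+ 2)%:E)%E.
Proof.
move=> A0 B0 mP mPhi PhiP hA hB.
have P0 x y : 0 <= P x y by exact: le_trans (PhiP x y).
rewrite -sumEFin.
apply: (@le_trans _ _ (\sum_i (A%:E * \int[mu]_y (P (p i) y * f y ^+ 2)%:E))%E).
  by apply: lee_sum => i _; exact: schur_pointwise.
rewrite -ge0_sume_distrr; last first.
  by move=> i _; apply: integral_ge0 => y _; rewrite lee_fin mulr_ge0 ?sqr_ge0.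
rewrite EFinM -muleA lee_wpmul2l ?lee_fin ?(ltW A0)//.
rewrite -ge0_integral_sum//; last 2 first.
- by move=> i; apply/measurable_EFinP; apply: measurable_funM => //; exact: measurable_funX.
- by move=> i y _; rewrite lee_fin mulr_ge0 ?sqr_ge0.
rewrite -ge0_integralZl_EFin//; last 2 first.
- by move=> y _; rewrite lee_fin sqr_ge0.
- by apply/measurable_EFinP; exact: measurable_funX.
apply: ge0_le_integral => //.
- by move=> y _; apply: sume_ge0 => i _; rewrite lee_fin mulr_ge0 ?sqr_ge0.
- apply: emeasurable_sum => i.
  by apply/measurable_EFinP; apply: measurable_funM => //; exact: measurable_funX.
- apply: emeasurable_funM; first exact: measurable_cst.
  by apply/measurable_EFinP; exact: measurable_funX.
move=> y _; rewrite sumEFin -EFinM lee_fin -mulr_suml.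
by rewrite ler_wpM2r ?sqr_ge0.
Qed.

End schur_operator.

End Schur.

(** * Products of one-dimensional kernels *)

Section Products.
Context {R : realType}.

Lemma prod_sum_tuple (T : finType) n (phi : 'I_n -> T -> R) :
  \sum_(k : n.-tuple T) \prod_j phi j (tnth k j) = \prod_j \sum_b phi j b.
Proof.
elim: n phi => [|n IH] phi.
  rewrite (big_pred1 [tuple]) => [|k]; first by rewrite !big_ord0.
  by apply/esym/eqP/val_inj; case: k => -[].
rewrite big_tuple_cons big_ord_recl -(IH (fun j => phi (lift ord0 j))) mulr_suml.
apply: eq_bigr => a _; rewrite mulr_sumr; apply: eq_bigr => k _.
by rewrite big_ord_recl; congr (_ * _); apply: eq_bigr => j _; rewrite tnthS.
Qed.

(** Telescoping: exchanging one factor at a time leaves n terms, each with one small factor e kap_j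
    and the others at most A kap_j. A >= 1 rounds the power n - 1 up to n. *)
Lemma prod_sub_bound n (a b kap : 'I_n -> R) (A e : R) : 1 <= A -> 0 <= e ->
  (forall j, 0 <= kap j) -> (forall j, `|a j| <= A * kap j) -> (forall j, `|b j| <= A * kap j) ->
  (forall j, `|a j - b j| <= e * kap j) ->
  `|\prod_j a j - \prod_j b j| <= n%:R * e * A ^+ n * \prod_j kap j.
Proof.
move=> A1 e0; have A0 : 0 <= A by exact: le_trans A1.
elim: n a b kap => [|n IH] a b kap k0 ha hb hab.
  by rewrite !big_ord0 subrr normr0 !mul0r.
rewrite !big_ord_recl; set a' := \prod_(i < n) a _; set b' := \prod_(i < n) b _.
set k' := \prod_(i < n) kap _.
have k'0 : 0 <= k' by exact: prodr_ge0.
have h1 : `|a'| <= A ^+ n * k'.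
  rewrite /a' normr_prod /k' -[X in A ^+ X]card_ord -prodr_const -big_split/=.
  by apply: ler_prod => i _; rewrite normr_ge0 ha.
have h2 : `|a' - b'| <= n%:R * e * A ^+ n * k' by exact: IH.
rewrite (_ : a ord0 * a' - b ord0 * b' = (a ord0 - b ord0) * a' + b ord0 * (a' - b')); last by ring.
apply: (le_trans (ler_normD _ _)); rewrite !normrM.
apply: (@le_trans _ _ (e * kap ord0 * (A ^+ n * k') + A * kap ord0 * (n%:R * e * A ^+ n * k'))).
  by apply: lerD; apply: ler_pM.
rewrite (_ : _ + _ = (1 + n%:R * A) * (e * A ^+ n * (kap ord0 * k'))); last by ring.
rewrite (_ : n.+1%:R * e * A ^+ n.+1 * (kap ord0 * k') =
  ((1 + n%:R) * A) * (e * A ^+ n * (kap ord0 * k'))); last by rewrite exprS -natr1; ring.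
rewrite ler_wpM2r ?mulr_ge0 ?exprn_ge0//.
by rewrite mulrDl lerD2r mul1r.
Qed.

Lemma Rintegral_sum d (T : measurableType d) (mu : {measure set T -> \bar R})
    (I : Type) (s : seq I) (F : I -> T -> R) :
  (forall i, mu.-integrable setT (EFin \o F i)) ->
  \int[mu]_x (\sum_(i <- s) F i x) = \sum_(i <- s) \int[mu]_x F i x.
Proof.
move=> iF; elim: s => [|i s IH].
  under eq_Rintegral do rewrite big_nil.
  by rewrite big_nil Rintegral_cst// mul0r.
under eq_Rintegral do rewrite big_cons.
rewrite big_cons RintegralD//; first by rewrite IH.
rewrite (_ : _ \o _ = fun x => (\sum_(j <- s) (F j x)%:E)%E).
  by apply: (integrable_sum measurableT) => j _; exact: iF.
by apply/funext => x; rewrite /= sumEFin.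
Qed.

End Products.

Section HeatKernelRd.
Context {R : realType}.
Implicit Types (T N : R).

Lemma heat_kernelE d T (z : Rd R d) : 0 < T ->
  heat_kernel T z = \prod_j heat1 T (tnth z j).
Proof.
move=> T0; rewrite /heat_kernel /heat1 big_split/= prodr_const card_ord.
have p0 : 0 <= 4 * pi * T by rewrite !mulr_ge0 ?pi_ge0 ?(ltW T0).
congr (_ * _).
  rewrite powRN exprVn; congr (_^-1).
  by rewrite [d%:R / 2]mulrC powRrM powR12_sqrt// powR_mulrn ?sqrtr_ge0.
rewrite -expR_sum sumrN -mulr_suml; congr expR; congr (- (_ / _)).
by rewrite /enorm sqr_sqrtr// sumr_ge0// => i _; exact: sqr_ge0.
Qed.

Lemma heat1_scale N T (z : R) : 0 < N -> 0 < T -> heat1 T z = N * heat1 (T * N ^+ 2) (N * z).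
Proof.
move=> N0 T0; rewrite /heat1 (_ : 4 * pi * (T * N ^+ 2) = 4 * pi * T * N ^+ 2); last by rewrite mulrA.
rewrite [Num.sqrt (_ * N ^+ 2)]sqrtrM ?mulr_ge0 ?pi_ge0 ?(ltW T0)// sqrtr_sqr ger0_norm ?(ltW N0)//.
rewrite [(_ * N)^-1]invfM (_ : (N * z) ^+ 2 / (4 * (T * N ^+ 2)) = z ^+ 2 / (4 * T)); last first.
  by field; rewrite !gt_eqF.
by move: (Num.sqrt _)^-1 (expR _) => s e; field; rewrite gt_eqF.
Qed.

(** [majorant] in the original coordinates: one width of order sqrt T from the heat kernel, one of
    1/N from the sampling scale. *)
Definition kap T N (z : R) : R := cauchy_kernel (2 * Num.sqrt T) z + cauchy_kernel N^-1 z.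

Lemma kap_ge0 T N z : 0 < T -> 0 < N -> 0 <= kap T N z.
Proof.
by move=> T0 N0; rewrite addr_ge0// cauchy_kernel_ge0 ?invr_gt0 ?mulr_gt0 ?sqrtr_gt0.
Qed.

Lemma kap_le T N z : 0 < T -> 0 < N -> kap T N z <= (2 * Num.sqrt T)^-1 + N.
Proof.
move=> T0 N0; rewrite lerD ?cauchy_kernel_le ?mulr_gt0 ?sqrtr_gt0//.
by rewrite -[leRHS]invrK cauchy_kernel_le ?invr_gt0.
Qed.

Lemma kapN T N z : kap T N (- z) = kap T N z.
Proof. by rewrite /kap !cauchy_kernelN. Qed.

Lemma continuous_kap T N : continuous (kap T N).
Proof. by move=> z; apply: cvgD; exact: continuous_cauchy_kernel. Qed.

Lemma sqrt_scale N T : 0 < N -> 0 < T -> Num.sqrt (T * N ^+ 2) = Num.sqrt T * N.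
Proof. by move=> N0 T0; rewrite sqrtrM ?(ltW T0)// sqrtr_sqr ger0_norm ?(ltW N0). Qed.

Lemma kap_scale T N z : 0 < T -> 0 < N -> kap T N z = N * majorant (T * N ^+ 2) (N * z).
Proof.
move=> T0 N0; rewrite /kap /majorant mulrDr sqrt_scale// mulrA.
rewrite (cauchy_kernel_scale (N := N))//; last by rewrite mulr_gt0 ?sqrtr_gt0.
congr (_ + _); rewrite (cauchy_kernel_scale (N := N)) ?invr_gt0//.
by rewrite mulVf ?gt_eqF.
Qed.

Lemma integral_kap T N x : 0 < T -> 0 < N ->
  (\int[lebesgue_measure]_y (kap T N (x - y))%:E <= (2 * pi)%:E)%E.
Proof.
move=> T0 N0; under eq_integral do rewrite /kap EFinD.
have m l : measurable_fun setT (fun y : R => cauchy_kernel l (x - y)).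
  apply: continuous_measurable_fun => y.
  apply: (@continuous_comp _ _ _ (fun y => x - y) (cauchy_kernel l)); last exact: continuous_cauchy_kernel.
  by apply: cvgB; [exact: cvg_cst|exact: cvg_id].
rewrite ge0_integralD//; last 4 first.
- by move=> y _; rewrite lee_fin cauchy_kernel_ge0// mulr_gt0 ?sqrtr_gt0.
- by apply/measurable_EFinP; exact: m.
- by move=> y _; rewrite lee_fin cauchy_kernel_ge0// invr_gt0.
- by apply/measurable_EFinP; exact: m.
rewrite (_ : 2 * pi = pi + pi); last by rewrite mulr_natl mulr2n.
by rewrite EFinD leeD// integral_cauchy_kernel ?invr_gt0 ?mulr_gt0 ?sqrtr_gt0.
Qed.

(** Scaling by N turns the nodes into integers. The scale 2 s then contributes 3 pi (1 + 1/(2 s))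
    and the scale 1 contributes 6 pi. *)
Lemma sum_kap T N M y : 0 < T -> 0 < N ->
  \sum_(k : 'I_M.*2.+1) kap T N (node k / N - y) <=
  N * (9 * pi * (1 + (Num.sqrt (T * N ^+ 2))^-1)).
Proof.
move=> T0 N0; set s := Num.sqrt _.
have s0 : 0 < s by rewrite sqrtr_gt0 mulr_gt0 ?exprn_gt0.
have -> : \sum_(k : 'I_M.*2.+1) kap T N (node k / N - y) =
    N * \sum_(k < M.*2.+1) (cauchy_kernel (2 * s) (k%:R + (- M%:R - N * y)) +
      cauchy_kernel 1 (k%:R + (- M%:R - N * y))).
  rewrite mulr_sumr; apply: eq_bigr => k _.
  rewrite kap_scale// /majorant -/s /node.
  rewrite (_ : N * ((k%:R - M%:R) / N - y) = k%:R + (- M%:R - N * y))//.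
  by field; rewrite gt_eqF.
rewrite ler_wpM2l ?(ltW N0)// big_split/=.
have s20 : 0 < 2 * s by rewrite mulr_gt0.
apply: (le_trans (lerD (cauchy_kernel_sum _ _ s20) (cauchy_kernel_sum _ _ ltr01))).
rewrite invr1 (_ : _ + _ = pi * (9 + 3 * (2 * s)^-1)); last by move: (pi : R) => p; ring.
rewrite (_ : 9 * pi * (1 + s^-1) = pi * (9 + 9 * s^-1)); last by move: (pi : R) => p; ring.
rewrite ler_wpM2l ?pi_ge0// lerD2l invfM mulrA ler_wpM2r ?invr_ge0 ?(ltW s0)//.
by rewrite ler_pdivrMr// -natrM ler_nat.
Qed.

Lemma heat1_le_kap T N z : 0 < T -> 0 < N -> heat1 T z <= kap T N z.
Proof.
move=> T0 N0; apply: (le_trans (heat1_le_cauchy z T0)).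
by rewrite lerDl cauchy_kernel_ge0// invr_gt0.
Qed.

Lemma norm_heat1_le_kap T N z : 0 < T -> 0 < N ->
  `|z| * heat1 T z <= 4 * Num.sqrt T * kap T N z.
Proof.
move=> T0 N0; apply: (le_trans (norm_heat1_le_cauchy z T0)).
rewrite ler_wpM2l ?mulr_ge0 ?sqrtr_ge0//.
by rewrite lerDl cauchy_kernel_ge0// invr_gt0.
Qed.

End HeatKernelRd.

Section ProductKernel.
Context {R : realType} (d : nat).
Implicit Types (x y : Rd R d).

Definition prod_kernel (k : R -> R) x y : R := \prod_(j < d) k (tnth x j - tnth y j).

Lemma measurable_prod_kernel (k : R -> R) : measurable_fun setT k ->
  measurable_fun setT (fun p : Rd R d * Rd R d => prod_kernel k p.1 p.2).
Proof.
move=> mk; apply: measurable_prod => j _; apply: measurableT_comp => //.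
apply: measurable_funB.
  by apply: measurableT_comp (@measurable_tnth _ _ _ _) _; exact: measurable_fst.
by apply: measurableT_comp (@measurable_tnth _ _ _ _) _; exact: measurable_snd.
Qed.

Lemma measurable_prod_kernelr (k : R -> R) x : measurable_fun setT k ->
  measurable_fun setT (prod_kernel k x).
Proof. by move=> mk; exact: (measurableT_comp (measurable_prod_kernel mk) (measurable_pair1 x)). Qed.

Variables (T N : R).
Hypotheses (T0 : 0 < T) (N0 : 0 < N).

Let k0 z := kap_ge0 z T0 N0.
Let mkap := continuous_measurable_fun (@continuous_kap R T N).

Lemma prod_kap_ge0 x y : 0 <= prod_kernel (kap T N) x y.
Proof. by apply: prodr_ge0 => j _; exact: k0. Qed.

Lemma prod_kap_le x y : prod_kernel (kap T N) x y <= ((2 * Num.sqrt T)^-1 + N) ^+ d.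
Proof.
rewrite -[X in _ ^+ X]card_ord -prodr_const; apply: ler_prod => j _.
by rewrite k0 kap_le.
Qed.

Lemma integral_prod_kap x :
  (\int[lebesgue_measureRd d]_y (prod_kernel (kap T N) x y)%:E <= ((2 * pi) ^+ d)%:E)%E.
Proof.
apply: (integral_prod_le (phi := fun j z => kap T N (tnth x j - z))).
- by rewrite mulr_ge0 ?pi_ge0.
- by move=> j; apply: measurableT_comp => //; exact: measurable_funB.
- by move=> j z; exact: k0.
- by move=> j; exact: integral_kap.
Qed.

Lemma integral_prod_kapl y :
  (\int[lebesgue_measureRd d]_x (prod_kernel (kap T N) x y)%:E <= ((2 * pi) ^+ d)%:E)%E.
Proof.
have := integral_prod_kap y; apply: le_trans.
rewrite le_eqVlt; apply/orP; left; apply/eqP; apply: eq_integral => x _.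
by congr (_%:E); apply: eq_bigr => j _; rewrite -kapN opprB.
Qed.

Definition lattice M (k : d.-tuple 'I_M.*2.+1) : Rd R d :=
  [tuple node (tnth k i) / N | i < d].

Lemma sum_prod_kap M y :
  \sum_k prod_kernel (kap T N) (@lattice M k) y <=
  (N * (9 * pi * (1 + (Num.sqrt (T * N ^+ 2))^-1))) ^+ d.
Proof.
rewrite (_ : \sum_k _ = \sum_(k : d.-tuple 'I_M.*2.+1) \prod_j kap T N (node (tnth k j) / N - tnth y j)); last first.
  by apply: eq_bigr => k _; apply: eq_bigr => j _; rewrite tnth_mktuple.
rewrite (prod_sum_tuple (fun j b => kap T N (node b / N - tnth y j))).
rewrite -[X in _ ^+ X]card_ord -prodr_const; apply: ler_prod => j _.
rewrite sum_kap// andbT; apply: sumr_ge0 => b _; exact: k0.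
Qed.

Section fixed_datum.
Variable f : Rd R d -> R.
Hypothesis mf : measurable_fun setT f.
Hypothesis f2 : (\int[lebesgue_measureRd d]_y (f y ^+ 2)%:E < +oo)%E.

Variable Phi : Rd R d -> Rd R d -> R.
Variable c : R.
Hypothesis c_gt0 : 0 < c.
Let c0 : 0 <= c. Proof. exact: ltW. Qed.
Hypothesis mPhi : measurable_fun setT (fun p : Rd R d * Rd R d => Phi p.1 p.2).
Hypothesis PhiP : forall x y, `|Phi x y| <= c * prod_kernel (kap T N) x y.

Let P x y : R := c * prod_kernel (kap T N) x y.

Let mP : measurable_fun setT (fun p : Rd R d * Rd R d => P p.1 p.2).
Proof. by apply: measurable_funM => //; exact: measurable_prod_kernel. Qed.

Let mPx x : measurable_fun setT (P x).
Proof. exact: (measurableT_comp mP (measurable_pair1 x)). Qed.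

Let mPhix x : measurable_fun setT (Phi x).
Proof. exact: (measurableT_comp mPhi (measurable_pair1 x)). Qed.

Let pi2 : 0 < (2 * pi) ^+ d :> R. Proof. by rewrite exprn_gt0// mulr_gt0 ?pi_gt0. Qed.

Let intP x : (\int[lebesgue_measureRd d]_y (P x y)%:E <= (c * (2 * pi) ^+ d)%:E)%E.
Proof.
under eq_integral do rewrite EFinM.
rewrite ge0_integralZl_EFin//; last 2 first.
- by move=> y _; rewrite lee_fin prod_kap_ge0.
- by apply/measurable_EFinP; exact: measurable_prod_kernelr.
by rewrite EFinM lee_wpmul2l// integral_prod_kap.
Qed.

(** The Schur weight is bounded, so P f^2 is integrable for every x and not just almost every x;
    point values on the lattice are therefore genuine integrals. *)
Lemma kernel_integrable x :
  (lebesgue_measureRd d).-integrable setT (EFin \o (fun y => Phi x y * f y)).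
Proof.
apply: (schur_integrable (mPx x) (mPhix x) mf (PhiP x) (intP x)).
apply: (@le_lt_trans _ _ (\int[lebesgue_measureRd d]_y
   ((c * ((2 * Num.sqrt T)^-1 + N) ^+ d)%:E * (f y ^+ 2)%:E))%E).
  apply: ge0_le_integral => //.
  - by move=> y _; rewrite lee_fin mulr_ge0 ?sqr_ge0// mulr_ge0// prod_kap_ge0.
  - by apply/measurable_EFinP; apply: measurable_funM => //; exact: measurable_funX.
  - apply: emeasurable_funM; first exact: measurable_cst.
    by apply/measurable_EFinP; exact: measurable_funX.
  move=> y _; rewrite -EFinM lee_fin ler_wpM2r ?sqr_ge0// ler_wpM2l//.
  exact: prod_kap_le.
have k1 : 0 <= ((2 * Num.sqrt T)^-1 + N) ^+ d.
  by rewrite exprn_ge0// addr_ge0 ?(ltW N0)// invr_ge0 mulr_ge0 ?sqrtr_ge0.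
rewrite ge0_integralZl_EFin ?mulr_ge0//.
- rewrite lte_mul_pinfty ?lee_fin ?mulr_ge0//.
- by move=> y _; rewrite lee_fin sqr_ge0.
- by apply/measurable_EFinP; exact: measurable_funX.
Qed.

Lemma kernel_operator :
  (\int[lebesgue_measureRd d]_x (((\int[lebesgue_measureRd d]_y (Phi x y * f y)) ^+ 2)%R)%:E <=
   ((c * (2 * pi) ^+ d) ^+ 2)%R%:E * \int[lebesgue_measureRd d]_y (f y ^+ 2)%:E)%E.
Proof.
apply: (schur_operator mf (mulr_gt0 c_gt0 pi2) (mulr_ge0 c0 (ltW pi2)) mP mPhi PhiP intP) => y.
under eq_integral do rewrite EFinM.
rewrite ge0_integralZl_EFin//; last 2 first.
- by move=> x _; rewrite lee_fin prod_kap_ge0.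
- apply/measurable_EFinP.
  exact: (measurableT_comp (measurable_prod_kernel mkap) (measurable_pair2 y)).
by rewrite EFinM lee_wpmul2l// integral_prod_kapl.
Qed.

Lemma kernel_sampled M :
  ((\sum_k (\int[lebesgue_measureRd d]_y (Phi (@lattice M k) y * f y)) ^+ 2)%R%:E <=
   (c ^+ 2 * (2 * pi) ^+ d * (N * (9 * pi * (1 + (Num.sqrt (T * N ^+ 2))^-1))) ^+ d)%R%:E *
   \int[lebesgue_measureRd d]_y (f y ^+ 2)%:E)%E.
Proof.
set B := (N * _) ^+ d.
have B0 : 0 <= B.
  by rewrite exprn_ge0// mulr_ge0 ?(ltW N0)// mulr_ge0 ?mulr_ge0 ?pi_ge0// addr_ge0// invr_ge0 sqrtr_ge0.
rewrite (_ : c ^+ 2 * (2 * pi) ^+ d * B = (c * (2 * pi) ^+ d) * (c * B)); last by ring.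
apply: (schur_sampled mf (mulr_gt0 c_gt0 pi2) (mulr_ge0 c0 B0) mPx mPhix PhiP intP) => y.
by rewrite -mulr_sumr ler_wpM2l// sum_prod_kap.
Qed.

End fixed_datum.

End ProductKernel.

Section FatouBound.
Context {R : realType} d (T : measurableType d) (mu : {measure set T -> \bar R}).

Lemma fatou_sq_bound (g : nat -> T -> R) (l : T -> R) (B : \bar R) :
  (forall n, measurable_fun setT (g n)) ->
  (forall x, g n x @[n --> \oo] --> l x) ->
  (forall n, \int[mu]_x (g n x ^+ 2)%:E <= B)%E ->
  (\int[mu]_x (l x ^+ 2)%:E <= B)%E.
Proof.
move=> mg gl gB.
have lE x : (l x ^+ 2)%:E = limn_einf (fun n => (g n x ^+ 2)%:E).
  have h : (g n x ^+ 2)%:E @[n --> \oo] --> (l x ^+ 2)%:E.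
    by apply: cvg_EFin; [exact: nearW|apply: cvgM; exact: gl].
  by have [-> _] := cvg_limn_einf_sup h.
under eq_integral do rewrite lE.
have mg2 n : measurable_fun setT (fun x => (g n x ^+ 2)%:E).
  by apply/measurable_EFinP; exact: measurable_funX.
apply: (le_trans (fatou mu measurableT mg2 _)); first by move=> n x _; rewrite lee_fin sqr_ge0.
rewrite limn_einf_lim; apply: lime_le; first exact: is_cvg_einfs.
by apply: nearW => n; apply: le_trans (gB n); apply: ereal_inf_lbound; exists n => /=.
Qed.

End FatouBound.

(** * The sampling remainder *)

Section SamplingRd.
Context {R : realType} (d : nat).
Variables (T N : R) (T0 : 0 < T) (N0 : 0 < N).
Variables (G : R -> R) (D : R).
Hypotheses (sG : samplable G) (cG : continuous G) (D0 : 0 <= D)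
  (GD : forall z, `|G z| <= D * cauchy_kernel 1 z).
Variable f : Rd R d -> R.
Hypothesis mf : measurable_fun setT f.
Hypothesis f2 : (\int[lebesgue_measureRd d]_y (f y ^+ 2)%:E < +oo)%E.
Local Notation mu := (lebesgue_measureRd d).

Definition scaled z : R := N * G (N * z).

Lemma continuous_scaled : continuous scaled.
Proof.
move=> z; apply: cvgM; first exact: cvg_cst.
apply: (@continuous_comp _ _ _ (fun z => N * z) G); last exact: cG.
by apply: cvgM; [exact: cvg_cst|exact: cvg_id].
Qed.

Lemma measurable_scaled : measurable_fun setT scaled.
Proof. by apply: continuous_measurable_fun; exact: continuous_scaled. Qed.

Lemma cauchy_kernel1_scale z : N * cauchy_kernel 1 (N * z) = cauchy_kernel N^-1 z.
Proof.
by rewrite (cauchy_kernel_scale (N := N) (l := N^-1))// ?invr_gt0// mulVf// gt_eqF.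
Qed.

Lemma scaled_le z : `|scaled z| <= D * kap T N z.
Proof.
rewrite /scaled normrM (gtr0_norm N0).
apply: (@le_trans _ _ (N * (D * cauchy_kernel 1 (N * z)))).
  by rewrite ler_wpM2l// ltW.
rewrite mulrCA ler_wpM2l// cauchy_kernel1_scale lerDr cauchy_kernel_ge0//.
by rewrite mulr_gt0 ?sqrtr_gt0.
Qed.

Let Gd := @prod_kernel R d scaled.

(** The summand 1 keeps the constant positive when D = 0, which happens for G = 0. *)
Lemma prod_scaled_le x y : `|Gd x y| <= (D ^+ d + 1) * prod_kernel (kap T N) x y.
Proof.
apply: (@le_trans _ _ (D ^+ d * prod_kernel (kap T N) x y)).
  rewrite /Gd /prod_kernel normr_prod -[X in _ ^+ X]card_ord -prodr_const -big_split/=.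
  by apply: ler_prod => j _; rewrite normr_ge0 scaled_le.
by rewrite ler_wpM2r ?prod_kap_ge0// lerDl.
Qed.

Let c0 : 0 < D ^+ d + 1. Proof. by rewrite ltr_wpDl// exprn_ge0. Qed.

Let intG x : mu.-integrable setT (EFin \o (fun y => Gd x y * f y)).
Proof.
apply: (kernel_integrable T0 N0 mf f2 c0 _ prod_scaled_le).
exact: measurable_prod_kernel measurable_scaled.
Qed.

Definition low_part (x : Rd R d) : R := \int[mu]_y (Gd x y * f y).

(** The truncated sampling series of the kernel itself. The finite sum commutes with the integral in
    y, and over a cube of nodes it factors by coordinates. *)
Let a (x : Rd R d) M (y : Rd R d) : R :=
  \prod_(j < d) \sum_b scaled (@node R M b / N - tnth y j) * sinc (N * tnth x j - node b).

Let sinc_combE x M : sinc_comb N (fun k : d.-tuple 'I_M.*2.+1 => low_part (lattice N k)) x =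
  \int[mu]_y (a x M y * f y).
Proof.
pose s (k : d.-tuple 'I_M.*2.+1) := \prod_(j < d) sinc (N * tnth x j - node (tnth k j)).
transitivity (\sum_k \int[mu]_y (s k * (Gd (lattice N k) y * f y))).
  by apply: eq_bigr => k _; rewrite RintegralZl// mulrC.
rewrite -Rintegral_sum; last first.
  move=> k; rewrite (_ : _ \o _ = fun y => (s k)%:E * (EFin \o (fun y => Gd (lattice N k) y * f y)%R) y)%E.
    by apply: integrableZl => //; exact: intG.
  by apply/funext => y; rewrite /= EFinM.
apply: eq_Rintegral => y _.
rewrite /a -(prod_sum_tuple (fun j b => scaled (@node R M b / N - tnth y j) * sinc (N * tnth x j - node b))).
rewrite mulr_suml; apply: eq_bigr => k _.
rewrite mulrA big_split/= mulrC [RHS]mulrC; congr (_ * _).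
rewrite mulrC; congr (_ * _).
by apply: eq_bigr => j _; rewrite tnth_mktuple.
Qed.

Let scaled_node M b z : scaled (@node R M b / N - z) = N * G (node b - N * z).
Proof. by rewrite /scaled; congr (_ * G _); field; rewrite gt_eqF. Qed.

Let a_cvg x y : a x M y @[M --> \oo] --> Gd x y.
Proof.
apply: cvg_big => [|j _]; first exact: mul_continuous.
rewrite (_ : scaled (tnth x j - tnth y j) = N * G (N * tnth x j - N * tnth y j)); last first.
  by rewrite /scaled mulrBr.
have := @sG (N * tnth x j) (N * tnth y j) => h.
under eq_fun do under eq_bigr do rewrite scaled_node -mulrA.
under eq_fun do rewrite -mulr_sumr.
by apply: cvgM; [exact: cvg_cst|exact: h].
Qed.

Let E : R := N * (288 * pi ^+ 2 * D ^+ 2).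
Let E0 : 0 <= E. Proof. by rewrite mulr_ge0 ?(ltW N0)// !mulr_ge0 ?exprn_ge0 ?pi_ge0. Qed.

Let Q (x : Rd R d) (y : Rd R d) : R := \prod_j (E * cauchy_kernel N^-1 (tnth x j - tnth y j)).

Let Ni0 : 0 < N^-1. Proof. by rewrite invr_gt0. Qed.

Let Q0 x y : 0 <= Q x y.
Proof. by apply: prodr_ge0 => j _; rewrite mulr_ge0// cauchy_kernel_ge0. Qed.

Let a_le x M y : a x M y ^+ 2 <= Q x y.
Proof.
rewrite /a /Q -prodrXl; apply: ler_prod => j _; rewrite sqr_ge0/=.
under eq_bigr do rewrite scaled_node -mulrA.
rewrite -mulr_sumr exprMn.
have := samplable_dominated D0 GD M (N * tnth x j) (N * tnth y j).
move=> /(ler_wpM2l (sqr_ge0 N)) /le_trans; apply.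
rewrite -mulrBr -cauchy_kernel1_scale /E le_eqVlt; apply/orP; left; apply/eqP.
by move: (pi : R) (cauchy_kernel _ _) => p q; ring.
Qed.

Let mphi (x : Rd R d) j : measurable_fun setT (fun z : R => E * cauchy_kernel N^-1 (tnth x j - z)).
Proof.
apply: continuous_measurable_fun => z; apply: cvgM; first exact: cvg_cst.
apply: (@continuous_comp _ _ _ (fun z => tnth x j - z) (cauchy_kernel N^-1)).
  by apply: cvgB; [exact: cvg_cst|exact: cvg_id].
exact: continuous_cauchy_kernel.
Qed.

Let mQ x : measurable_fun setT (Q x).
Proof. exact: (measurable_prod_tnth (mphi x)). Qed.

Let intQ x : mu.-integrable setT (EFin \o Q x).
Proof.
apply/integrableP; split; first exact/measurable_EFinP.
under eq_integral do rewrite gee0_abs ?lee_fin//.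
apply: le_lt_trans (ltry ((E * pi) ^+ d)).
apply: (integral_prod_le (phi := fun j z => E * cauchy_kernel N^-1 (tnth x j - z))).
- by rewrite mulr_ge0 ?pi_ge0.
- exact: mphi.
- by move=> j z; rewrite mulr_ge0// cauchy_kernel_ge0.
move=> j; under eq_integral do rewrite EFinM.
rewrite ge0_integralZl_EFin//; last 2 first.
- by move=> z _; rewrite lee_fin cauchy_kernel_ge0.
- apply/measurable_EFinP; apply: continuous_measurable_fun => z.
  apply: (@continuous_comp _ _ _ (fun z => tnth x j - z) (cauchy_kernel N^-1)).
    by apply: cvgB; [exact: cvg_cst|exact: cvg_id].
  exact: continuous_cauchy_kernel.
by rewrite (EFinM E) lee_wpmul2l// integral_cauchy_kernel.
Qed.

Let intf2 : mu.-integrable setT (EFin \o (fun y => f y ^+ 2)).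
Proof.
apply/integrableP; split; first by apply/measurable_EFinP; exact: measurable_funX.
by under eq_integral do rewrite gee0_abs ?lee_fin ?sqr_ge0//.
Qed.

(** Dominated convergence in y. [samplable_dominated] bounds squares only, hence the dominating
    function [Q] + f^2, through |a f| <= a^2 + f^2. *)
Lemma low_part_sampling x :
  sinc_comb N (fun k : d.-tuple 'I_M.*2.+1 => low_part (lattice N k)) x @[M --> \oo] -->
  low_part x.
Proof.
under eq_fun do rewrite sinc_combE.
apply: fine_cvg.
rewrite /low_part /Rintegral fineK; last by apply: integrable_fin_num => //; exact: intG.
apply: (@dominated_cvg _ _ _ mu _ _ (fun M y => (a x M y * f y)%:E) _
  (EFin \o (fun y => Q x y + f y ^+ 2))) => //=.
- move=> M; apply/measurable_EFinP; apply: measurable_funM => //.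
  apply: (@measurable_prod_tnth R d (fun j z => \sum_b scaled (@node R M b / N - z) * sinc (N * tnth x j - node b))) => j.
  apply: measurable_sum => b; apply: measurable_funM => //.
  apply: measurableT_comp; first exact: measurable_scaled.
  exact: measurable_funB.
- move=> y _; apply: cvg_EFin; first exact: nearW.
  by apply: cvgM; [exact: a_cvg|exact: cvg_cst].
- rewrite (_ : _ \o _ = fun y => ((EFin \o Q x) y + (EFin \o (fun y => f y ^+ 2)%R) y)%E).
    exact: integrableD.
  by apply/funext => y; rewrite /= EFinD.
- move=> M y _; rewrite lee_fin normrM.
  apply: (@le_trans _ _ (a x M y ^+ 2 + f y ^+ 2)); last by rewrite lerD2r.
  rewrite -(real_normK (num_real (a x M y))) -(real_normK (num_real (f y))).
  move: (normr_ge0 (a x M y)) (normr_ge0 (f y)); move: `|a x M y| `|f y| => p q p0 q0.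
  have : 0 <= (p - q) ^+ 2 by exact: sqr_ge0.
  have : 0 <= p * q by exact: mulr_ge0.
  nra.
Qed.

End SamplingRd.

Section EuclideanNorm.
Context {R : realType} (d : nat).
Implicit Types (x y : Rd R d).

Lemma enorm_ge0 x : 0 <= enorm x.
Proof. exact: sqrtr_ge0. Qed.

Lemma enorm_sq x : enorm x ^+ 2 = \sum_j (tnth x j : R) ^+ 2.
Proof. by rewrite sqr_sqrtr// sumr_ge0// => j _; exact: sqr_ge0. Qed.

Lemma tnth_le_enorm x j : `|tnth x j| <= enorm x.
Proof.
rewrite -ler_sqr ?nnegrE ?enorm_ge0// enorm_sq real_normK ?num_real//.
by rewrite (bigD1 j)//= lerDl sumr_ge0// => i _; exact: sqr_ge0.
Qed.

(** The difference enters by its coordinates so that each |x_j - y_j| meets its own factor of a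
    product kernel. *)
Lemma enorm_le x y : enorm x <= \sum_j `|tnth x j - tnth y j| + enorm y.
Proof.
have s0 : 0 <= \sum_j `|tnth x j - tnth y j| by exact: sumr_ge0.
rewrite -ler_sqr ?nnegrE ?addr_ge0 ?enorm_ge0//.
rewrite sqrrD !enorm_sq.
pose a j : R := tnth x j - tnth y j.
have -> : \sum_j (tnth x j : R) ^+ 2 =
    \sum_j a j ^+ 2 + \sum_j (a j * tnth y j) *+ 2 + \sum_j (tnth y j : R) ^+ 2.
  rewrite -!big_split/=; apply: eq_bigr => j _; rewrite /a; ring.
rewrite lerD2r lerD//.
  rewrite expr2 mulr_suml; apply: ler_sum => j _.
  rewrite -real_normK ?num_real// expr2 ler_wpM2l//.
  by rewrite (bigD1 j)//= lerDl sumr_ge0.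
rewrite sumrMnl lerMn2r/= mulr_suml; apply: ler_sum => j _.
apply: (le_trans (ler_norm _)); rewrite normrM ler_wpM2l//.
exact: tnth_le_enorm.
Qed.

Lemma measurable_enorm : measurable_fun setT (@enorm R d).
Proof.
apply: (@measurableT_comp _ _ _ _ _ _ (@Num.sqrt R)).
  by apply: continuous_measurable_fun; exact: sqrt_continuous.
apply: measurable_sum => j; apply: measurable_funX; exact: measurable_tnth.
Qed.

Variables (T N : R).
Hypotheses (T0 : 0 < T) (N0 : 0 < N).

Lemma prod_heat1_le x y : `|prod_kernel (heat1 T) x y| <= prod_kernel (kap T N) x y.
Proof.
rewrite /prod_kernel normr_prod; apply: ler_prod => j _.
by rewrite normr_ge0 ger0_norm ?heat1_ge0// heat1_le_kap.
Qed.

(** The weight passes from x to the datum variable y; each of the d coordinate differences is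
    absorbed by its own Gaussian factor at the price 4 sqrt T. *)
Lemma enorm_prod_heat1_le x y : enorm x * `|prod_kernel (heat1 T) x y| <=
  (4 * d%:R * Num.sqrt T + enorm y) * prod_kernel (kap T N) x y.
Proof.
have P0 : 0 <= prod_kernel (kap T N) x y by exact: prod_kap_ge0.
apply: (@le_trans _ _ ((\sum_j `|tnth x j - tnth y j| + enorm y) * `|prod_kernel (heat1 T) x y|)).
  by rewrite ler_wpM2r// enorm_le.
rewrite [leLHS]mulrDl [leRHS]mulrDl lerD//; last by rewrite ler_wpM2l ?enorm_ge0// prod_heat1_le.
rewrite mulr_suml (_ : _ * d%:R * _ * _ = \sum_(j < d) (4 * Num.sqrt T * prod_kernel (kap T N) x y)); last first.
  by rewrite sumr_const card_ord -[_ *+ d]mulr_natr; ring.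
apply: ler_sum => j _.
rewrite /prod_kernel normr_prod (bigD1 j)//= [X in _ <= _ * X](bigD1 j)//=.
rewrite !mulrA; apply: ler_pM => //.
- by apply: prodr_ge0.
- by rewrite (ger0_norm (heat1_ge0 _ _)) norm_heat1_le_kap.
by apply: ler_prod => i _; rewrite normr_ge0 ger0_norm ?heat1_ge0// heat1_le_kap.
Qed.

End EuclideanNorm.

Section BallSum.
Context {R : realType} (d : nat).
Implicit Types (N r : R).

Definition shift_index M (k : d.-tuple 'I_M.*2.+1) : d.-tuple int :=
  [tuple (tnth k i)%:Z - M%:Z | i < d].

Lemma shift_index_inj M : injective (@shift_index M).
Proof.
move=> k l kl; apply: eq_from_tnth => i; apply: val_inj => /=.
have := congr1 (fun t => tnth t i) kl; rewrite !tnth_mktuple => /addIr h.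
by case: h.
Qed.

Lemma lattice_pointE N M (k : d.-tuple 'I_M.*2.+1) :
  lattice_point N (shift_index k) = lattice N k.
Proof.
apply: eq_from_tnth => i; rewrite !tnth_mktuple /node; congr (_ / _).
by rewrite intrD intrN -!pmulrn.
Qed.

Lemma sampling_funE N M (k : d.-tuple 'I_M.*2.+1) (x : Rd R d) :
  sampling_fun N (shift_index k) x = \prod_(j < d) sinc (N * tnth x j - node (tnth k j)).
Proof.
apply: eq_bigr => j _; rewrite tnth_mktuple /node.
by rewrite intrD intrN -!pmulrn.
Qed.

(** Once M exceeds r N, the cube of indices contains the ball. One threshold serves all v and x. *)
Lemma ball_sum N r : 0 < N -> exists M0 : nat, forall M, (M0 <= M)%N ->
  forall (v : Rd R d -> R) (x : Rd R d),
  \sum_(n \in lattice_ball N r) v (lattice_point N n) * sampling_fun N n x =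
  sinc_comb N (fun k : d.-tuple 'I_M.*2.+1 =>
    if enorm (lattice N k) < r then v (lattice N k) else 0) x.
Proof.
move=> N0; exists (Num.truncn (r * N)).+1 => M hM v x.
pose s := [seq @shift_index M k | k <- enum {: d.-tuple 'I_M.*2.+1}].
have us : uniq s by rewrite map_inj_uniq ?enum_uniq//; exact: shift_index_inj.
have -> : @lattice_ball R d N r = [set` mem (@lattice_ball R d N r)].
  by apply/seteqP; split => n /=; rewrite ?inE.
rewrite -(@bigfs _ _ _ _ s)//; last first.
  move=> n; rewrite inE/= => nr /negP ns; exfalso; apply: ns.
  have bnd i : (`|tnth n i| <= M%:Z)%R.
    have h : `|(tnth n i)%:~R / N : R| < r.
      apply: le_lt_trans nr; have := tnth_le_enorm (lattice_point N n) i.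
      by rewrite tnth_mktuple.
    move: h; rewrite normrM normfV (gtr0_norm N0) ltr_pdivrMr// => h.
    rewrite -(ler_int R) intr_norm (le_trans (ltW h))//.
    rewrite -pmulrn (le_trans (ltW (truncnS_gt _)))// ler_nat.
    exact: hM.
  apply/mapP; exists [tuple inord `|(tnth n i + M%:Z)%R|%N | i < d].
    by rewrite mem_enum.
  apply: eq_from_tnth => i; rewrite !tnth_mktuple.
  have /andP[b1 b2] : (- M%:Z <= tnth n i <= M%:Z)%R by rewrite -ler_norml.
  rewrite inordK; last by lia.
  by rewrite gez0_abs ?addrK//; lia.
rewrite big_map big_enum_cond/= /sinc_comb big_mkcond/=.
apply: eq_bigr => k _; rewrite lattice_pointE sampling_funE.
have -> : in_set (@lattice_ball R d N r) (shift_index k) = (enorm (lattice N k) < r).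
  rewrite -[LHS]/(shift_index k \in @lattice_ball R d N r).
  by apply/idP/idP; rewrite inE /lattice_ball/= lattice_pointE.
by case: ifP => // _; rewrite mul0r.
Qed.

End BallSum.

(** * Assembling the remainder estimate *)

Section Remainder.
Context {R : realType} (d : nat).
Local Notation mu := (lebesgue_measureRd d).

Lemma powR_pow_half (a : R) : 0 < a -> ((Num.sqrt a)^-1) ^+ d = (a `^ (- (d%:R / 4))) ^+ 2.
Proof.
move=> a0; rewrite -(powR12_sqrt (ltW a0)) -powRN.
rewrite -(@powR_mulrn _ (a `^ (- 2^-1)) d (powR_ge0 _ _)).
rewrite -(@powR_mulrn _ (a `^ (- (d%:R / 4))) 2 (powR_ge0 _ _)) -!powRrM.
by congr (_ `^ _); field.
Qed.

Lemma one_plus_pow_le (a : R) : 0 <= a -> (1 + a) ^+ d <= 2 ^+ d * (1 + a ^+ d).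
Proof.
move=> a0; have [a1|a1] := leP a 1.
  apply: (@le_trans _ _ (2 ^+ d)); first by rewrite lerXn2r ?nnegrE ?addr_ge0//; lra.
  by rewrite ler_peMr ?exprn_ge0// lerDl exprn_ge0.
apply: (@le_trans _ _ ((2 * a) ^+ d)).
  by rewrite lerXn2r ?nnegrE ?addr_ge0 ?mulr_ge0//; lra.
by rewrite exprMn ler_wpM2l ?exprn_ge0// lerDr.
Qed.

(** Converts the sqrt T of the moment estimate into the power of T in the theorem; for T > 1 this
    uses d >= 1. *)
Lemma sqrt_le_powR (T : R) : (1 <= d)%N -> 0 < T -> Num.sqrt T <= 1 + T `^ (d%:R / 2).
Proof.
move=> d1 T0; have [T1|T1] := leP T 1.
  apply: (@le_trans _ _ 1); last by rewrite lerDl powR_ge0.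
  by rewrite -[leRHS]sqrtr1 ler_wsqrtr.
rewrite -powR12_sqrt ?(ltW T0)//; apply: (@le_trans _ _ (T `^ (d%:R / 2))); last by rewrite lerDr.
by rewrite ler_powR ?(ltW T1)// -[leLHS]mul1r ler_wpM2r// ler1n.
Qed.

Lemma sqrD_le (u v : R) : (u + v) ^+ 2 <= 2 * u ^+ 2 + 2 * v ^+ 2.
Proof. by have := sqr_ge0 (u - v); lra. Qed.

Lemma sqrB_le (u v : R) : (u - v) ^+ 2 <= 2 * u ^+ 2 + 2 * v ^+ 2.
Proof. by rewrite -(sqrrN v) sqrD_le. Qed.

Lemma measurable_heat1 (T : R) : measurable_fun setT (heat1 T).
Proof.
apply: measurable_funM => //; apply: measurableT_comp => //; apply: measurableT_comp => //.
by apply: measurable_funM => //; exact: measurable_funX.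
Qed.

Lemma sampling_remainder_sq : (1 <= d)%N -> exists2 C : R, 0 < C &
  forall f : Rd R d -> R, measurable_fun setT f ->
  (\int[mu]_x ((1 + enorm x) ^+ 2 * f x ^+ 2)%:E < +oo)%E ->
  forall T N r : R, 0 < T -> 0 < N -> 1 <= r ->
  forall v : Rd R d -> R,
  (forall x, v x = \int[mu]_y (heat_kernel T (subRd x y) * f y)) ->
  let Rem x := v x -
    \sum_(n \in lattice_ball N r) v (lattice_point N n) * sampling_fun N n x in
  measurable_fun setT Rem /\
  (\int[mu]_x (Rem x ^+ 2)%:E <=
    ((C * (1 + (T * N ^+ 2) `^ (- (d%:R / 4))) *
      (expR (- (T * N ^+ 2)) +
       (1 + T `^ (d%:R / 2)) * (1 + T `^ (- (1 / 2))) * r^-1)) ^+ 2)%:E *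
    \int[mu]_x ((1 + enorm x) ^+ 2 * f x ^+ 2)%:E)%E.
Proof.
move=> d1.
have [C0 C0_gt0 lowC] := @low_frequency_part R.
(* A [kap] bounds both one-dimensional kernels: 1 for the heat kernel, C0 for its distance to G. *)
pose A := 1 + C0.
have A1 : 1 <= A by rewrite lerDl ltW.
(* [c1] collects the bounds of h in L^2 and on the lattice, [c2] that of the samples outside the
   ball. The factors 2 and 4 come from (u + v)^2 <= 2 u^2 + 2 v^2 used once or twice, and 18 = 2 * 9
   from [one_plus_pow_le] and [sum_kap]. *)
pose c1 : R := (d%:R * C0 * A ^+ d) ^+ 2 * (2 * (2 * pi) ^+ d ^+ 2 + 4 * (2 * pi) ^+ d * (18 * pi) ^+ d).
pose c2 : R := 4 * (2 * pi) ^+ d * (18 * pi) ^+ d * (4 * d%:R + 1) ^+ 2.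
have pi0 : 0 <= pi :> R := pi_ge0 R.
have c10 : 0 <= c1.
  by rewrite mulr_ge0 ?sqr_ge0// addr_ge0// !mulr_ge0 ?exprn_ge0 ?mulr_ge0 ?exprn_ge0 ?mulr_ge0.
have c20 : 0 <= c2.
  rewrite /c2 mulr_ge0 ?sqr_ge0// mulr_ge0 ?exprn_ge0 ?mulr_ge0 ?exprn_ge0 ?mulr_ge0//.
exists (1 + c1 + c2); first by rewrite -addrA ltr_wpDr ?addr_ge0.
move=> f mf W2oo T N r T0 N0 r1 v v_heat Rem.
set W2 := (\int[mu]_x _)%E in W2oo *.
set tau := T * N ^+ 2.
have tau0 : 0 < tau by rewrite mulr_gt0 ?exprn_gt0.
have r0 : 0 < r by rewrite (lt_le_trans _ r1).
have mw : measurable_fun setT (fun x : Rd R d => 1 + enorm x).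
  by apply: measurable_funD => //; exact: measurable_enorm.
have mf2 : measurable_fun setT (fun x => (f x ^+ 2)%:E).
  by apply/measurable_EFinP; exact: measurable_funX.
have mW : measurable_fun setT (fun x => ((1 + enorm x) ^+ 2 * f x ^+ 2)%:E).
  by apply/measurable_EFinP; apply: measurable_funM; exact: measurable_funX.
have FW : (\int[mu]_x (f x ^+ 2)%:E <= W2)%E.
  apply: ge0_le_integral => //; first by move=> x _; rewrite lee_fin sqr_ge0.
  by move=> x _; rewrite lee_fin ler_peMl ?sqr_ge0// exprn_ege1// lerDl enorm_ge0.
have f2 : (\int[mu]_x (f x ^+ 2)%:E < +oo)%E by exact: le_lt_trans FW W2oo.
have W20 : (0 <= W2)%E.
  by apply: integral_ge0 => x _; rewrite lee_fin mulr_ge0 ?sqr_ge0.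
have [G [sG cG] [D D0 hG]] := lowC tau tau0.
have GD z : `|G z| <= D * cauchy_kernel 1 z by exact: (hG z).1.
pose K := @prod_kernel R d (heat1 T).
pose L := @prod_kernel R d (scaled N G).
pose P := @prod_kernel R d (kap T N).
have vE x : v x = \int[mu]_y (K x y * f y).
  rewrite v_heat; apply: eq_Rintegral => y _; rewrite heat_kernelE//; congr (_ * _).
  by apply: eq_bigr => j _; rewrite tnth_mktuple.
have mh1 := measurable_heat1 T.
have mK := @measurable_prod_kernel R d _ mh1.
have mL := @measurable_prod_kernel R d _ (measurable_scaled N cG).
have mH : measurable_fun setT (fun p : Rd R d * Rd R d => K p.1 p.2 - L p.1 p.2).
  exact: measurable_funB.
have KP x y : `|K x y| <= 1 * P x y by rewrite mul1r; exact: prod_heat1_le.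
have intK := kernel_integrable T0 N0 mf f2 ltr01 mK KP.
have LP := prod_scaled_le (d := d) T0 N0 D0 GD.
have D1 : 0 < D ^+ d + 1 by rewrite ltr_wpDl// exprn_ge0.
have intL := kernel_integrable T0 N0 mf f2 D1 mL LP.
pose w := low_part N G f.
pose h x := \int[mu]_y ((K x y - L x y) * f y).
have hE x : h x = v x - w x.
  rewrite vE /w /low_part -RintegralB//.
  by apply: eq_Rintegral => y _; rewrite mulrBl.
pose e := d%:R * (C0 * expR (- tau)) * A ^+ d.
have e0 : 0 < e.
  by rewrite /e !mulr_gt0 ?expR_gt0 ?ltr0n ?exprn_gt0// (lt_le_trans _ A1).
have HP x y : `|K x y - L x y| <= e * P x y.
  have k0 j : 0 <= kap T N (tnth x j - tnth y j) by exact: kap_ge0.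
  have hd j : `|heat1 T (tnth x j - tnth y j) - scaled N G (tnth x j - tnth y j)| <=
      C0 * expR (- tau) * kap T N (tnth x j - tnth y j).
    set z := tnth x j - tnth y j; rewrite /scaled (heat1_scale z N0 T0) -mulrBr normrM (gtr0_norm N0).
    by rewrite kap_scale// [leRHS]mulrCA ler_wpM2l ?(ltW N0)//; exact: (hG _).2.
  have hk j : `|heat1 T (tnth x j - tnth y j)| <= 1 * kap T N (tnth x j - tnth y j).
    by rewrite mul1r ger0_norm ?heat1_ge0// heat1_le_kap.
  apply: prod_sub_bound => //.
  - by rewrite mulr_ge0 ?expR_ge0// ltW.
  - by move=> j; apply: (le_trans (hk j)); rewrite ler_wpM2r.
  - move=> j; set z := tnth x j - tnth y j.
    rewrite (_ : scaled N G z = heat1 T z - (heat1 T z - scaled N G z)); last by ring.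
    apply: (le_trans (ler_normB _ _)); rewrite /A mulrDl lerD ?hk//.
    apply: (le_trans (hd j)); rewrite ler_wpM2r// ler_piMr ?(ltW C0_gt0)//.
    by rewrite -expR0 ler_expR oppr_le0 ltW.
have mv : measurable_fun setT v.
  rewrite (_ : v = fun x => \int[mu]_y (K x y * f y)); last exact/funext.
  apply: (@measurable_Rintegral_param R _ _ _ _ mu (fun x y => K x y * f y)).
  apply: measurable_funM => //; apply: measurableT_comp => //; exact: measurable_snd.
have mh : measurable_fun setT h.
  apply: (@measurable_Rintegral_param R _ _ _ _ mu (fun x y => (K x y - L x y) * f y)).
  apply: measurable_funM => //; apply: measurableT_comp => //; exact: measurable_snd.
have [M0 hM0] := ball_sum d r N0.
have mRem : measurable_fun setT Rem.
  rewrite (_ : Rem = fun x => v x - sinc_comb N (fun k : d.-tuple 'I_M0.*2.+1 =>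
      if enorm (lattice N k) < r then v (lattice N k) else 0) x).
    by apply: measurable_funB => //; exact: measurable_sinc_comb.
  by apply/funext => x; rewrite -(hM0 _ (leqnn _) v).
split => //.
pose c M (k : d.-tuple 'I_M.*2.+1) : R := if enorm (lattice N k) < r then 0 else v (lattice N k).
(* The form c - h separates two l^2 bounds: h on the whole cube of nodes, and v outside the ball
   only. *)
pose g M x := h x + sinc_comb N (fun k => c M k - h (lattice N k)) x.
have gE M x : (M0 <= M)%N -> g M x = h x +
    sinc_comb N (fun k : d.-tuple 'I_M.*2.+1 => w (lattice N k)) x -
    \sum_(n \in lattice_ball N r) v (lattice_point N n) * sampling_fun N n x.
  move=> M0M; rewrite (hM0 M M0M v x) /g -addrA; congr (_ + _).
  rewrite /sinc_comb -sumrB; apply: eq_bigr => k _; rewrite -mulrBl; congr (_ * _).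
  by rewrite /c hE; case: ifP => _; ring.
(* The shift by M0 keeps every index in the range of [ball_sum]. *)
have gcvg x : g (n + M0)%N x @[n --> \oo] --> Rem x.
  rewrite (_ : (fun n => g (n + M0)%N x) = (fun n => h x +
    sinc_comb N (fun k : d.-tuple 'I_(n + M0).*2.+1 => w (lattice N k)) x -
    \sum_(n \in lattice_ball N r) v (lattice_point N n) * sampling_fun N n x)); last first.
    by apply/funext => n; rewrite gE// leq_addl.
  have -> : Rem x = h x + w x -
    \sum_(n \in lattice_ball N r) v (lattice_point N n) * sampling_fun N n x.
    by rewrite /Rem hE subrK.
  apply: cvgB; last exact: cvg_cst.
  apply: cvgD; first exact: cvg_cst.
  have := low_part_sampling T0 N0 sG cG D0 GD mf f2 (x := x).
  by rewrite -(cvg_shiftn M0).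
apply: (fatou_sq_bound (g := fun n => g (n + M0)%N)) gcvg _ => n.
  by apply: measurable_funD => //; exact: measurable_sinc_comb.
move: (n + M0)%N => M {n}.
have W2E : W2 = (fine W2)%:E by rewrite fineK// ge0_fin_numE.
set w2 := fine W2 in W2E; have w20 : 0 <= w2 by exact: fine_ge0.
rewrite W2E in FW *.
set E := expR (- tau); set q := 1 + tau `^ _; set V := _ * r^-1.
have E0 : 0 <= E by exact: expR_ge0.
have q1 : 1 <= q by rewrite lerDl powR_ge0.
pose p2 : R := (2 * pi) ^+ d; pose b : R := (18 * pi) ^+ d.
have p20 : 0 <= p2 by rewrite exprn_ge0// mulr_ge0.
have b0 : 0 <= b by rewrite exprn_ge0// mulr_ge0.
pose B : R := (N * (9 * pi * (1 + (Num.sqrt tau)^-1))) ^+ d.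
have si0 : 0 <= (Num.sqrt tau)^-1 by rewrite invr_ge0 sqrtr_ge0.
have B0 : 0 <= B by rewrite exprn_ge0// mulr_ge0 ?(ltW N0)// mulr_ge0 ?addr_ge0// mulr_ge0.
(* The N^-d of the Bessel inequality cancels the sampling density N^d contained in [B]. *)
have NB : N ^- d * B <= b * q ^+ 2.
  rewrite /B exprMn mulKf ?expf_neq0 ?gt_eqF// exprMn.
  apply: (@le_trans _ _ ((9 * pi) ^+ d * (2 ^+ d * (1 + (Num.sqrt tau)^-1 ^+ d)))).
    by rewrite ler_wpM2l ?one_plus_pow_le// exprn_ge0// mulr_ge0.
  rewrite mulrA -exprMn (_ : 9 * pi * 2 = 18 * pi); last by move: (pi : R) => u; ring.
  rewrite ler_wpM2l// powR_pow_half// /q; set t := tau `^ _.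
  have t0 : 0 <= t by exact: powR_ge0.
  rewrite sqrrD expr1n mul1r -addrA lerD2l lerDr.
  by rewrite mulrn_wge0.
have V0 : 0 <= V.
  by rewrite /V !mulr_ge0 ?invr_ge0 ?(ltW r0)// addr_ge0 ?powR_ge0.
pose m : R := 4 * d%:R * Num.sqrt T + 1.
have m0 : 0 <= m by rewrite addr_ge0// !mulr_ge0 ?sqrtr_ge0.
have mV : m * r^-1 <= (4 * d%:R + 1) * V.
  rewrite /V mulrA ler_wpM2r ?invr_ge0 ?(ltW r0)//.
  have h1 := sqrt_le_powR d1 T0; set u := 1 + _ in h1 *.
  have u1 : 1 <= u by rewrite lerDl powR_ge0.
  have u2 : u <= u * (1 + T `^ (- (1 / 2))).
    by rewrite ler_peMr ?(le_trans _ u1)// lerDl powR_ge0.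
  apply: (@le_trans _ _ ((4 * d%:R + 1) * u)); last by rewrite ler_wpM2l// addr_ge0// mulr_ge0.
  by rewrite /m [leRHS]mulrDl mul1r lerD// ler_wpM2l// mulr_ge0.
have H1 : (\int[mu]_x (h x ^+ 2)%:E <= ((e * p2) ^+ 2 * w2)%:E)%E.
  have := kernel_operator T0 N0 mf e0 mH HP.
  by move=> /le_trans; apply; rewrite (EFinM _ w2) lee_wpmul2l ?lee_fin ?sqr_ge0//.
have H4 : \sum_(k : d.-tuple 'I_M.*2.+1) h (lattice N k) ^+ 2 <= e ^+ 2 * p2 * B * w2.
  rewrite -lee_fin; have := kernel_sampled T0 N0 mf e0 mH HP M.
  move=> /le_trans; apply; rewrite (EFinM _ w2) lee_wpmul2l ?lee_fin//.
  by rewrite mulr_ge0// mulr_ge0// sqr_ge0.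
(* The datum with the weight that [enorm_prod_heat1_le] moves onto it. As 4 d sqrt T + |y| <= m (1 +
   |y|), its norm is at most m times the weighted norm of f. *)
pose f' y := (4 * d%:R * Num.sqrt T + enorm y) * `|f y|.
have mf' : measurable_fun setT f'.
  apply: measurable_funM; last exact: measurableT_comp.
  by apply: measurable_funD => //; exact: measurable_enorm.
have F'W : (\int[mu]_y (f' y ^+ 2)%:E <= (m ^+ 2 * w2)%:E)%E.
  rewrite EFinM -W2E /W2 -ge0_integralZl_EFin ?sqr_ge0//; last first.
    by move=> x _; rewrite lee_fin mulr_ge0 ?sqr_ge0.
  apply: ge0_le_integral => //.
  - by move=> y _; rewrite lee_fin sqr_ge0.
  - by apply/measurable_EFinP; exact: measurable_funX.
  - by apply: emeasurable_funM => //; exact: measurable_cst.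
  move=> y _; rewrite -EFinM lee_fin /f' exprMn real_normK ?num_real// [leRHS]mulrA.
  rewrite ler_wpM2r ?sqr_ge0// -exprMn.
  have n0 := enorm_ge0 y.
  have s0 : 0 <= 4 * d%:R * Num.sqrt T by rewrite !mulr_ge0 ?sqrtr_ge0.
  rewrite ler_sqr ?nnegrE ?addr_ge0 ?mulr_ge0 ?addr_ge0//.
  rewrite /m; move: (4 * d%:R * Num.sqrt T) (enorm y) s0 n0 => u z u0 z0.
  by rewrite mulrDl mul1r mulrDr mulr1 -addrA lerD2l addrA lerDr addr_ge0// mulr_ge0.
have f'2 : (\int[mu]_y (f' y ^+ 2)%:E < +oo)%E by exact: le_lt_trans F'W (ltry _).
have mkap : measurable_fun setT (kap T N).
  by apply: continuous_measurable_fun; exact: continuous_kap.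
have mP := @measurable_prod_kernel R d _ mkap.
have PP x y : `|P x y| <= 1 * P x y by rewrite mul1r ger0_norm// prod_kap_ge0.
have intP := kernel_integrable T0 N0 mf' f'2 ltr01 mP PP.
have vP x : enorm x * `|v x| <= \int[mu]_y (P x y * f' y).
  rewrite vE; apply: (@le_trans _ _ (enorm x * \int[mu]_y `|K x y * f y|)).
    by rewrite ler_wpM2l ?enorm_ge0// le_normr_Rintegral.
  have intKn : mu.-integrable setT (EFin \o (fun y => `|K x y * f y|)).
    by have := integrable_norm (intK x).
  rewrite -RintegralZl//; apply: le_Rintegral => //.
    rewrite (_ : _ \o _ = fun y => (enorm x)%:E * (EFin \o (fun y => `|K x y * f y|)%R) y)%E.
      by apply: integrableZl.
    by apply/funext => y; rewrite /= EFinM.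
  move=> y _; rewrite normrM mulrA /f' mulrA ler_wpM2r// mulrC [leRHS]mulrC mulrC.
  exact: enorm_prod_heat1_le.
have H5 : \sum_(k : d.-tuple 'I_M.*2.+1) c M k ^+ 2 <= r ^- 2 * (p2 * B * (m ^+ 2 * w2)).
  apply: (@le_trans _ _ (r ^- 2 * \sum_(k : d.-tuple 'I_M.*2.+1) (\int[mu]_y (P (lattice N k) y * f' y)) ^+ 2)).
    rewrite mulr_sumr; apply: ler_sum => k _; rewrite /c; case: ifPn => hr.
      by rewrite expr0n/= mulr_ge0 ?sqr_ge0// invr_ge0 sqr_ge0.
    (* Outside the ball r |v| <= |x| |v|, and [vP] bounds the latter; this is the source of the
       decay in r. *)
    rewrite -leNgt in hr; rewrite ler_pdivlMl ?exprn_gt0//.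
    rewrite -(real_normK (num_real (v _))) -exprMn.
    have I0 := le_trans (mulr_ge0 (enorm_ge0 _) (normr_ge0 _)) (vP (lattice N k)).
    rewrite ler_sqr ?nnegrE ?mulr_ge0 ?(ltW r0)//.
    by apply: le_trans (vP _); rewrite ler_wpM2r.
  rewrite ler_wpM2l ?invr_ge0 ?sqr_ge0// -lee_fin.
  have := kernel_sampled T0 N0 mf' ltr01 mP PP M; rewrite expr1n mul1r.
  move=> /le_trans; apply; rewrite (EFinM (p2 * B)) lee_wpmul2l ?lee_fin//.
  by rewrite mulr_ge0.
pose s := sinc_comb N (fun k => c M k - h (lattice N k)).
have H2 : (\int[mu]_x (s x ^+ 2)%:E <=
    (N ^- d * (2 * (r ^- 2 * (p2 * B * (m ^+ 2 * w2))) + 2 * (e ^+ 2 * p2 * B * w2)))%:E)%E.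
  apply: (le_trans (sinc_bessel_Rd _ N0)); rewrite lee_fin ler_wpM2l ?invr_ge0 ?exprn_ge0 ?(ltW N0)//.
  apply: (@le_trans _ _ (2 * \sum_k c M k ^+ 2 + 2 * \sum_(k : d.-tuple 'I_M.*2.+1) h (lattice N k) ^+ 2)).
    rewrite !mulr_sumr -big_split/=; apply: ler_sum => k _.
    move: (c M k) (h (lattice N k)) => u z.
    by exact: sqrB_le.
  by rewrite lerD// ler_wpM2l.
have ms : measurable_fun setT s by exact: measurable_sinc_comb.
apply: (@le_trans _ _ (\int[mu]_x (2%:E * (h x ^+ 2)%:E + 2%:E * (s x ^+ 2)%:E))%E).
  apply: ge0_le_integral => //.
  - by move=> x _; rewrite lee_fin sqr_ge0.
  - by apply/measurable_EFinP; apply: measurable_funX; exact: measurable_funD.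
  - by apply: emeasurable_funD; apply: emeasurable_funM; (exact: measurable_cst || (apply/measurable_EFinP; exact: measurable_funX)).
  move=> x _; rewrite -!EFinM -EFinD lee_fin /g -/s.
  move: (h x) (s x) => u z.
  by exact: sqrD_le.
rewrite ge0_integralD//; last 4 first.
- by move=> x _; rewrite -EFinM lee_fin mulr_ge0 ?sqr_ge0.
- by apply: emeasurable_funM; [exact: measurable_cst|apply/measurable_EFinP; exact: measurable_funX].
- by move=> x _; rewrite -EFinM lee_fin mulr_ge0 ?sqr_ge0.
- by apply: emeasurable_funM; [exact: measurable_cst|apply/measurable_EFinP; exact: measurable_funX].
rewrite !ge0_integralZl_EFin//; first last.
- by apply/measurable_EFinP; exact: measurable_funX.
- by move=> x _; rewrite lee_fin sqr_ge0.
- by apply/measurable_EFinP; exact: measurable_funX.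
- by move=> x _; rewrite lee_fin sqr_ge0.
have two0 : (0 <= 2%:E :> \bar R)%E by rewrite lee_fin.
apply: (le_trans (leeD (lee_wpmul2l two0 H1) (lee_wpmul2l two0 H2))).
rewrite -!EFinM -EFinD lee_fin.
rewrite [leLHS](_ : _ = (2 * e ^+ 2 * p2 ^+ 2 + 4 * e ^+ 2 * p2 * (N ^- d * B) +
   4 * p2 * (N ^- d * B) * (m * r^-1) ^+ 2) * w2); last first.
  by rewrite [(m * _) ^+ 2]exprMn exprVn; move: (N ^- d) (r ^- 2) => u z; ring.
rewrite ler_wpM2r//.
pose e1 : R := d%:R * C0 * A ^+ d.
have eE : e = e1 * E by rewrite /e mulrA mulrAC.
have e10 : 0 <= e1 by rewrite !mulr_ge0 ?exprn_ge0// ?(ltW C0_gt0)// (le_trans _ A1).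
have q20 : 1 <= q ^+ 2 by exact: exprn_ege1.
have hm : (m * r^-1) ^+ 2 <= (4 * d%:R + 1) ^+ 2 * V ^+ 2.
  rewrite -exprMn ler_sqr ?nnegrE//; first by rewrite mulr_ge0 ?invr_ge0 ?(ltW r0).
  by rewrite mulr_ge0// addr_ge0// mulr_ge0.
(* Two of the three terms carry q^2 through [NB]; the L^2 term of h acquires it because q^2 >= 1. *)
apply: (@le_trans _ _ (q ^+ 2 * (c1 * E ^+ 2 + c2 * V ^+ 2))).
  rewrite (_ : q ^+ 2 * _ = 2 * e ^+ 2 * p2 ^+ 2 * q ^+ 2 + 4 * e ^+ 2 * p2 * (b * q ^+ 2) +
      4 * p2 * (b * q ^+ 2) * ((4 * d%:R + 1) ^+ 2 * V ^+ 2)); last first.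
    by rewrite /c1 /c2 eE -/p2 -/b -/e1; ring.
  have B1 : 0 <= N ^- d * B by rewrite mulr_ge0// invr_ge0 exprn_ge0// ltW.
  apply: lerD; first apply: lerD.
  - by rewrite ler_peMr// (mulr_ge0 (mulr_ge0 (ler0n R 2) (sqr_ge0 e)) (sqr_ge0 p2)).
  - by rewrite ler_wpM2l// (mulr_ge0 (mulr_ge0 (ler0n R 4) (sqr_ge0 e)) p20).
  - apply: ler_pM => //.
    + exact: mulr_ge0 (mulr_ge0 (ler0n R 4) p20) B1.
    + exact: sqr_ge0.
    + by rewrite ler_wpM2l// mulr_ge0.
rewrite (_ : (_ * q * _) ^+ 2 = q ^+ 2 * ((1 + c1 + c2) ^+ 2 * (E + V) ^+ 2)); last by ring.
rewrite ler_wpM2l ?sqr_ge0//.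
have EV0 : 0 <= E * V by exact: mulr_ge0.
have EEV : E ^+ 2 <= (E + V) ^+ 2 by rewrite ler_sqr ?nnegrE ?addr_ge0// lerDl.
have VEV : V ^+ 2 <= (E + V) ^+ 2 by rewrite ler_sqr ?nnegrE ?addr_ge0// lerDr.
apply: (@le_trans _ _ ((c1 + c2) * (E + V) ^+ 2)).
  by rewrite mulrDl lerD// ler_wpM2l.
(* The constant enters squared; its summand 1 makes it at least 1, so its square still dominates c1
   + c2. *)
rewrite ler_wpM2r ?sqr_ge0// -addrA; apply: (@le_trans _ _ (1 + (c1 + c2))).
  by rewrite lerDr.
by rewrite expr2 ler_peMr// ?lerDl ?addr_ge0// addr_ge0.
Qed.

End Remainder.

Lemma Lnorm2_le (R : realType) d (T : measurableType d) (mu : {measure set T -> \bar R})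
    (g : T -> R) (a : R) (W : \bar R) : 0 <= a -> (0 <= W)%E ->
  (\int[mu]_x (g x ^+ 2)%:E <= (a ^+ 2)%:E * W)%E ->
  ('N[mu]_2%:E [EFin \o g] <= a%:E * W `^ (1 / 2))%E.
Proof.
move=> a0 W0 h.
rewrite unlock /Lnorm/=.
under eq_integral do rewrite powR_mulrn// real_normK ?num_real//.
have -> : (a%:E * W `^ (1 / 2) = ((a ^+ 2)%:E * W) `^ 2^-1)%E.
  rewrite div1r poweRM ?lee_fin ?sqr_ge0// poweR_EFin -powR_mulrn// -powRrM.
  by rewrite mulfV// powRr1.
rewrite gt0_ler_poweR// in_itv/= leey andbT.
  by apply: integral_ge0 => x _; rewrite lee_fin sqr_ge0.
by rewrite mule_ge0// lee_fin sqr_ge0.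
Qed.

Theorem theorem3p2 (R : realType) (d : nat) (d_ge1 : (1 <= d)%N) :
  exists C : R, 0 < C /\
  forall u : R -> Rd R d -> R,
    heat_solution u ->
    (\int[lebesgue_measureRd d]_x ((1 + enorm x) ^+ 2 * `|u 0 x| ^+ 2)%:E
      < +oo)%E ->
  forall T N r : R, 0 < T -> 0 < N -> 1 <= r ->
  exists Rem : Rd R d -> R,
    [/\ Rem \in Lfun (lebesgue_measureRd d) 2%:E,
      ('N[lebesgue_measureRd d]_2%:E [EFin \o Rem] <=
        (C * (1 + (T * N ^+ 2) `^ (- (d%:R / 4))) *
          (expR (- (T * N ^+ 2)) +
           (1 + T `^ (d%:R / 2)) * (1 + T `^ (- (1 / 2))) * r^-1))%:E *
        (\int[lebesgue_measureRd d]_x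
          ((1 + enorm x) ^+ 2 * `|u 0 x| ^+ 2)%:E) `^ (1 / 2))%E
    & {ae lebesgue_measureRd d, forall x,
        u T x = (\sum_(n \in lattice_ball N r)
                   u T (lattice_point N n) * sampling_fun N n x) + Rem x}].
Proof.
have [C C0 bound] := @sampling_remainder_sq R d d_ge1.
exists C; split => // u [u0L uE].
have -> : (\int[lebesgue_measureRd d]_x ((1 + enorm x) ^+ 2 * `|u 0 x| ^+ 2)%:E =
    \int[lebesgue_measureRd d]_x ((1 + enorm x) ^+ 2 * u 0 x ^+ 2)%:E)%E.
  by apply: eq_integral => x _; rewrite real_normK ?num_real.
set W := (\int[_]_x _)%E => Woo T N r T0 N0 r1.
have W0 : (0 <= W)%E.
  by apply: integral_ge0 => x _; rewrite lee_fin mulr_ge0 ?sqr_ge0.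
have mu0 : measurable_fun setT (u 0).
  by move: u0L; rewrite inE => /andP[+ _]; rewrite inE.
have uT x : u T x = \int[lebesgue_measureRd d]_y (heat_kernel T (subRd x y) * u 0 y).
  by rewrite uE ?(ltW T0)// /heat_semigroup gt_eqF.
have [mRem Rem2] := bound _ mu0 Woo T N r T0 N0 r1 (u T) uT.
exists (fun x => u T x - \sum_(n \in lattice_ball N r) u T (lattice_point N n) * sampling_fun N n x).
set a := (X in _ (X ^+ 2)%:E _) in Rem2.
have a0 : 0 <= a.
  rewrite /a mulr_ge0//.
    by rewrite mulr_ge0 ?(ltW C0)// addr_ge0// powR_ge0.
  by rewrite addr_ge0 ?expR_ge0// !mulr_ge0 ?addr_ge0 ?powR_ge0// invr_ge0 (le_trans _ r1).
have nrm := Lnorm2_le a0 W0 Rem2.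
split => //.
- rewrite inE; apply/andP; split; rewrite inE//.
  rewrite /= /finite_norm; apply: (le_lt_trans nrm).
  by rewrite lte_mul_pinfty ?lee_fin// poweR_lty.
(* The identity holds at every point, the remainder being defined by subtraction. *)
- by apply: aeW => x; rewrite addrC subrK.
Qed.
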